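(* Let $n\ge 2$, let $Q_n\in\mathrm{Kom}^-(n)$ be a symmetric projector and $P_n$ a Cooper--Krushkal projector. Let $U_n\in\mathrm{END}(P_n)$ denote the chain map (of bidegree $(2-2n,2n)$) coming from the action of $u_n$ (multiplication by $u_n$) on the complex $\mathbb Z[u_n]\otimes Q_n$ with differential $1\otimes d_{Q_n}+u_n\otimes\partial_n$, which is homotopy equivalent to $P_n$. Then $$Q_n\simeq\mathrm{Cone}(U_n).$$
   Context: **Cobordism categories.** Fix $2n$ points on the boundary of the rectangle $[0,1]^2$, $n$ on top and $n$ on the bottom. $\mathrm{Cob}_n$ has objects $q^jT$ ($j\in\mathbb Z$), $T\subset[0,1]^2$ a properly embedded compact 1-manifold with boundary these points. Morphisms $q^iT\to q^jT'$ are $\mathbb Z$-linear combinations of properly embedded dotted surfaces $S\subset[0,1]^2\times[0,1]$ with bottom $T$, top $T'$ and vertical boundary (the $2n$ points)$\times[0,1]$, of degree $n+j-i-\chi(S)+2\#\text{dots}=0$, modulo isotopy rel boundary, free motion of dots on components, and the local relations: sphere $=0$; sphere with one dot $=1$; two dots on one sheet $=0$; neck cutting (a neck equals the two capping disks with a dot on the first, plus the two disks with a dot on the second); hence a handle is twice a dot. $\mathcal{TL}_n$ is the additive category of formal finite direct sums of objects and matrices of morphisms. $1_n$ is the diagram of $n$ vertical strands; $a\otimes b$ is vertical stacking ($a$ on top of $b$); $\sqcup$ is horizontal juxtaposition. **Complexes.** $\mathrm{Kom}(n)$ is the category of (possibly unbounded) complexes over $\mathcal{TL}_n$ with differential of degree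 $+1$ and degree $0$ chain maps; $\mathrm{Kom}^-(n)$ is the full subcategory of complexes bounded above. $\otimes,\sqcup$ extend to $\mathrm{Kom}^-$ by the usual tensor product rule. $\simeq$ is homotopy equivalence. $t,q$ are upward shifts of homological and $q$-degree, $(tA)_k=A_{k-1}$, $d_{tA}=-d_A$. $\mathrm{HOM}(A,B)$ is the complex with $\mathrm{HOM}^{i,j}(A,B)=\prod_k\mathrm{Hom}_{\mathcal{TL}_n}(q^jA_k,B_{k+i})$ and differential $f\mapsto d_Bf-(-1)^{i}fd_A$; $\mathrm{END}(A)=\mathrm{HOM}(A,A)$. A chain map of bidegree $(i,j)$ is a cycle in $\mathrm{HOM}^{i,j}(A,B)$, i.e. a degree-zero chain map $t^iq^jA\to B$. For a degree-zero chain map $f:A\to B$, $\mathrm{Cone}(f)=t^{-1}A\oplus B$ with differential $\begin{pmatrix}-d_A&0\\ f&d_B\end{pmatrix}$; for $f$ of bidegree $(i,j)$, $\mathrm{Cone}(f)$ is the cone of $t^iq^jA\to B$. For an indeterminate $x$ of bidegree $(a,b)$, $\mathbb Z[x]\otimes C=\bigoplus_{k\ge0}t^{ak}q^{bk}C$, and $x\otimes f$ sends the $x^k$-copy to the $x^{k+1}$-copy by $f$. **Cooper--Krushkal projectors.** The through-degree $\tau(a)$ of a diagram $a$ is the minimal $k$ such that $a$ factors (vertically) through $k$ points; $\tau(A)$ of a complex is the maximum over diagrams occurring in its chain groups. $C\in\mathrm{Kom}^-(n)$ kills turnbacks if $C\otimes N\simeq0\simeq N\otimes C$ for all $N\in\mathrm{Kom}^-(n)$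 with $\tau(N)<n$. A Cooper--Krushkal projector is $(P_n,\iota)$ with $P_n\in\mathrm{Kom}^-(n)$ killing turnbacks and $\iota:1_n\to P_n$ a chain map such that $\mathrm{Cone}(\iota)$ is homotopy equivalent to a complex of through-degree $<n$. It is unique up to homotopy equivalence. **Symmetric projectors.** Let $c_i\in\mathcal{TL}_n$ be the cup-cap diagram on strands $i,i+1$ (from the left), $D_0=1_n$, $D_k=c_{n-1}\otimes c_{n-2}\otimes\cdots\otimes c_{n-k}$. Given $K\in\mathrm{Kom}^-(n-1)$ killing turnbacks, let $[K]_k=(K\sqcup1_1)\otimes D_k$. The symmetric Cooper--Krushkal sequence relative to $K$ is $E_{1-2n}\to\cdots\to E_{-1}\to E_0$ with $E_{-k}=q^k[K]_k$ and $E_{1-2n+k}=q^{2n-k}[K]_k$ for $0\le k\le n-1$. Maps: $E_{-k}\to E_{-k+1}$ ($1\le k\le n-1$) is induced by the saddle $q\,c_{n-k}\to 1_n$; $E_{1-2n+k-1}\to E_{1-2n+k}$ ($1\le k\le n-1$) is induced by the saddle $q\,1_n\to c_{n-k}$; the middle map $E_{-n}=q^{n+1}[K]_{n-1}\to E_{1-n}=q^{n-1}[K]_{n-1}$ is the identity cobordism with a dot on the arc of $D_{n-1}$ attached to the leftmost bottom endpoint of $K$, minus the identity cobordism with a dot on the arc of $D_{n-1}$ joining the bottom points $1$ and $2$. Consecutive maps compose to null-homotopic maps. A convolution of a sequence $(E_i,\alpha_i)$ is a complex equal, as a graded object, to $\bigoplus_i t^iE_i$ with differential having components $d_{ii}=(-1)^id_{E_i}$,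 $d_{i+1,i}=\alpha_i$, and $d_{ij}=0$ for $i<j$ (the components $d_{ij}$ with $i>j+1$ arbitrary). A symmetric projector $Q_n$ is a convolution of the symmetric Cooper--Krushkal sequence relative to some Cooper--Krushkal projector $P_{n-1}$. **The map $\partial_n$ and the periodic complex.** Let $\eta_n:P_{n-1}\sqcup1_1=E_0\to Q_n$ be the inclusion of the last term and $\varepsilon_n:Q_n\to t^{1-2n}E_{1-2n}=t^{1-2n}q^{2n}(P_{n-1}\sqcup1_1)$ the projection onto the first term; $\partial_n=-\eta_n\circ\varepsilon_n\in\mathrm{END}(Q_n)$ has bidegree $(2n-1,-2n)$. The indeterminate $u_n$ has bidegree $(2-2n,2n)$. The complex $\mathbb Z[u_n]\otimes Q_n$ with differential $1\otimes d_{Q_n}+u_n\otimes\partial_n$ is a Cooper--Krushkal projector; conjugating multiplication by $u_n$ with a homotopy equivalence to $P_n$ gives $U_n$. *)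

(* Defs.v *)
From HB Require Import structures.
From mathcomp Require Import all_boot all_order all_algebra.
From mathcomp Require Import finmap.
From mathcomp Require Import all_classical all_reals all_analysis.
Set Implicit Arguments.
Unset Strict Implicit.
Unset Printing Implicit Defensive.
Import Order.TTheory GRing.Theory Num.Theory.
Import numFieldNormedType.Exports.
Local Open Scope classical_set_scope.
Local Open Scope ring_scope.

(* The cobordism category is set up in the topological category: tangles and
   surfaces are subsets of the square and of the cube, tameness is local
   flatness, and isotopies are ambient.  In these dimensions this agrees with
   the smooth theory.  Operations act on raw subsets; that the subsets are
   tangles or cobordisms is expressed by the predicates [tangle] and [cob]. *)

(** * Topology *)

Definition homeo_on (P P' : topologicalType) (A : set P) (B : set P')
    (f : P -> P') (g : P' -> P) : Prop :=
  [/\ {within A, continuous f}, {within B, continuous g},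
      (forall p, A p -> B (f p) /\ g (f p) = p)
    & (forall q, B q -> A (g q) /\ f (g q) = q)].

(* Every point of S has a neighbourhood in X which is carried, together with
   its intersection with S, to an open piece of the model pair (M, F). *)
Definition locally_flat (P : topologicalType) (X S M F : set P) : Prop :=
  forall p, S p -> exists (U V : set P) (f g : P -> P),
    [/\ open U, open V, U p, homeo_on (U `&` X) (V `&` M) f g
      & forall u, (U `&` X) u -> (S u <-> F (f u))].

Section Geometry.
Context {R : realType}.
Local Notation P2 := (R * R)%type.
Local Notation P3 := ((R * R) * R)%type.   (* ((x, y), t) *)

Definition unitI : set R := [set s | 0 <= s <= 1].
Definition openI : set R := [set s | 0 < s < 1].
Definition square : set P2 := [set p | unitI p.1 /\ unitI p.2].
Definition bd_square : set P2 :=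
  [set p | square p /\ ~ (openI p.1 /\ openI p.2)].
Definition cube : set P3 := [set p | square p.1 /\ unitI p.2].

(* For X compact each H s is then a homeomorphism of X. *)
Definition ambient_isotopy (P : topologicalType) (X : set P)
    (H : R -> P -> P) : Prop :=
  [/\ {within [set sp : R * P | unitI sp.1 /\ X sp.2],
         continuous (fun sp : R * P => H sp.1 sp.2)},
      (forall p, X p -> H 0 p = p)
    & (forall s, unitI s -> set_bij X X (H s))].

(** ** Tangles *)

(* Position of the j-th of n strands, j = 0, ..., n-1 from the left.  With this
   choice juxtaposition of m and m' strands, in widths m : m', matches the
   positions of m + m' strands. *)
Definition strand (n j : nat) : R := (2 * j + 1)%:R / (2 * n)%:R.

Definition marks (b t : nat) : set P2 :=
  [set p | (exists2 j, (j < b)%N & p = (strand b j, 0)) \/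
           (exists2 j, (j < t)%N & p = (strand t j, 1))].

(* T is a disjoint union of the a arcs ga i and the c circles de j. *)
Definition arcs_and_circles (T : set P2) (a c : nat)
    (ga : 'I_a -> R -> P2) (de : 'I_c -> R -> P2) : Prop :=
  [/\ (forall i, {within unitI, continuous (ga i)} /\ set_inj unitI (ga i))
      /\ (forall j, [/\ {within unitI, continuous (de j)},
            set_inj [set s | 0 <= s < 1] (de j) & de j 0 = de j 1]),
      T = (\bigcup_i (ga i @` unitI)) `|` (\bigcup_j (de j @` unitI)),
      (forall i i', i != i' -> ga i @` unitI `&` ga i' @` unitI = set0)
      /\ (forall j j', j != j' -> de j @` unitI `&` de j' @` unitI = set0),
      (forall i j, ga i @` unitI `&` de j @` unitI = set0)
    & (forall i s, unitI s -> (bd_square (ga i s) <-> s = 0 \/ s = 1))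
      /\ (forall j s, unitI s -> ~ bd_square (de j s))].

(* Properly embedded compact 1-manifold in the square with b bottom and t top
   endpoints.  A compact 1-manifold is a finite disjoint union of arcs and
   circles. *)
Definition tangle (b t : nat) (T : set P2) : Prop :=
  [/\ T `<=` square, T `&` bd_square = marks b t,
      locally_flat square T [set p | 0 <= p.2] [set p | p.1 = 0]
    & exists a c ga de, @arcs_and_circles T a c ga de].

Definition tangle_isotopic (T T' : set P2) : Prop :=
  exists H : R -> P2 -> P2, [/\ ambient_isotopy square H,
    (forall s p, unitI s -> bd_square p -> H s p = p) & T' = H 1 @` T].

(** ** Dotted surfaces *)

(* [dots] is a multiset of points, given in some order. *)
Record dsurf := DSurf { body : set P3; dots : seq P3 }.
HB.instance Definition _ := gen_eqMixin dsurf.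
HB.instance Definition _ := gen_choiceMixin dsurf.

Definition at_height (T : set P2) (s : R) : set P3 :=
  [set p | T p.1 /\ p.2 = s].

(* The surface is vertical near its bottom and top, so that stacking two
   surfaces gives a locally flat surface.  The model pair is the quarter space
   {0 <= y, 0 <= t} with its half-plane x = 0; the quarter space is
   homeomorphic to a half space, and its two faces serve the walls and the
   bottom or top of the cube. *)
Definition cob (n : nat) (T T' : set P2) (S : dsurf) : Prop :=
  [/\ [/\ tangle n n T, tangle n n T', closed (body S) & body S `<=` cube],
      locally_flat cube (body S)
        [set p | 0 <= p.1.2 /\ 0 <= p.2] [set p | p.1.1 = 0],
      (exists e : R, 0 < e /\
        forall p s, square p -> 0 <= s <= e ->
          (body S (p, s) <-> T p) /\ (body S (p, 1 - s) <-> T' p)),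
      (forall p s, bd_square p -> unitI s -> (body S (p, s) <-> marks n n p))
    & {in dots S, forall d, body S d}].

Definition open_cell (d : nat) : set P2 :=
  match d with
  | 0 => [set (0, 0)]
  | 1 => [set p | p.2 = 0]
  | _ => setT
  end.

(* [attach A X c]: X is obtained from A by successively adding open cells of
   dimension at most 2, all stages being closed, and c is the alternating
   number of cells added. *)
Inductive attach (A : set P3) : set P3 -> int -> Prop :=
| attach_nil : attach A A 0
| attach_cell (X E : set P3) (c : int) (d : nat) (f : P3 -> P2) (g : P2 -> P3) :
    attach A X c -> (d <= 2)%N -> homeo_on E (open_cell d) f g ->
    X `&` E = set0 -> closed (X `|` E) ->
    attach A (X `|` E) (c + (-1) ^+ d).

(* chi(S) = c, computed from a cell decomposition of S that starts with one of
   its top boundary T' at height 1; T' consists of n arcs and some circles,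
   and so has Euler characteristic n. *)
Definition euler (n : nat) (T' : set P2) (S : dsurf) (c : int) : Prop :=
  exists c', [/\ attach set0 (at_height T' 1) n%:Z,
    attach (at_height T' 1) (body S) c' & c = n%:Z + c'].

(* The bottom and top are fixed.  On the walls points may move vertically; by
   using a collar such an isotopy can be replaced by one that is fixed there. *)
Definition surf_isotopic (S S' : dsurf) : Prop :=
  exists H : R -> P3 -> P3, [/\ ambient_isotopy cube H,
    (forall s p, unitI s -> cube p -> (p.2 = 0 \/ p.2 = 1) -> H s p = p),
    (forall s p, unitI s -> cube p -> bd_square p.1 -> (H s p).1 = p.1),
    body S' = H 1 @` body S & dots S' = map (H 1) (dots S)].

(** ** Linear combinations *)

Definition lincomb := seq (int * dsurf).

Definition coef (S : dsurf) (f : lincomb) : int :=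
  \sum_(c <- f | c.2 == S) c.1.

Definition lscale (a : int) (f : lincomb) : lincomb :=
  [seq (a * c.1, c.2) | c <- f].

Definition lbilin (o : dsurf -> dsurf -> dsurf) (f g : lincomb) : lincomb :=
  [seq (c.1 * c'.1, o c.2 c'.2) | c <- f, c' <- g].

Definition cobs (n : nat) (T T' : set P2) (f : lincomb) : Prop :=
  {in f, forall c, cob n T T' c.2}.

(* Union of the images under two maps; stacking and juxtaposition are of this
   form, with affine embeddings. *)
Definition dunion (f g : P3 -> P3) (S S' : dsurf) : dsurf :=
  DSurf (f @` body S `|` g @` body S') (map f (dots S) ++ map g (dots S')).

Definition scomp (S' S : dsurf) : dsurf :=
  dunion (fun p => (p.1, (1 + p.2) / 2)) (fun p => (p.1, p.2 / 2)) S' S.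
Definition lcomp : lincomb -> lincomb -> lincomb := lbilin scomp.

Definition cylinder (T : set P2) : set P3 := [set p | T p.1 /\ unitI p.2].
Definition lid (T : set P2) : lincomb := [:: (1, DSurf (cylinder T) [::])].

(** ** The local relations *)

Definition chart (e : P3 -> P3) : Prop :=
  [/\ continuous e, injective e
    & forall p, [/\ openI (e p).1.1, openI (e p).1.2 & openI (e p).2]].

Definition nsq2 (p : P3) : R := p.1.1 ^+ 2 + p.1.2 ^+ 2.
Definition nsq3 (p : P3) : R := nsq2 p + p.2 ^+ 2.
Definition sphere : set P3 := [set p | nsq3 p = 1].
Definition ball2 : set P3 := [set p | nsq3 p <= 4].
(* {r = 1, |z| <= h} and {r <= 2, |z| <= 2} *)
Definition tube (h : R) : set P3 := [set p | nsq2 p = 1 /\ `|p.2| <= h].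
Definition drum2 : set P3 := [set p | nsq2 p <= 4 /\ `|p.2| <= 2].
Definition caps : set P3 := [set p | nsq2 p <= 1 /\ `|p.2| = 1].

Definition neck_cut (e : P3 -> P3) (B : set P3) : set P3 :=
  (B `\` e @` tube 1) `|` e @` caps.

(* Equality of linear combinations of dotted cobordisms from T to T' modulo
   isotopy, motion of dots, and the local relations. *)
Inductive meq (n : nat) : set P2 -> set P2 -> lincomb -> lincomb -> Prop :=
| meq_lin T T' f g : cobs n T T' f -> cobs n T T' g ->
    (forall S, coef S f = coef S g) -> meq n T T' f g
| meq_sym T T' f g : meq n T T' f g -> meq n T T' g f
| meq_trans T T' f g h :
    meq n T T' f g -> meq n T T' g h -> meq n T T' f h
| meq_add T T' f f' g g' : meq n T T' f f' -> meq n T T' g g' ->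
    meq n T T' (f ++ g) (f' ++ g')
| meq_comp T T' T'' f f' g g' : meq n T T' f f' -> meq n T' T'' g g' ->
    meq n T T'' (lcomp g f) (lcomp g' f')
| meq_isotopy T T' S S' : cob n T T' S -> cob n T T' S' ->
    surf_isotopic S S' -> meq n T T' [:: (1, S)] [:: (1, S')]
| meq_dots_perm T T' B ds ds' : cob n T T' (DSurf B ds) -> perm_eq ds ds' ->
    meq n T T' [:: (1, DSurf B ds)] [:: (1, DSurf B ds')]
| meq_dot_move T T' B d d' ds : cob n T T' (DSurf B (d :: ds)) ->
    connected_component B d d' ->
    meq n T T' [:: (1, DSurf B (d :: ds))] [:: (1, DSurf B (d' :: ds))]
| meq_two_dots T T' B d d' ds : cob n T T' (DSurf B [:: d, d' & ds]) ->
    connected_component B d d' ->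
    meq n T T' [:: (1, DSurf B [:: d, d' & ds])] [::]
| meq_sphere T T' B ds e : cob n T T' (DSurf B ds) -> chart e ->
    B `&` e @` ball2 = e @` sphere ->
    {in ds, forall d, ~ (e @` ball2) d} ->
    meq n T T' [:: (1, DSurf B ds)] [::]
| meq_dotted_sphere T T' B d ds e : cob n T T' (DSurf B (d :: ds)) -> chart e ->
    B `&` e @` ball2 = e @` sphere ->
    (e @` sphere) d -> {in ds, forall d', ~ (e @` ball2) d'} ->
    cob n T T' (DSurf (B `\` e @` sphere) ds) ->
    meq n T T' [:: (1, DSurf B (d :: ds))]
               [:: (1, DSurf (B `\` e @` sphere) ds)]
| meq_neck T T' B ds e : cob n T T' (DSurf B ds) -> chart e ->
    B `&` e @` drum2 = e @` tube 2 ->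
    {in ds, forall d, ~ (e @` drum2) d} ->
    cob n T T' (DSurf (neck_cut e B) ds) ->
    meq n T T' [:: (1, DSurf B ds)]
      [:: (1, DSurf (neck_cut e B) (e ((0, 0), 1) :: ds));
          (1, DSurf (neck_cut e B) (e ((0, 0), - 1) :: ds))].

(* f represents a morphism q^i T -> q^j T' of Cob_n. *)
Definition cob_hom (n : nat) (i : int) (T : set P2) (j : int) (T' : set P2)
    (f : lincomb) : Prop :=
  {in f, forall c, cob n T T' c.2 /\ exists2 chi : int,
    euler n T' c.2 chi & n%:Z + j - i - chi + 2 * (size (dots c.2))%:Z = 0}.

(** ** Stacking and juxtaposition *)

Definition lift3 (f : P2 -> P2) (p : P3) : P3 := (f p.1, p.2).

Definition vtop (p : P2) : P2 := (p.1, (1 + p.2) / 2).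
Definition vbot (p : P2) : P2 := (p.1, p.2 / 2).
Definition vstack (a b : set P2) : set P2 := vtop @` a `|` vbot @` b.
Definition lvstack : lincomb -> lincomb -> lincomb :=
  lbilin (dunion (lift3 vtop) (lift3 vbot)).

Definition hleft (m m' : nat) (p : P2) : P2 :=
  (m%:R * p.1 / (m + m')%:R, p.2).
Definition hright (m m' : nat) (p : P2) : P2 :=
  ((m%:R + m'%:R * p.1) / (m + m')%:R, p.2).
Definition hjuxt (m m' : nat) (a b : set P2) : set P2 :=
  hleft m m' @` a `|` hright m m' @` b.
Definition lhjuxt (m m' : nat) : lincomb -> lincomb -> lincomb :=
  lbilin (dunion (lift3 (hleft m m')) (lift3 (hright m m'))).

(** ** The diagrams c_i, D_k and the saddles *)

Definition vlines (n : nat) : set P2 :=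
  [set p | unitI p.2 /\ exists2 j, (j < n)%N & p.1 = strand n j].

(* In the coordinates X, Y in which strands i and i+1 (counted from 1) are
   X = -1 and X = 1 and the square is -1 <= Y <= 1, the level curves
     X^2 - Y^2 = s (1 - Y^2)  (0 <= s <= 1),
     X^2 - Y^2 = s (1 - X^2)  (-1/2 <= s <= 0)
   all pass through (+-1, +-1).  They are the two vertical strands for s = 1
   and a cup and a cap for s < 0, with a crossing at s = 0. *)
Definition saddle_level (n i : nat) (s : R) : set P2 :=
  [set p | unitI p.2 /\
    ((exists j, [/\ (j < n)%N, j != i.-1, j != i & p.1 = strand n j]) \/
     let X := (2 * n)%:R * p.1 - (2 * i)%:R in
     let Y := 2 * p.2 - 1 in
     `|X| <= 1 /\
     X ^+ 2 - Y ^+ 2 =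
       if 0 <= s then s * (1 - Y ^+ 2) else s * (1 - X ^+ 2))].

Definition cupcap (n i : nat) : set P2 := saddle_level n i (- (1 / 2)).

(* -1/2 for t <= 1/4, 1 for t >= 3/4, affine in between *)
Definition saddle_param (t : R) : R :=
  Num.min 1 (Num.max (- (1 / 2)) (3 * t - 5 / 4)).

Definition saddle_to_id (n i : nat) : set P3 :=
  [set p | unitI p.2 /\ saddle_level n i (saddle_param p.2) p.1].
Definition saddle_from_id (n i : nat) : set P3 :=
  [set p | unitI p.2 /\ saddle_level n i (saddle_param (1 - p.2)) p.1].

(* The l-th of N equal horizontal layers, l = 0 being the top one. *)
Definition layer (N l : nat) (p : P2) : P2 :=
  (p.1, (p.2 + (N - l.+1)%:R) / N%:R).

(* D_k = c_{n-1} c_{n-2} ... c_{n-k}, drawn in n-1 equal layers of which those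
   below the k-th are identity diagrams; so D_0 = 1_n. *)
Definition Dlayer (n k l : nat) : set P2 :=
  if (l < k)%N then cupcap n (n - l.+1) else vlines n.
Definition Ddiag (n k : nat) : set P2 :=
  \bigcup_(l in [set l | (l < n.-1)%N]) (layer n.-1 l @` Dlayer n k l).

(* The surface which is S in layer l0 and the identity of D_k elsewhere. *)
Definition in_layer (n k l0 : nat) (S : set P3) : set P3 :=
  \bigcup_(l in [set l | (l < n.-1)%N])
    (lift3 (layer n.-1 l) @`
       (if l == l0 then S else cylinder (Dlayer n k l))).

(* D_{k+1} -> D_k and D_k -> D_{k+1} *)
Definition Dsaddle_down (n k : nat) : lincomb :=
  [:: (1, DSurf (in_layer n k k (saddle_to_id n (n - k.+1))) [::])].
Definition Dsaddle_up (n k : nat) : lincomb :=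
  [:: (1, DSurf (in_layer n k k (saddle_from_id n (n - k.+1))) [::])].

(* The leftmost bottom endpoint of K is glued to the leftmost top point of
   D_{n-1}; the arc joining the bottom points 1 and 2 starts at the leftmost
   bottom point. *)
Definition Ddot (n : nat) : lincomb :=
  let D := cylinder (Ddiag n n.-1) in
  [:: (1, DSurf D [:: ((strand n 0, 1), 1 / 2)]);
      (-1, DSurf D [:: ((strand n 0, 0), 1 / 2)])].

(** ** Through-degree *)

Definition factors_through (n : nat) (T : set P2) (k : nat) : Prop :=
  exists a b, [/\ tangle k n a, tangle n k b & tangle_isotopic T (vstack a b)].

Definition through_degree (n : nat) (T : set P2) (k : nat) : Prop :=
  factors_through n T k /\ forall j, factors_through n T j -> (k <= j)%N.

(** * Complexes *)

(* A graded object over TL_n is a family of objects q^(qd x) (dg x) placed in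
   homological degree hd x; the chain group in degree k is the direct sum over
   the x with hd x = k, finite by [is_cpx].  For morphisms A -> B of
   homological degree i, only the entries x, y with hd y = hd x + i are
   meaningful; all other entries are ignored. *)
Record cpx := Cpx {
  gens : choiceType;
  hd : gens -> int;
  qd : gens -> int;
  dg : gens -> set P2;
  dif : gens -> gens -> lincomb }.

Definition gmap (A B : cpx) := gens A -> gens B -> lincomb.

Definition psign (i : int) : int := (-1) ^+ `|i|%N.

Definition gzero (A B : cpx) : gmap A B := fun _ _ => [::].
Definition gid (A : cpx) : gmap A A :=
  fun x y => if x == y then lid (dg x) else [::].
Definition gadd (A B : cpx) (f g : gmap A B) : gmap A B :=
  fun x y => f x y ++ g x y.
Definition gscale (A B : cpx) (a : int) (f : gmap A B) : gmap A B :=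
  fun x y => lscale a (f x y).

Definition fiber (A : cpx) (k : int) : seq (gens A) :=
  fset_set [set x : gens A | hd x = k].

(* g after f, for f of homological degree i *)
Definition gcomp (A B C : cpx) (i : int) (g : gmap B C) (f : gmap A B) :
    gmap A C :=
  fun x z => flatten [seq lcomp (g y z) (f x y) | y <- fiber B (hd x + i)].

Section Category.
Variable n : nat.

(* f is an element of HOM^{i,j}(A, B). *)
Definition hom (i j : int) (A B : cpx) (f : gmap A B) : Prop :=
  forall x y, hd y = hd x + i ->
    cob_hom n (qd x + j) (dg x) (qd y) (dg y) (f x y).

Definition geq (i : int) (A B : cpx) (f g : gmap A B) : Prop :=
  forall x y, hd y = hd x + i -> meq n (dg x) (dg y) (f x y) (g x y).

(* The differential of HOM(A, B) on a map of homological degree i. *)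
Definition hdiff (i : int) (A B : cpx) (f : gmap A B) : gmap A B :=
  gadd (gcomp i (@dif B) f) (gscale (- psign i) (gcomp 1 f (@dif A))).

Definition chain_map (i j : int) (A B : cpx) (f : gmap A B) : Prop :=
  hom i j f /\ geq (i + 1) (hdiff i f) (@gzero A B).

Definition is_cpx (A : cpx) : Prop :=
  [/\ (forall x : gens A, tangle n n (dg x)),
      (forall k : int, finite_set [set x : gens A | hd x = k]),
      hom 1 0 (@dif A)
    & geq 2 (gcomp 1 (@dif A) (@dif A)) (@gzero A A)].

Definition Kom_minus (A : cpx) : Prop :=
  is_cpx A /\ exists b : int, forall x : gens A, hd x <= b.

Definition homotopic (A B : cpx) (f g : gmap A B) : Prop :=
  exists2 h : gmap A B, hom (-1) 0 h
    & geq 0 (gadd f (gscale (-1) g)) (hdiff (-1) h).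

Definition homotopy_inverse (A B : cpx) (f : gmap A B) (g : gmap B A) : Prop :=
  [/\ chain_map 0 0 f, chain_map 0 0 g,
      homotopic (gcomp 0 g f) (@gid A) & homotopic (gcomp 0 f g) (@gid B)].

Definition homotopy_equiv (A B : cpx) : Prop :=
  exists f g, @homotopy_inverse A B f g.

Definition zero_cpx : cpx :=
  @Cpx void (fun _ => 0) (fun _ => 0) (fun _ => set0) (fun _ _ => [::]).

Definition unit_cpx : cpx :=
  @Cpx unit (fun _ => 0) (fun _ => 0) (fun _ => vlines n) (fun _ _ => [::]).

(* t^i q^j A *)
Definition shift (i j : int) (A : cpx) : cpx :=
  @Cpx (gens A) (fun x => hd x + i) (fun x => qd x + j) (@dg A)
    (fun x y => lscale (psign i) (dif x y)).

Definition cone0 (A B : cpx) (f : gmap A B) : cpx :=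
  @Cpx (gens A + gens B)%type
    (fun z => match z with inl x => hd x - 1 | inr y => hd y end)
    (fun z => match z with inl x => qd x | inr y => qd y end)
    (fun z => match z with inl x => dg x | inr y => dg y end)
    (fun z z' => match z, z' with
       | inl x, inl x' => lscale (-1) (dif x x')
       | inl x, inr y => f x y
       | inr y, inr y' => dif y y'
       | inr _, inl _ => [::]
       end).

(* The cone of a chain map of bidegree (i, j). *)
Definition cone (i j : int) (A B : cpx) (f : gmap A B) : cpx :=
  @cone0 (shift i j A) B f.

Definition tens (A B : cpx) : cpx :=
  @Cpx (gens A * gens B)%type
    (fun z => hd z.1 + hd z.2) (fun z => qd z.1 + qd z.2)
    (fun z => vstack (dg z.1) (dg z.2))
    (fun z z' =>
       (if z.2 == z'.2 then lvstack (dif z.1 z'.1) (lid (dg z.2)) else [::]) ++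
       (if z.1 == z'.1 then
          lscale (psign (hd z.1)) (lvstack (lid (dg z.1)) (dif z.2 z'.2))
        else [::])).

(** ** Cooper--Krushkal projectors *)

Definition through_degree_lt (A : cpx) : Prop :=
  forall x : gens A, exists2 k, through_degree n (dg x) k & (k < n)%N.

Definition kills_turnbacks (C : cpx) : Prop :=
  forall N : cpx, Kom_minus N -> through_degree_lt N ->
    homotopy_equiv (tens C N) zero_cpx /\ homotopy_equiv (tens N C) zero_cpx.

Definition CK_projector (P : cpx) (iota : gmap unit_cpx P) : Prop :=
  [/\ Kom_minus P, kills_turnbacks P, chain_map 0 0 iota
    & exists N : cpx, [/\ is_cpx N, through_degree_lt N
        & homotopy_equiv (cone 0 0 iota) N]].

(** ** Convolutions *)

(* A sequence E_{1-N} -> ... -> E_0 is indexed by m = 0, ..., N-1, where E m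
   stands for the term in position m - (N-1).  Only al m (m+1) is used. *)
Definition position (N : nat) (m : 'I_N) : int := m%:Z - (N.-1)%:Z.

Definition conv (N : nat) (E : 'I_N -> cpx)
    (D : {m : 'I_N & gens (E m)} -> {m : 'I_N & gens (E m)} -> lincomb) : cpx :=
  @Cpx {m : 'I_N & gens (E m)}
    (fun z => hd (tagged z) + position (tag z)) (fun z => qd (tagged z))
    (fun z => dg (tagged z)) D.

Definition is_convolution (N : nat) (E : 'I_N -> cpx)
    (al : forall m m' : 'I_N, gmap (E m) (E m'))
    (D : {m : 'I_N & gens (E m)} -> {m : 'I_N & gens (E m)} -> lincomb) : Prop :=
  [/\ is_cpx (conv D),
      (forall (m : 'I_N) (x x' : gens (E m)), hd x' = hd x + 1 ->
         meq n (dg x) (dg x') (D (existT _ m x) (existT _ m x'))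
           (lscale (psign (position m)) (dif x x'))),
      (forall (m m' : 'I_N) (x : gens (E m)) (x' : gens (E m')),
         m' = m.+1 :> nat -> hd x' = hd x ->
         meq n (dg x) (dg x') (D (existT _ m x) (existT _ m' x'))
           (al m m' x x'))
    & (forall (m m' : 'I_N) (x : gens (E m)) (x' : gens (E m')),
         (m' < m)%N -> hd x' + position m' = hd x + position m + 1 ->
         meq n (dg x) (dg x') (D (existT _ m x) (existT _ m' x')) [::])].

(** ** The symmetric sequence *)

Section Symmetric.
Variable K : cpx.

(* q^j [K]_k, where [K]_k = (K juxtaposed with one strand) stacked on D_k *)
Definition bracket (j : int) (k : nat) : cpx :=
  @Cpx (gens K) (@hd K) (fun x => qd x + j)
    (fun x => vstack (hjuxt n.-1 1 (dg x) (vlines 1)) (Ddiag n k))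
    (fun x y => lvstack (lhjuxt n.-1 1 (dif x y) (lid (vlines 1)))
                        (lid (Ddiag n k))).

(* Position m - (2n-1): for m = k < n this is E_{1-2n+k} = q^{2n-k} [K]_k, and
   for m = 2n-1-k >= n it is E_{-k} = q^k [K]_k. *)
Definition sym_k (m : nat) : nat := if (m < n)%N then m else (2 * n - m.+1)%N.
Definition sym_term (m : 'I_(2 * n)) : cpx :=
  bracket (if (m < n)%N then (2 * n)%:Z - m%:Z else (2 * n)%:Z - 1 - m%:Z)
          (sym_k m).

Definition sym_cob (m : nat) : lincomb :=
  if (m.+1 < n)%N then Dsaddle_up n m
  else if (m.+1 == n)%N then Ddot n
  else Dsaddle_down n (sym_k m.+1).

Definition sym_map (m m' : 'I_(2 * n)) : gmap (sym_term m) (sym_term m') :=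
  fun (x y : gens K) =>
    if x == y then
      lvstack (lid (hjuxt n.-1 1 (dg x) (vlines 1))) (sym_cob m)
    else [::].

Definition sym_gens : Type := {m : 'I_(2 * n) & gens (sym_term m)}.

Variable D : sym_gens -> sym_gens -> lincomb.

Definition symQ : cpx := @conv (2 * n) sym_term D.

(* The last term E_0 = K juxtaposed with one strand; E_{1-2n} = q^{2n} E_0 has
   the same generators and diagrams. *)
Definition symE0 : cpx := bracket 0 0.

Definition eta : gmap symE0 symQ :=
  fun (x : gens K) (z : sym_gens) =>
    if (val (tag z) == (2 * n).-1) && ((tagged z : gens K) == x)
    then lid (@dg symE0 x) else [::].

Definition epsilon : gmap symQ symE0 :=
  fun (z : sym_gens) (x : gens K) =>
    if (val (tag z) == 0%N) && ((tagged z : gens K) == x)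
    then lid (@dg symE0 x) else [::].

(* bidegree (2n-1, -2n) *)
Definition partial_n : gmap symQ symQ :=
  gscale (-1) (gcomp ((2 * n)%:Z - 1) eta epsilon).

(* Z[u] (x) Q with differential 1 (x) d + u (x) partial, u of bidegree
   (2-2n, 2n); (k, z) is the copy of z in u^k Q.  As 2-2n is even, the
   shifts t^{(2-2n)k} do not change the sign of d. *)
Definition periodic : cpx :=
  @Cpx (nat * gens symQ)%type
    (fun w => hd w.2 + (2 - (2 * n)%:Z) * w.1%:Z)
    (fun w => qd w.2 + (2 * n)%:Z * w.1%:Z)
    (fun w => dg w.2)
    (fun w w' => if w'.1 == w.1 then dif w.2 w'.2
                 else if w'.1 == w.1.+1 then partial_n w.2 w'.2 else [::]).

Definition mul_u : gmap periodic periodic :=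
  fun w w' => if (w'.1 == w.1.+1) && (w'.2 == w.2) then lid (dg w.2) else [::].

End Symmetric.
End Category.
End Geometry.

Arguments cpx : clear implicits.
Arguments unit_cpx {R} n.

(* The data of a symmetric projector: a Cooper--Krushkal projector on n-1
   strands and a convolution of the symmetric sequence relative to it. *)
Record symmetric_projector (R : realType) (n : nat) := SymmetricProjector {
  sp_K : cpx R;
  sp_iota : gmap (unit_cpx n.-1) sp_K;
  sp_CK : CK_projector sp_iota;
  sp_dif : sym_gens n sp_K -> sym_gens n sp_K -> lincomb;
  sp_conv : is_convolution n (@sym_map R n sp_K) sp_dif;
  sp_bounded : Kom_minus n (symQ sp_dif) }.

Definition sp_cpx (R : realType) (n : nat) (Q : symmetric_projector R n) :=
  symQ (@sp_dif R n Q).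

Definition sp_periodic (R : realType) (n : nat) (Q : symmetric_projector R n) :=
  periodic (@sp_dif R n Q).

(* U_n: multiplication by u_n conjugated by a homotopy equivalence phi with
   homotopy inverse psi. *)
Definition U_map (R : realType) (n : nat) (Q : symmetric_projector R n)
    (P : cpx R) (phi : gmap (sp_periodic Q) P) (psi : gmap P (sp_periodic Q)) :
    gmap P P :=
  gcomp (2 - (2 * n)%:Z) phi (gcomp 0 (@mul_u R n (sp_K Q) (@sp_dif R n Q)) psi).

(* Main.v *)
From HB Require Import structures.
Require Import Defs.
From mathcomp Require Import all_boot all_order all_algebra.
From mathcomp Require Import finmap.
From mathcomp Require Import all_classical all_reals all_analysis.
From mathcomp Require Import zify ring lra.
Import Order.TTheory GRing.Theory Num.Theory.
Import numFieldNormedType.Exports.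
Local Open Scope ring_scope.

(** The differential 1 (x) d + u (x) del on W = Z[u] (x) Q makes multiplication
    by u a split injection of graded objects whose quotient W / uW is Q, and the
    cone of such a chain map is equivalent to its quotient.  Explicitly,
    z |-> (- del z, z) embeds Q into Cone(u), (a, b) |-> (b mod u) is a
    retraction, and the homotopy divides the second component by u
    ([mheq_cone_quotient]).  What makes the embedding
    a chain map is that del anticommutes with d and squares to zero: del is
    minus the composite of the projection to the first term of the convolution
    with the inclusion of the last term, and these two terms are different.

    The map U of the statement is phi u psi for mutually inverse homotopy
    equivalences phi : W -> P and psi : P -> W, so it remains to see that
    Cone(u) and Cone(phi u psi) are equivalent ([mheq_cone_conj]).  The given
    homotopies turn phi and psi into triangular chain maps between the two
    cones.  One composite is homotopic to 1.  The other one is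
    homotopic to 1 + N with N of square zero, because the homotopies for
    psi phi and phi psi need not be coherent with each other; by
    [mheq_unipotent] such an N is null-homotopic.

    The computations need an additive category in which they make sense.
    Linear combinations of dotted cobordisms modulo the local relations form
    abelian groups [cobHom], and gluing makes them the morphisms of a category:
    the glued surface is again locally flat since it is vertical near the seam
    ([cob_scomp]), and associativity and the unit laws hold because the surfaces
    compared differ by a reparametrisation of the vertical direction
    ([meq_assoc], [meq_unitl], [meq_unitr]), except that dots may have to slide
    along a collar.  Degrees are respected because the Euler characteristic of a
    glued surface is computed by attaching the cells of the lower half to the
    upper half ([euler_scomp]), and because a tangle with 2n endpoints has n arcs,
    so that the cylinder over it has Euler characteristic n ([euler_lid]).

    Graded maps become column-finite matrices over this category ([mor]).  Their
    product involves no degrees, so that the homological algebra above is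
    calculation in a preadditive category; [mor_of] translates between the two
    languages.  Chain groups must be finite sums for this, and for W this uses
    that Q is bounded above and that u lowers the homological degree as
    n is at least 2. *)

(** * Local flatness *)

Section Flat.
Local Open Scope classical_set_scope.
Set Implicit Arguments.
Unset Strict Implicit.

Lemma within_continuousP (P P' : topologicalType) (A : set P) (f : P -> P') :
  {within A, continuous f} <->
  forall x, A x -> forall N, nbhs (f x) N -> exists2 G, open_nbhs x G &
     forall y, G y -> A y -> N (f y).
Proof.
rewrite subspace_continuousP; split.
- move=> h x Ax N Nfx; have := h x Ax N Nfx; rewrite /= nbhs_simpl /within /=.
  rewrite nbhsE => -[G Ox OA]; exists G => // y Oy Ay; exact: OA.
- move=> h x Ax N Nfx; have [G Ox OA] := h x Ax N Nfx.
  rewrite /= nbhs_simpl /within /= nbhsE; exists G => // y Oy Ay; exact: OA.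
Qed.

Lemma within_comp (P P' P'' : topologicalType) (A : set P) (B : set P')
    (f : P -> P') (g : P' -> P'') :
  {within A, continuous f} -> {within B, continuous g} ->
  (forall x, A x -> B (f x)) -> {within A, continuous (g \o f)}.
Proof.
move=> /within_continuousP hf /within_continuousP hg AB.
apply/within_continuousP => x Ax N Ngfx.
have [G [Wo Ox] OB] := hg _ (AB _ Ax) N Ngfx.
have [G' G'x G'A] := hf _ Ax G (open_nbhs_nbhs (conj Wo Ox)).
exists G' => // y G'y Ay; apply: OB; [exact: G'A|exact: AB].
Qed.

Lemma within_sub (P P' : topologicalType) (A B : set P) (f : P -> P') :
  A `<=` B -> {within B, continuous f} -> {within A, continuous f}.
Proof. exact: continuous_subspaceW. Qed.

Lemma within_cont (P P' : topologicalType) (A : set P) (f : P -> P') :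
  continuous f -> {within A, continuous f}.
Proof. exact: continuous_subspaceT. Qed.

Lemma within_pair (P P' P'' : topologicalType) (A : set P) (f : P -> P') (g : P -> P'') :
  {within A, continuous f} -> {within A, continuous g} ->
  {within A, continuous (fun x => (f x, g x))}.
Proof.
move=> /within_continuousP hf /within_continuousP hg; apply/within_continuousP => x Ax N.
move=> [[N1 N2] /= [h1 h2] h].
have [W1 [e1 x1] h1'] := hf _ Ax _ h1; have [W2 [e2 x2] h2'] := hg _ Ax _ h2.
exists (W1 `&` W2); first by split; [exact: openI|].
by move=> y [y1 y2] Ay; apply: h; split; [apply: h1'|apply: h2'].
Qed.

(** Relatively open preimages extended to open sets: this shrinks a chart without
    losing that its image is an open piece of the model. *)
Lemma within_open (P P' : topologicalType) (A : set P) (f : P -> P') (G : set P') :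
  {within A, continuous f} -> open G ->
  exists2 V, open V & forall x, A x -> (V x <-> G (f x)).
Proof.
move=> /within_continuousP hf Go.
(* The largest open set whose points in A are sent into G. *)
exists (\bigcup_(W in [set W | open W /\ forall y, W y -> A y -> G (f y)]) W).
  by apply: bigcup_open => W [].
move=> x Ax; split=> [[W [Wo Wh] Wx]|Ofx]; first exact: Wh.
have [W [Wo Wx] Wh] := hf _ Ax _ (open_nbhs_nbhs (conj Go Ofx)).
by exists W.
Qed.

(** Local flatness at one point, so that different points of a surface can be
    treated by different charts. *)
Definition flat_at (P : topologicalType) (X S M F : set P) (p : P) : Prop :=
  exists (U V : set P) (f g : P -> P),
    [/\ open U, open V, U p, homeo_on (U `&` X) (V `&` M) f g
      & forall u, (U `&` X) u -> (S u <-> F (f u))].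

Lemma flat_at_local (P : topologicalType) (X S X' S' M F : set P) (G : set P) p :
  open G -> G p -> (forall q, G q -> (X q <-> X' q)) ->
  (forall q, G q -> (S q <-> S' q)) -> flat_at X S M F p -> flat_at X' S' M F p.
Proof.
move=> Go Gp hX hS [U [V [f [g [Uo Vo Up [fc gc fg gf] FS]]]]].
(* V is cut down to the points whose preimage lies in the neighbourhood G. *)
have [W Wo hW] := within_open gc Go.
have XX : (U `&` G) `&` X' `<=` U `&` X by move=> q [[Uq Oq] Xq]; split=> //; apply/hX.
exists (U `&` G), (V `&` W), f, g; split=> //; [exact: openI|exact: openI| |].
- split.
  + exact: within_sub fc.
  + by apply: within_sub gc => q [[]].
  + move=> q h; have [[Vf Mf] gq] := fg _ (XX _ h); split=> //; split=> //; split=> //.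
    by apply/hW => //; rewrite gq; case: h => -[].
  + move=> q [[Vq Wq] Mq]; have [[Ug Xg] fq] := gf q (conj Vq Mq); split=> //.
    have Og : G (g q) by apply/hW.
    by split; [split|apply/hX].
- move=> u h; rewrite -FS; last exact: XX.
  by apply: iff_sym; apply: hS; case: h => -[].
Qed.

Lemma flat_at_transport (P : topologicalType) (X S M F : set P) (a b : P -> P) p :
  continuous a -> continuous b -> cancel a b -> cancel b a ->
  flat_at X S M F (b p) -> flat_at (a @` X) (a @` S) M F p.
Proof.
move=> ac bc ab ba [U [V [f [g [Uo Vo Up [fc gc fg gf] FS]]]]].
have im (Y : set P) q : (a @` Y) q <-> Y (b q).
  by split=> [[y Yy <-]|Yb]; [rewrite ab|exists (b q)].
exists (b @^-1` U), V, (f \o b), (a \o g); split=> //.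
- by apply: open_comp.
- split.
  + apply: (@within_comp _ _ _ _ (U `&` X)) fc _; first exact: within_cont.
    by move=> q [Uq /im Xq].
  + apply: (@within_comp _ _ _ _ setT) => //; exact: within_cont.
  + move=> q [Uq /im Xq]; have [h1 h2] := fg (b q) (conj Uq Xq).
    by split=> //=; rewrite h2 ba.
  + move=> q h; have [[Ug Xg] h2] := gf q h; split; last by rewrite /= ab.
    split; first by rewrite /= ab.
    by exists (g q).
- by move=> u [Uu /im Xu]; rewrite im /= FS.
Qed.
End Flat.

Section FlatCylinder.
Local Open Scope classical_set_scope.
Context {R : realType}.
Local Notation P2 := (R * R)%type.
Local Notation P3 := ((R * R) * R)%type.
Set Implicit Arguments.
Unset Strict Implicit.

Definition quarter : set P3 := [set p | 0 <= p.1.2 /\ 0 <= p.2].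
Definition qplane : set P3 := [set p | p.1.1 = 0].
Definition half_cyl : set P3 := [set p | square p.1 /\ 0 <= p.2].

(** The product of a chart for the tangle with the half line is a chart with values
    in the quarter space.  The half line, rather than an interval, covers interior
    points and points of the bottom by the same chart; everything else is reduced
    to this case by [flat_at_local] and [flat_at_transport]. *)
Lemma flat_cyl b t (T : set P2) (p : P3) : tangle b t T -> T p.1 ->
  flat_at half_cyl [set q | T q.1 /\ 0 <= q.2] quarter qplane p.
Proof.
move=> [_ _ lf _] Tp; have [U [V [f [g [Uo Vo Up [fc gc fg gf] FS]]]]] := lf _ Tp.
have e1 (W : set P2) : open W -> open [set q : P3 | W q.1].
  move=> Wo; apply: (@open_comp _ _ (fun q : P3 => q.1)) => //.
  by move=> q _; apply: cvg_fst.
have c1 (A : set P2) (k : P2 -> P2) (B : set P3) : {within A, continuous k} -> 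
   (forall q, B q -> A q.1) -> {within B, continuous (fun q : P3 => (k q.1, q.2))}.
  move=> kc h; apply: within_pair.
    by apply: within_comp kc h; apply: within_cont => q; apply: cvg_fst.
  by apply: within_cont => q; apply: cvg_snd.
exists [set q | U q.1], [set q | V q.1], (fun q => (f q.1, q.2)), (fun q => (g q.1, q.2)).
split=> //=; [exact: e1|exact: e1| |].
- split.
  + by apply: c1 fc _ => q [? []].
  + by apply: c1 gc _ => q [? []].
  + move=> q /= [Uq [sq q0]]; have [[Vf Mf] gq] := fg _ (conj Uq sq).
    by split=> //; rewrite gq; case: (q).
  + move=> q /= [Vq [Mq q0]]; have [[Uf Mf] gq] := gf _ (conj Vq Mq).
    by split=> //; rewrite gq; case: (q).
- move=> u [Uu [su u0]]; have /= h := FS u.1 (conj Uu su).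
  by split=> [[/h]|/h].
Qed.
End FlatCylinder.

(** * Affine maps in the vertical direction *)

Section VerticalMaps.
Local Open Scope classical_set_scope.
Context {R : realType}.
Local Notation P2 := (R * R)%type.
Local Notation P3 := ((R * R) * R)%type.
Set Implicit Arguments.
Unset Strict Implicit.

Lemma cont_pair (P P' P'' : topologicalType) (f : P -> P') (g : P -> P'') :
  continuous f -> continuous g -> continuous (fun x => (f x, g x)).
Proof.
move=> fc gc x.
exact: (@cvg_pair _ _ _ (nbhs x) (nbhs (f x)) (nbhs (g x)) _ _ _ f g (fc x) (gc x)).
Qed.

Lemma cont_fst (P P' : topologicalType) : continuous (@fst P P').
Proof. by move=> x; apply: cvg_fst. Qed.

Lemma cont_snd (P P' : topologicalType) : continuous (@snd P P').
Proof. by move=> x; apply: cvg_snd. Qed.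

Lemma cont_comp (P P' P'' : topologicalType) (f : P -> P') (g : P' -> P'') :
  continuous f -> continuous g -> continuous (fun x => g (f x)).
Proof. by move=> fc gc x; apply: continuous_comp; [exact: fc|exact: gc]. Qed.

Lemma cont_vert (r : R -> R) : continuous r ->
  continuous (fun p : P3 => (p.1, r p.2)).
Proof. by move=> rc; apply: cont_pair; [exact: cont_fst|apply: cont_comp rc; exact: cont_snd]. Qed.

Lemma open_vert (A : set R) : open A -> open [set q : P3 | A q.2].
Proof. by move=> Ao; apply: open_comp Ao => q _; apply: cvg_snd. Qed.

Lemma cont_affine (a b : R) : continuous (fun t : R => a * t + b).
Proof.
move=> t; apply: cvgD; last exact: cvg_cst.
by apply: cvgM; [exact: cvg_cst|exact: cvg_id].
Qed.

Lemma closed_vert (a b : R) (A : set P3) : a != 0 -> closed A ->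
  closed ((fun p : P3 => (p.1, a * p.2 + b)) @` A).
Proof.
move=> a0 Ac.
rewrite (_ : _ @` _ = (fun p : P3 => (p.1, a^-1 * p.2 + (- b / a))) @^-1` A).
  by apply: closed_comp Ac => p _; exact: (cont_vert (@cont_affine _ _)).
apply/seteqP; split=> [_ [[p s] Ap <-] /=|[p s] /= Ap].
  by rewrite (_ : _ + _ = s) //; field.
by exists (p, a^-1 * s + - b / a) => //=; congr pair; field.
Qed.

Lemma scomp_body (S' S : @dsurf R) p s :
  body (scomp S' S) (p, s) <-> body S' (p, 2 * s - 1) \/ body S (p, 2 * s).
Proof.
rewrite /scomp /=; split.
  move=> [[[q t] h [<- <-]]|[[q t] h [<- <-]]] /=; [left|right].
    by rewrite (_ : _ - 1 = t) //; field.
  by rewrite (_ : _ * _ = t) //; field.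
move=> [h|h]; [left|right].
  by exists (p, 2 * s - 1) => //=; congr pair; field.
by exists (p, 2 * s) => //=; congr pair; field.
Qed.

Lemma unitI_itv : unitI = `[0, 1] :> set R.
Proof. by apply/seteqP; split=> x; rewrite /= in_itv. Qed.

Lemma compact_arc (ga : R -> P2) : {within unitI, continuous ga} ->
  compact (ga @` unitI).
Proof. by move=> c; apply: continuous_compact => //; rewrite unitI_itv; exact: segment_compact. Qed.
End VerticalMaps.

(** * Identity cobordisms and gluing *)

Section Gluing.
Local Open Scope classical_set_scope.
Context {R : realType}.
Local Notation P2 := (R * R)%type.
Local Notation P3 := ((R * R) * R)%type.
Set Implicit Arguments.
Unset Strict Implicit.

Lemma compact_image_closed (ga : R -> P2) : {within unitI, continuous ga} ->
  closed (ga @` unitI).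
Proof. move=> c; apply: compact_closed; [exact: norm_hausdorff|exact: compact_arc]. Qed.

Lemma tangle_closed b t (T : set P2) : tangle b t T -> closed T.
Proof.
move=> [_ _ _ [a [c [ga [de [[h1 h2] -> _ _ _]]]]]].
apply: closedU; apply: closed_bigcup => [|i _]; try exact: finite_finset; apply: compact_image_closed.
  by have [] := h1 i.
by have [] := h2 i.
Qed.

Lemma closed_cylinder (T : set P2) : closed T -> closed (cylinder T).
Proof.
move=> Tc; rewrite (_ : cylinder T = fst @^-1` T `&` snd @^-1` `[0, 1]).
  apply: closedI.
    by apply: closed_comp Tc => p _; exact: cont_fst.
  by apply: closed_comp; [move=> p _; exact: cont_snd|exact: interval_closed].
by apply/seteqP; split=> p /=; rewrite in_itv.
Qed.

Lemma open_half (a b : R) : open [set q : P3 | a * q.2 < b].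
Proof.
apply: (@open_vert _ [set s : R | a * s < b]).
rewrite (_ : [set _ | _] = (fun s => a * s + 0) @^-1` [set s : R | s < b]).
  by apply: open_comp; [move=> x _; exact: cont_affine|exact: open_lt].
by apply/seteqP; split=> x /=; rewrite addr0.
Qed.

Lemma flat_collar n (T : set P2) (S : set P3) (p : P3) (G : set P3) : tangle n n T ->
  open G -> G p -> (forall q, G q -> 0 < q.2 < 1) -> T p.1 ->
  (forall q, G q -> (S q <-> T q.1)) ->
  flat_at cube S quarter qplane p.
Proof.
move=> tT Go Gp G01 Tp GS.
apply: (flat_at_local Go Gp _ _ (flat_cyl tT Tp)).
  move=> q Gq; have := G01 q Gq; rewrite /half_cyl /cube /unitI /=.
  by move=> /andP[h1 h2]; split=> -[h3 h4]; split=> //; lra.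
move=> q Gq; rewrite GS //= /unitI /=; have := G01 q Gq.
by split=> [[]|]//; split=> //; lra.
Qed.

Lemma flat_cylinder n (T : set P2) (p : P3) : tangle n n T -> cylinder T p ->
  flat_at cube (cylinder T) quarter qplane p.
Proof.
move=> tT [Tp /= /andP[p0 p1]].
have [h|h] := ltP p.2 1.
  apply: (flat_at_local (@open_half 1 1) _ _ _ (flat_cyl tT Tp)).
  - by rewrite /= mul1r.
  - by move=> q /=; rewrite mul1r /half_cyl /cube /unitI /= => h1; split=> -[]; split=> //; lra.
  - by move=> q /=; rewrite mul1r /cylinder /unitI /= => h1; split=> -[]; split=> //; lra.
(* The top is reached by turning the cube upside down. *)
pose fl (q : P3) : P3 := (q.1, (- 1) * q.2 + 1).
have flK : cancel fl fl by case=> q s; rewrite /fl /=; congr pair; ring.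
have flc : continuous fl := cont_vert (@cont_affine _ _ _).
have tr := @flat_at_transport _ half_cyl _ quarter qplane fl fl p flc flc flK flK
   (@flat_cyl _ _ _ _ (fl p) tT Tp).
have im (Y : set P3) q : (fl @` Y) q <-> Y (fl q).
  by split=> [[y Yy <-]|Yb]; [rewrite flK|exists (fl q)].
apply: (flat_at_local (@open_half (- 1) 0) _ _ _ tr).
- by rewrite /= mulN1r; lra.
- by move=> q h1; apply: (iff_trans (im _ _));
      move: h1; rewrite /= mulN1r => h1; rewrite /half_cyl /fl /cube /unitI /=; split=> -[]; split=> //; lra.
- by move=> q h1; apply: (iff_trans (im _ _));
      move: h1; rewrite /= mulN1r => h1; rewrite /half_cyl /fl /cylinder /unitI /=; split=> -[]; split=> //; lra.
Qed.

Lemma cob_lid n (T : set P2) : tangle n n T -> cob n T T (DSurf (cylinder T) [::]).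
Proof.
move=> tT; have Tc := tangle_closed tT; have [Tsq Tbd _ _] := tT; split=> //.
- split=> //; first exact: closed_cylinder.
  by move=> p [/Tsq ? ?]; split.
- by move=> p hp; exact: (flat_cylinder tT hp).
- exists 1; split; first exact: ltr01.
  move=> p s sq s01; rewrite /cylinder /unitI /=.
  have h0 : 0 <= s <= 1 by [].
  have h1 : 0 <= 1 - s <= 1 by lra.
  by split; split=> [[]//|Tp]; split.
- by move=> p s bp s01; rewrite /cylinder /= -Tbd; split=> -[].
Qed.

(** Shorter than 1/2, so that after gluing the collars stay inside their halves. *)
Lemma cob_collar n (T T' : set P2) S : cob n T T' S -> exists e : R,
  [/\ 0 < e, e < 1/2, (forall p s, 0 <= s <= e -> (body S (p, s) <-> T p))
    & (forall p s, 1 - e <= s <= 1 -> (body S (p, s) <-> T' p))].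
Proof.
move=> [[tT tT' _ bc] _ [e [e0 he]] _ _]; have [Tsq _ _ _] := tT; have [Tsq' _ _ _] := tT'.
have m0 : 0 < Num.min e (1/4) by rewrite lt_min e0; lra.
have m1 : Num.min e (1/4) <= e by rewrite ge_min lexx.
have m2 : Num.min e (1/4) <= 1/4 :> R by rewrite ge_min lexx orbT.
exists (Num.min e (1/4)); split=> //; first by lra.
- move=> p s h; have h' : 0 <= s <= e by lra.
  by split=> h2; [have [sp _] := bc _ h2|have sp := Tsq _ h2];
    have [h1 _] := he p s sp h'; apply/h1.
- move=> p s h; have h' : 0 <= 1 - s <= e by lra.
  have -> : s = 1 - (1 - s) by ring.
  by split=> h2; [have [sp _] := bc _ h2|have sp := Tsq' _ h2];
    have [_ h1] := he p _ sp h'; apply/h1.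
Qed.

Lemma cob_body_range n (T T' : set P2) S p s : cob n T T' S -> body S (p, s) ->
   [/\ square p, 0 <= s & s <= 1].
Proof. by move=> [[_ _ _ bc] _ _ _ _] /bc [sq /andP[]]. Qed.

(** Away from height 1/2 the glued surface looks like one of its halves, and near
    height 1/2 it is vertical because both halves are. *)
Lemma cob_scomp n (T T' T'' : set P2) S S' :
  cob n T T' S -> cob n T' T'' S' -> cob n T T'' (scomp S' S).
Proof.
move=> cS cS'; have [e [e0 e1 he he']] := cob_collar cS.
have [f [f0 f1 hf hf']] := cob_collar cS'.
have rS := cob_body_range cS; have rS' := cob_body_range cS'.
have [[tT tT' Sc _] lS _ wS dS] := cS; have [[_ tT'' Sc' _] lS' _ wS' dS'] := cS'.
pose m := Num.min e f.
have m0 : 0 < m by rewrite lt_min e0.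
have m1 : m <= e by rewrite ge_min lexx.
have m2 : m <= f by rewrite ge_min lexx orbT.
pose up (q : P3) : P3 := (q.1, (1/2) * q.2 + 1/2).
pose dn (q : P3) : P3 := (q.1, (1/2) * q.2 + 0).
pose upi (q : P3) : P3 := (q.1, 2 * q.2 + -1).
pose dni (q : P3) : P3 := (q.1, 2 * q.2 + 0).
have upK : cancel up upi by case=> q s; rewrite /up /upi /=; congr pair; field.
have upiK : cancel upi up by case=> q s; rewrite /up /upi /=; congr pair; field.
have dnK : cancel dn dni by case=> q s; rewrite /dn /dni /=; congr pair; field.
have dniK : cancel dni dn by case=> q s; rewrite /dn /dni /=; congr pair; field.
have cv a b : continuous (fun q : P3 => (q.1, a * q.2 + b)) := cont_vert (@cont_affine _ a b).
have imu (Y : set P3) q : (up @` Y) q <-> Y (upi q).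
  by split=> [[y Yy <-]|Yb]; [rewrite upK|exists (upi q)].
have imd (Y : set P3) q : (dn @` Y) q <-> Y (dni q).
  by split=> [[y Yy <-]|Yb]; [rewrite dnK|exists (dni q)].
have bE q : body (scomp S' S) q <-> (up @` body S') q \/ (dn @` body S) q.
  by rewrite imu imd /upi /dni addr0; case: q => p s; exact: scomp_body.
split.
- split=> //.
  + rewrite (_ : body _ = up @` body S' `|` dn @` body S); last by apply/predeqP => q; exact: bE.
    by apply: closedU; apply: closed_vert => //; apply/eqP; lra.
  + by move=> [p s] /scomp_body [/rS'|/rS] [sq ? ?]; split=> //; rewrite /unitI /=; lra.
- move=> [p s] /bE; rewrite imu imd /upi /dni /= => h.
  have [sl|sl] := ltP s (1/2).
  + have {h} h : body S (dni (p, s)) by case: h => //= /rS'[]; lra.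
    have tr := flat_at_transport (cv _ _) (cv _ _) dnK dniK (lS _ h).
    apply: (flat_at_local (@open_half 1 (1/2)) _ _ _ tr).
    * by rewrite /= mul1r.
    * by case=> q t h1; apply: (iff_trans (imd _ _));
      move: h1; rewrite /= mul1r => h1; rewrite /dni /cube /unitI /=; split=> -[]; split=> //; lra.
    * case=> q t h1; apply: (iff_trans (imd _ _)); apply: (iff_trans _ (iff_sym (bE _))); rewrite imd imu;
      move: h1; rewrite /upi /dni /= mul1r => h1; split; first by right.
      by case=> // /rS'[]; lra.
  have [sr|sr] := ltP (1/2) s.
  + have {h} h : body S' (upi (p, s)) by case: h => //= /rS[]; lra.
    have tr := flat_at_transport (cv _ _) (cv _ _) upK upiK (lS' _ h).
    apply: (flat_at_local (@open_half (-1) (-(1/2))) _ _ _ tr).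
    * by rewrite /= mulN1r; lra.
    * by case=> q t h1; apply: (iff_trans (imu _ _));
      move: h1; rewrite /= mulN1r => h1; rewrite /upi /cube /unitI /=; split=> -[]; split=> //; lra.
    * case=> q t h1; apply: (iff_trans (imu _ _)); apply: (iff_trans _ (iff_sym (bE _))); rewrite imd imu;
      move: h1; rewrite /upi /dni /= mulN1r => h1; split; first by left.
      by case=> // /rS[]; lra.
  (* At the seam both collars show that the surface is a cylinder over T'. *)
  + have se : s = 1/2 by lra.
    apply: (@flat_collar n T' _ _ ([set q : P3 | 1 * q.2 < 1/2 + m/2] `&` [set q : P3 | (-1) * q.2 < m/2 - 1/2])).
    * exact: tT'.
    * by apply: openI; exact: open_half.
    * by split=> /=; lra.
    * by move=> q [/= h1 h2]; lra.
    * by case: h => h; [apply: (proj1 (hf _ _ _) h)|apply: (proj1 (he' _ _ _) h)] => /=; lra.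
    * case=> q t [/= h1 h2]; apply: (iff_trans (bE _)); rewrite imu imd /upi /dni /=; split.
        by case=> h'; [have [_ ? ?] := rS' _ _ h'; apply: (proj1 (hf _ _ _) h')|
      have [_ ? ?] := rS _ _ h'; apply: (proj1 (he' _ _ _) h')] => /=; lra.
      have [h'|h'] := leP t (1/2) => Tq; [right; apply/he'|left; apply/hf] => //; lra.
- exists (m/2); split; first by lra.
  move=> p s sq s0; rewrite !scomp_body; split; split.
  + by case=> h; [have [] := rS' _ _ h; lra|have [] := rS _ _ h => *; apply: (proj1 (he _ _ _) h); lra].
  + by move=> Tp; right; apply/he => //; lra.
  + by case=> h; [have [] := rS' _ _ h => *; apply: (proj1 (hf' _ _ _) h); lra|have [] := rS _ _ h; lra].
  + by move=> Tp; left; apply/hf' => //; lra.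
- move=> p s bp s01; rewrite scomp_body; have /andP[s0 s1] := s01; split.
  + case=> h; [have [_ ? ?] := rS' _ _ h; apply: (proj1 (wS' _ _ bp _) h)|
               have [_ ? ?] := rS _ _ h; apply: (proj1 (wS _ _ bp _) h)];
      by rewrite /unitI /=; lra.
  + by move=> mp; have [h|h] := leP s (1/2);
      [right; apply: (proj2 (wS _ _ bp _) mp)|left; apply: (proj2 (wS' _ _ bp _) mp)];
      rewrite /unitI /=; lra.
- move=> d; rewrite mem_cat => /orP[] /mapP[q qd ->].
    by left; exists q => //; apply: dS'.
  by right; exists q => //; apply: dS.
Qed.
End Gluing.

(** * Isotopies that reparametrise the vertical direction *)

Section Reparametrisation.
Local Open Scope classical_set_scope.
Context {R : realType}.
Local Notation P2 := (R * R)%type.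
Local Notation P3 := ((R * R) * R)%type.
Set Implicit Arguments.
Unset Strict Implicit.

(** Homeomorphisms of the line that preserve the interval [0, 1].  Being defined on
    the whole line avoids relative continuity. *)
Definition reparam (r : R -> R) : Prop :=
  [/\ continuous r, (forall s t, s < t -> r s < r t), r 0 = 0 & r 1 = 1].

Definition vert (r : R -> R) (p : P3) : P3 := (p.1, r p.2).

Lemma reparam_inj r s t : reparam r -> r s = r t -> s = t.
Proof.
move=> [_ hr _ _] rst; have [h|h|//] := ltgtP s t; have := hr _ _ h; rewrite rst ltxx //.
Qed.

Lemma reparam_le r s t : reparam r -> s <= t -> r s <= r t.
Proof. by move=> [_ hr _ _]; rewrite le_eqVlt => /orP[/eqP-> //|/hr /ltW]. Qed.

Lemma reparam_surj r v : reparam r -> 0 <= v <= 1 -> exists2 t, 0 <= t <= 1 & r t = v.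
Proof.
move=> [rc hr r0 r1] v01.
have := @IVT R r 0 1 v ler01 (within_cont rc).
rewrite r0 r1 /Num.min /Num.max ltr01 => /(_ v01)[t t01 <-].
by exists t => //; move: t01; rewrite in_itv.
Qed.

(** The straight-line homotopy to the identity stays inside the reparametrisations,
    and is therefore an isotopy. *)
Lemma reparam_interp r s : reparam r -> 0 <= s <= 1 ->
  reparam (fun t => (1 - s) * t + s * r t).
Proof.
move=> [rc hr r0 r1] s01; split.
- move=> t; apply: cvgD; apply: cvgM; [exact: cvg_cst|exact: cvg_id|exact: cvg_cst|exact: rc].
- move=> a b ab; have := hr _ _ ab => h.
  have [s1|s1] := leP s (1/2); nra.
- by rewrite r0; ring.
- by rewrite r1; ring.
Qed.

Lemma surf_isotopic_vert r (S : @dsurf R) : reparam r ->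
  surf_isotopic S (DSurf (vert r @` body S) (map (vert r) (dots S))).
Proof.
move=> rr; have [rc hr r0 r1] := rr.
have ri s s01 := @reparam_interp r s rr s01.
exists (fun s => vert (fun t => (1 - s) * t + s * r t)); split => //.
- split.
  + apply: within_cont; rewrite /vert; apply: cont_pair.
      by apply: (cont_comp (@cont_snd _ _)); exact: cont_fst.
    have c2 : continuous (fun sp : R * P3 => sp.2.2).
      by apply: (cont_comp (@cont_snd _ _)); exact: cont_snd.
    move=> x; apply: cvgD; apply: cvgM.
    * by apply: cvgB; [exact: cvg_cst|exact: cont_fst].
    * exact: c2.
    * exact: cont_fst.
    * exact: (cont_comp c2 rc).
  + by move=> [p t] _; rewrite /vert /=; congr pair; ring.
  + move=> s s01; have ris := ri s s01; have [_ _ i0 i1] := ris; split.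
    * move=> [p t] [sp /andP[t0 t1]]; split=> //=; rewrite /unitI /=.
      have := reparam_le ris t0; have := reparam_le ris t1.
      by rewrite /= in i0 i1 *; rewrite i0 i1 => -> ->.
    * by move=> [p t] [p' t'] _ _ [<- /(reparam_inj ris) <-].
    * move=> [p t] [sp /= t01]; have [t' t'01 h] := reparam_surj ris t01.
      by exists (p, t'); rewrite /vert /= ?h.
- move=> s [p t] s01 _ /= h; have [_ _ i0 i1] := ri s s01.
  by rewrite /vert /=; congr pair; case: h => ->.
- congr (_ @` _); apply/funext => -[p t]; rewrite /vert /=; congr pair; ring.
- apply: eq_map => -[p t]; rewrite /vert /=; congr pair; ring.
Qed.

Lemma connected_vert (B : set P3) p a b s t :
  (forall x, a <= x <= b -> B (p, x)) -> a <= s <= b -> a <= t <= b ->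
  connected_component B (p, s) (p, t).
Proof.
move=> hB sab tab.
apply: (@connected_component_max _ B ((fun x => (p, x)) @` `[a, b])).
- by exists s => //=; rewrite in_itv.
- by move=> _ [x /= xab <-]; apply: hB; move: xab; rewrite in_itv.
- apply: connected_continuous_connected; first exact: segment_connected.
  by apply: within_cont; apply: cont_pair => x; [exact: cvg_cst|exact: cvg_id].
- by exists t => //=; rewrite in_itv.
Qed.

Lemma cob_dots n (T T' : set P2) B ds ds' : cob n T T' (DSurf B ds) ->
  {in ds', forall d, B d} -> cob n T T' (DSurf B ds').
Proof. by move=> []. Qed.

(** The relation moving a dot only acts on the first dot, so the dots are permuted
    to the front one at a time. *)
Lemma meq_dots n (T T' : set P2) B (f g : P3 -> P3) ds :
  cob n T T' (DSurf B (map f ds)) ->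
  {in ds, forall d, connected_component B (f d) (g d)} ->
  meq n T T' [:: (1, DSurf B (map f ds))] [:: (1, DSurf B (map g ds))].
Proof.
(* acc collects the dots that have already been moved. *)
rewrite -[map f ds]cat0s -[map g ds]cat0s.
elim: ds [::] => [|d ds IH] acc cb hc /=.
  by apply: meq_lin => // c; rewrite inE => /eqP ->.
have perm1 (x : P3) l : perm_eq (acc ++ x :: l) (x :: (acc ++ l)).
  by rewrite -cat1s perm_catCA.
have [_ _ _ _ dB] := cb.
have gB : B (g d) by apply: (@connected_component_sub _ B (f d)); apply: hc; rewrite mem_head.
have c1 : cob n T T' (DSurf B (f d :: (acc ++ map f ds))).
  by apply: cob_dots cb _ => x; rewrite -(perm_mem (perm1 _ _)) => /dB.
have c2 : cob n T T' (DSurf B (g d :: (acc ++ map f ds))).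
  apply: cob_dots c1 _ => x; rewrite inE => /orP[/eqP-> //|h].
  by apply: dB; rewrite /= (perm_mem (perm1 _ _)) inE h orbT.
apply: meq_trans (meq_dots_perm cb (perm1 _ _)) _.
apply: meq_trans (meq_dot_move c1 (hc d (mem_head _ _))) _.
have p2 : perm_eq (g d :: (acc ++ map f ds)) ((acc ++ [:: g d]) ++ map f ds).
  by rewrite -catA /= perm_sym.
apply: meq_trans (meq_dots_perm c2 p2) _.
rewrite (_ : acc ++ g d :: map g ds = (acc ++ [:: g d]) ++ map g ds); last by rewrite -catA.
apply: IH.
  have [_ _ _ _ d2] := c2.
  by apply: cob_dots c2 _ => x; rewrite -(perm_mem p2) => /d2.
by move=> x xd; apply: hc; rewrite inE xd orbT.
Qed.

(** The isotopy determines where the dots of S go, and g says where the dots of S'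
    are; they are allowed to differ by a motion on the surface. *)
Lemma meq_reparam n (T T' : set P2) (S S' : dsurf) r (g : P3 -> P3) :
  reparam r -> cob n T T' S -> cob n T T' S' ->
  (forall q, body S' q <-> (vert r @` body S) q) ->
  dots S' = map g (dots S) ->
  {in dots S, forall d, connected_component (body S') (vert r d) (g d)} ->
  meq n T T' [:: (1, S)] [:: (1, S')].
Proof.
move=> rr cS cS' /predeqP bE dE conn; case: S' => B ds in bE dE cS' conn *; rewrite /= in bE dE conn.
have c1 : cob n T T' (DSurf B (map (vert r) (dots S))).
  apply: cob_dots cS' _ => _ /mapP[d dS ->].
  by rewrite bE; exists d => //; case: cS => _ _ _ _; apply.
apply: (@meq_trans _ _ _ _ _ [:: (1, DSurf B (map (vert r) (dots S)))]).
  by apply: meq_isotopy => //; rewrite bE; exact: surf_isotopic_vert.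
by rewrite dE; exact: meq_dots.
Qed.
End Reparametrisation.

(** * Associativity and units up to isotopy *)

Section CategoryLaws.
Local Open Scope classical_set_scope.
Context {R : realType}.
Local Notation P2 := (R * R)%type.
Local Notation P3 := ((R * R) * R)%type.
Set Implicit Arguments.
Unset Strict Implicit.

Lemma cont_min (f g : R -> R) : continuous f -> continuous g ->
  continuous (fun t => Num.min (f t) (g t)).
Proof. by move=> fc gc t; apply: continuous_min; [exact: fc|exact: gc]. Qed.

Lemma cont_max (f g : R -> R) : continuous f -> continuous g ->
  continuous (fun t => Num.max (f t) (g t)).
Proof. by move=> fc gc t; apply: continuous_max; [exact: fc|exact: gc]. Qed.

(** Only heights in [0, 1] have to be compared, since both surfaces lie in the cube
    and r maps [0, 1] onto itself. *)
Lemma vert_bodyP n (T T' U U' : set P2) (S S' : dsurf) r : reparam r ->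
  cob n T T' S -> cob n U U' S' ->
  (forall p t, 0 <= t <= 1 -> (body S' (p, r t) <-> body S (p, t))) ->
  forall q, body S' q <-> (vert r @` body S) q.
Proof.
move=> rr cS cS' h [p s]; split.
  move=> hs; have [_ s0 s1] := cob_body_range cS' hs.
  have [|t t01 ts] := @reparam_surj _ r s rr; first by rewrite s0 s1.
  by exists (p, t); [apply/h => //; rewrite ts|rewrite /vert /= ts].
move=> [[p' t] hp [<- <-]] /=; have [_ t0 t1] := cob_body_range cS hp.
by apply/h => //; rewrite t0 t1.
Qed.

(** Takes the breakpoints 1/4, 1/2 of S3 (S2 S1) to the breakpoints 1/2, 3/4 of
    (S3 S2) S1.  The slopes 2, 1, 1/2 decrease, so the map is a minimum of affine
    maps. *)
Definition assoc_r (t : R) : R := Num.min (2 * t) (Num.min (t + 1/4) ((t + 1) / 2)).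

Lemma assoc_rP t :
  [/\ t <= 1/4 & assoc_r t = 2 * t] \/ [/\ 1/4 <= t, t <= 1/2 & assoc_r t = t + 1/4] \/
  [/\ 1/2 <= t & assoc_r t = (t + 1) / 2].
Proof.
have [h1|h1] := leP t (1/4).
  by left; split; rewrite // /assoc_r min_l // le_min; lra.
right; have [h2|h2] := leP t (1/2).
  by left; split; [lra|lra|rewrite /assoc_r [X in Num.min _ X]min_l ?min_r; lra].
by right; split; [lra|rewrite /assoc_r [X in Num.min _ X]min_r ?min_r; lra].
Qed.

Lemma reparam_assoc : reparam assoc_r.
Proof.
split.
- apply: cont_min; last apply: cont_min.
  + by move=> t; apply: cvgM; [exact: cvg_cst|exact: cvg_id].
  + by move=> t; apply: cvgD; [exact: cvg_id|exact: cvg_cst].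
  + move=> t; apply: cvgM; last exact: cvg_cst.
    by apply: cvgD; [exact: cvg_id|exact: cvg_cst].
- move=> s t st.
  by case: (assoc_rP s) => [[? ->]|[[? ? ->]|[? ->]]];
    case: (assoc_rP t) => [[? ->]|[[? ? ->]|[? ->]]]; lra.
- by case: (assoc_rP 0) => [[? ->]|[[? ? ->]|[? ->]]]; lra.
- by case: (assoc_rP 1) => [[? ->]|[[? ? ->]|[? ->]]]; lra.
Qed.

(** Heights outside [0, 1] are allowed: the affine rescalings of the layers of a
    composite produce them, and there the surface is empty. *)
Lemma body_iff n (T T' : set P2) S p (s t : R) : cob n T T' S ->
  s = t \/ (s < 0 \/ 1 < s) /\ (t < 0 \/ 1 < t) ->
  (body S (p, s) <-> body S (p, t)).
Proof.
move=> cS [-> //|[h1 h2]].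
by split=> h; have [_ ? ?] := cob_body_range cS h; exfalso; lra.
Qed.

Lemma meq_assoc n (T0 T1 T2 T3 : set P2) S1 S2 S3 :
  cob n T0 T1 S1 -> cob n T1 T2 S2 -> cob n T2 T3 S3 ->
  meq n T0 T3 [:: (1, scomp S3 (scomp S2 S1))] [:: (1, scomp (scomp S3 S2) S1)].
Proof.
move=> c1 c2 c3; have c21 := cob_scomp c1 c2; have c32 := cob_scomp c2 c3.
have cl := cob_scomp c21 c3; have cr := cob_scomp c1 c32.
have lr (A A' B B' C C' : Prop) : (A <-> A') -> (B <-> B') -> (C <-> C') ->
  ((A \/ B) \/ C <-> A' \/ B' \/ C') by tauto.
have bE := vert_bodyP reparam_assoc cl cr.
have {}bE : forall q, body (scomp (scomp S3 S2) S1) q <->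
                    (vert assoc_r @` body (scomp S3 (scomp S2 S1))) q.
  apply: bE => p t t01; rewrite !scomp_body; apply: lr.
  + apply: body_iff c3 _.
    case: (assoc_rP t) => [[? ->]|[[? ? ->]|[? ->]]]; last (by left; field); first by right; split; left; lra.
    by have [?|?] := ltP t (1/2); [right; split; left; lra|left; lra].
  + apply: body_iff c2 _.
    case: (assoc_rP t) => [[? ->]|[[? ? ->]|[? ->]]]; last first.
    * by have [?|?] := ltP (1/2) t; [right; split; right; lra|left; lra].
    * by left; field.
    * by have [?|?] := ltP t (1/4); [right; split; left; lra|left; lra].
  + apply: body_iff c1 _.
    case: (assoc_rP t) => [[? ->]|[[? ? ->]|[? ->]]]; first (by left; field);
      last by right; split; right; lra.
    by have [?|?] := ltP (1/4) t; [right; split; right; lra|left; lra].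
apply: (@meq_reparam _ _ _ _ _ _ assoc_r (vert assoc_r)) => //.
- exact: reparam_assoc.
- rewrite /scomp /dunion /= !map_cat -!map_comp -catA.
  have rng n' (U U' : set P2) S d : cob n' U U' S -> d \in dots S -> 0 <= d.2 <= 1.
    move=> cS dS; have [_ _ _ _ dB] := cS; have := dB d dS.
    by case: d {dS} => p t /(cob_body_range cS)[_ -> ->].
  congr (_ ++ (_ ++ _)); apply/eq_in_map => -[p t] /= hd.
  + have /= := rng _ _ _ _ _ c3 hd => h; congr pair.
    by case: (assoc_rP ((1 + t) / 2)) => [[? ->]|[[? ? ->]|[? ->]]]; lra.
  + have /= := rng _ _ _ _ _ c2 hd => h; congr pair.
    by case: (assoc_rP (((1 + t) / 2) / 2)) => [[? ->]|[[? ? ->]|[? ->]]]; lra.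
  + have /= := rng _ _ _ _ _ c1 hd => h; congr pair.
    by case: (assoc_rP ((t / 2) / 2)) => [[? ->]|[[? ? ->]|[? ->]]]; lra.
- move=> d hd; apply: connected_component_refl.
  by apply/bE; exists d => //; case: cl => _ _ _ _; apply.
Qed.

(** Slope of the segment through (1 - e, (1 - e) / 2) and (1, 1), which stretches a
    collar of width e to a collar of width (1 + e) / 2. *)
Definition steep (e : R) : R := (1 + e) / (2 * e).
Definition unitl_r (e t : R) : R := Num.max (t / 2) (1 - (1 - t) * steep e).
Definition unitr_r (e t : R) : R := Num.min (steep e * t) ((1 + t) / 2).

Lemma steepE e : 0 < e -> steep e * e = (1 + e) / 2.
Proof. by move=> e0; rewrite /steep; field; lra. Qed.

Lemma steep_gt e : 0 < e -> 1/2 < steep e.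
Proof. by move=> e0; rewrite /steep ltr_pdivlMr; lra. Qed.

Lemma steep_ge1 e : 0 < e -> e < 1/2 -> 1 <= steep e.
Proof. by move=> e0 e1; rewrite /steep ler_pdivlMr; lra. Qed.

Lemma unitl_rP e t : 0 < e -> t <= 1 ->
  [/\ t <= 1 - e & unitl_r e t = t / 2] \/
  [/\ 1 - e <= t, (1 - e) / 2 <= unitl_r e t & unitl_r e t <= 1].
Proof.
move=> e0 t1; have h1 := steepE e0; have h2 := steep_gt e0.
have [h|h] := leP t (1 - e).
  by left; split=> //; rewrite /unitl_r max_l //; nra.
by right; split; rewrite /unitl_r ?le_max ?ge_max; nra.
Qed.

Lemma unitr_rP e t : 0 < e -> 0 <= t ->
  [/\ e <= t & unitr_r e t = (1 + t) / 2] \/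
  [/\ t <= e, 0 <= unitr_r e t & unitr_r e t <= (1 + e) / 2].
Proof.
move=> e0 t1; have h1 := steepE e0; have h2 := steep_gt e0.
have [h|h] := leP e t.
  by left; split=> //; rewrite /unitr_r min_r //; nra.
by right; split; rewrite /unitr_r ?le_min ?ge_min; nra.
Qed.

Lemma reparam_unitl e : 0 < e -> e < 1/2 -> reparam (unitl_r e).
Proof.
move=> e0 e1; have h0 := steep_ge1 e0 e1; have h1 := steepE e0; have h2 := steep_gt e0; split.
- apply: cont_max; first by move=> t; apply: cvgM; [exact: cvg_id|exact: cvg_cst].
  move=> t; apply: cvgB; first exact: cvg_cst.
  apply: cvgM; last exact: cvg_cst.
  by apply: cvgB; [exact: cvg_cst|exact: cvg_id].
- move=> s t st; rewrite /unitl_r lt_max !gt_max.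
  have h3 : 1 - (1 - s) * steep e < 1 - (1 - t) * steep e by nra.
  have h4 : s / 2 < t / 2 by lra.
  have [h|h] := leP (1 - (1 - t) * steep e) (t / 2); apply/orP; [left|right]; apply/andP; split; lra.
- by rewrite /unitl_r max_l; nra.
- by rewrite /unitl_r max_r; nra.
Qed.

Lemma reparam_unitr e : 0 < e -> e < 1/2 -> reparam (unitr_r e).
Proof.
move=> e0 e1; have h0 := steep_ge1 e0 e1; have h1 := steepE e0; have h2 := steep_gt e0; split.
- apply: cont_min; first by move=> t; apply: cvgM; [exact: cvg_cst|exact: cvg_id].
  move=> t; apply: cvgM; last exact: cvg_cst.
  by apply: cvgD; [exact: cvg_cst|exact: cvg_id].
- move=> s t st; rewrite /unitr_r gt_min !lt_min.
  have h3 : steep e * s < steep e * t by nra.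
  have h4 : (1 + s) / 2 < (1 + t) / 2 by lra.
  have [h|h] := leP (steep e * s) ((1 + s) / 2); apply/orP; [left|right]; apply/andP; split; lra.
- by rewrite /unitr_r min_l; nra.
- by rewrite /unitr_r min_r; nra.
Qed.

(** The glued cylinder is absorbed by stretching the collar of S at its top. *)
Lemma meq_unitl n (T T' : set P2) S : cob n T T' S ->
  meq n T T' [:: (1, S)] [:: (1, scomp (DSurf (cylinder T') [::]) S)].
Proof.
move=> cS; have [e [e0 e1 he he']] := cob_collar cS.
have [[tT tT' _ _] _ _ _ dS] := cS.
have cL := cob_lid tT'; have cc := cob_scomp cS cL.
have rr := reparam_unitl e0 e1; have rS := cob_body_range cS.
have bI p t : 0 <= t <= 1 -> (body (scomp (DSurf (cylinder T') [::]) S) (p, unitl_r e t) <->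
    body S (p, t)).
  move=> t01; rewrite scomp_body /= /cylinder /unitI /=.
  have [|[h ->]|[h h1 h2]] := @unitl_rP e t e0; first lra.
    split; first by case=> [[_]|]; [lra|rewrite (_ : 2 * (t / 2) = t) //; field].
    by move=> h'; right; rewrite (_ : 2 * (t / 2) = t) //; field.
  rewrite (he' p t); last by lra.
  split; first by case=> [[]//|h']; have [_ ? ?] := rS _ _ h'; apply: (proj1 (he' _ _ _) h'); lra.
  move=> Tp; have [h'|h'] := leP (unitl_r e t) (1/2); last by left; split=> //; lra.
  by right; apply: (proj2 (he' _ _ _) Tp); lra.
have bE := vert_bodyP rr cS cc bI.
(* A dot of S is expected at height t / 2; inside the collar the isotopy carries
   it to another point of the same vertical segment. *)
apply: (meq_reparam (g := vert (fun t => t / 2)) rr cS cc bE) => // -[p t] hd.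
have hb := dS _ hd; have [_ t0 t1] := rS _ _ hb.
have [|[h h']|[h h1 h2]] := @unitl_rP e t e0; first exact: t1.
  rewrite /vert /= h'; apply: connected_component_refl; rewrite -h'.
  by apply: (proj2 (bI _ _ _) hb); lra.
rewrite /vert; apply: (@connected_vert _ _ _ ((1 - e) / 2) 1); [|rewrite /=; lra|rewrite /=; lra].
move=> x hx; have Tp : T' p by apply: (proj1 (he' _ _ _) hb); lra.
apply: (proj2 (scomp_body _ _ _ _)); have [h'|h'] := leP x (1/2).
  by right; apply: (proj2 (he' _ _ _) Tp); lra.
by left; split=> //=; rewrite /unitI /=; lra.
Qed.

(** The glued cylinder is absorbed by stretching the collar of S at its bottom. *)
Lemma meq_unitr n (T T' : set P2) S : cob n T T' S ->
  meq n T T' [:: (1, S)] [:: (1, scomp S (DSurf (cylinder T) [::]))].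
Proof.
move=> cS; have [e [e0 e1 he he']] := cob_collar cS.
have [[tT tT' _ _] _ _ _ dS] := cS.
have cL := cob_lid tT; have cc := cob_scomp cL cS.
have rr := reparam_unitr e0 e1; have rS := cob_body_range cS.
have bI p t : 0 <= t <= 1 -> (body (scomp S (DSurf (cylinder T) [::])) (p, unitr_r e t) <->
    body S (p, t)).
  move=> t01; rewrite scomp_body /= /cylinder /unitI /=.
  have [|[h ->]|[h h1 h2]] := @unitr_rP e t e0; first lra.
    rewrite (_ : 2 * ((1 + t) / 2) - 1 = t); last by field.
    by split; [case=> // -[_]; lra|left].
  rewrite (he p t); last by lra.
  split; first by case=> [h'|[]//]; have [_ ? ?] := rS _ _ h'; apply: (proj1 (he _ _ _) h'); lra.
  move=> Tp; have [h'|h'] := leP (unitr_r e t) (1/2); first by right; split=> //; lra.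
  by left; apply: (proj2 (he _ _ _) Tp); lra.
have bE := vert_bodyP rr cS cc bI.
apply: (meq_reparam (g := vert (fun t => (1 + t) / 2)) rr cS cc bE) => [|[p t] hd].
  by rewrite /= cats0.
have hb := dS _ hd; have [_ t0 t1] := rS _ _ hb.
have [|[h h']|[h h1 h2]] := @unitr_rP e t e0; first exact: t0.
  rewrite /vert /= h'; apply: connected_component_refl; rewrite -h'.
  by apply: (proj2 (bI _ _ _) hb); lra.
rewrite /vert; apply: (@connected_vert _ _ _ 0 ((1 + e) / 2)); [|rewrite /=; lra|rewrite /=; lra].
move=> x hx; have Tp : T p by apply: (proj1 (he _ _ _) hb); lra.
apply: (proj2 (scomp_body _ _ _ _)); have [h'|h'] := leP x (1/2).
  by right; split=> //=; rewrite /unitI /=; lra.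
by left; apply: (proj2 (he _ _ _) Tp); lra.
Qed.
End CategoryLaws.

(** * Euler characteristics of composites and of cylinders *)

Section CellAttachment.
Local Open Scope classical_set_scope.
Context {R : realType}.
Local Notation P2 := (R * R)%type.
Local Notation P3 := ((R * R) * R)%type.
Set Implicit Arguments.
Unset Strict Implicit.

Lemma attach_sub (A X : set P3) c : attach A X c -> A `<=` X.
Proof. by elim=> // X' E c' d f g _ IH _ _ _ _ p /IH; left. Qed.

Lemma attach_trans (A X Y : set P3) c c' :
  attach A X c -> attach X Y c' -> attach A Y (c + c').
Proof.
move=> h; elim=> [|X' E c0 d f g _ IH dle hE dis cl]; first by rewrite addr0.
by rewrite addrA; exact: attach_cell hE dis cl.
Qed.

(** Attaching the same cells to a larger set.  A cell of X misses B because it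
    misses A, which contains the part of X in B. *)
Lemma attach_union (A B X : set P3) c : attach A X c -> closed B -> B `&` X `<=` A ->
  attach (B `|` A) (B `|` X) c.
Proof.
move=> h Bc; elim: h => [|X' E c0 d f g hA IH dle hE dis cl] BX; first exact: attach_nil.
rewrite setUA; apply: attach_cell hE _ _ => //.
- by apply: IH => p [Bp Xp]; apply: BX; split=> //; left.
- apply/eqP; rewrite setIUl dis setU0; apply/eqP; rewrite -subset0 => p [Bp Ep].
  have Ap : A p by apply: BX; split=> //; right.
  by rewrite -dis; split=> //; exact: attach_sub hA _ Ap.
- by rewrite -setUA; exact: closedU.
Qed.

Lemma attach_affine (a b : R) (A X : set P3) c : a != 0 -> attach A X c ->
  let m (p : P3) : P3 := (p.1, a * p.2 + b) in attach (m @` A) (m @` X) c.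
Proof.
move=> a0 h m; elim: h => [|X' E c0 d f g hA IH dle [fc gc fg gf] dis cl].
  exact: attach_nil.
pose mi (p : P3) : P3 := (p.1, a^-1 * p.2 + - b / a).
have mK : cancel m mi by case=> p s; rewrite /m /mi /=; congr pair; field.
have miK : cancel mi m by case=> p s; rewrite /m /mi /=; congr pair; field.
have mc : continuous m by exact: cont_vert (@cont_affine _ _ _).
have mic : continuous mi by exact: cont_vert (@cont_affine _ _ _).
rewrite image_setU; apply: (@attach_cell _ _ _ _ _ d (f \o mi) (m \o g)) => //.
- split.
  + apply: (within_comp _ fc); first exact: within_cont.
    by move=> _ [p Ep <-]; rewrite mK.
  + by apply: (@within_comp _ _ _ _ setT) => //; exact: within_cont.
  + by move=> _ [p Ep <-]; have [h1 h2] := fg _ Ep; rewrite /= mK h2.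
  + move=> q /gf[h1 h2]; split; first by exists (g q).
    by rewrite /= mK.
- rewrite -subset0 => p [[x Xx <-] [y Ey /(can_inj mK) yx]].
  have : set0 x by rewrite -dis; split; rewrite // -yx.
  by [].
- by rewrite -image_setU; exact: closed_vert.
Qed.

(** Each Euler characteristic counts the cells added to the top boundary, itself of
    Euler characteristic n.  The bottom boundary of the upper half is the top
    boundary of the lower half, so it is counted twice. *)
Lemma euler_scomp n (T T' T'' : set P2) S S' c c' :
  cob n T T' S -> cob n T' T'' S' -> euler n T' S c -> euler n T'' S' c' ->
  euler n T'' (scomp S' S) (c + c' - n%:Z).
Proof.
move=> cS cS' [e [_ hS ->]] [e' [h0 hS' ->]]; exists (e' + e).
split=> //; last by ring.
have h2 : (1/2 : R) != 0 by apply/eqP; lra.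
have hu := attach_affine (1/2) h2 hS'; have hd := attach_affine 0 h2 hS.
have [x [x0 x1 hx hx']] := cob_collar cS; have [y [y0 y1 hy hy']] := cob_collar cS'.
set up := (fun p : P3 => (p.1, 1/2 * p.2 + 1/2)) in hu.
set dn := (fun p : P3 => (p.1, 1/2 * p.2 + 0)) in hd.
rewrite /= -/up in hu; rewrite /= -/dn in hd.
have eu : up @` at_height T'' 1 = at_height T'' 1.
  apply/seteqP; split=> [_ [[p s] [/= Tp ->] <-]|[p s] [/= Tp ->]].
    by split=> //=; field.
  by exists (p, 1); rewrite /up //=; congr pair; field.
rewrite eu in hu; apply: attach_trans hu _.
have Ac : dn @` at_height T' 1 `<=` up @` body S'.
  move=> _ [[p s] [/= Tp ->] <-]; exists (p, 0); first by apply/hy => //; lra.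
  by rewrite /up /dn /=; congr pair; field.
have [[_ _ Sc' _] _ _ _ _] := cS'.
(* The two halves meet in T' at height 1/2, from which the cells of the lower
   half are attached. *)
have := @attach_union _ (up @` body S') _ _ hd _ _.
rewrite (setUidl Ac) (_ : up @` body S' `|` dn @` body S = body (scomp S' S)).
  apply; first exact: closed_vert.
  move=> q [[[p s] h1 <-] [[p' s'] h3 [pp ss]]].
  have [_ s0 s1] := cob_body_range cS' h1; have [_ s0' s1'] := cob_body_range cS h3.
  have s'1 : s' = 1 by lra.
  exists (p', s'); last by rewrite /up /dn pp ss.
  split=> //=; apply: (proj1 (hx' _ _ _) h3); lra.
rewrite /scomp /dunion /=; congr (_ `|` _).
  by congr (_ @` _); apply/funext => -[p s]; rewrite /up /=; congr pair; field.
by congr (_ @` _); apply/funext => -[p s]; rewrite /dn /=; congr pair; field.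
Qed.

(** The analogue of [attach] for 1-manifolds in the square.  Having only cells of
    dimension at most 1, it can be multiplied with an interval. *)
Inductive attach1 : set P2 -> int -> Prop :=
| attach1_nil : attach1 set0 0
| attach1_cell X E c d (f g : P2 -> P2) : attach1 X c -> (d <= 1)%N ->
    homeo_on E (open_cell d) f g -> X `&` E = set0 -> closed (X `|` E) ->
    attach1 (X `|` E) (c + (-1) ^+ d).

Lemma attach1_closed X c : attach1 X c -> closed X.
Proof. by case=> // *; exact: closed0. Qed.

Lemma closed_level (X : set P2) (s : R) : closed X -> closed (at_height X s).
Proof.
move=> Xc; rewrite (_ : at_height X s = fst @^-1` X `&` snd @^-1` [set s]) //.
apply: closedI; first by apply: closed_comp Xc => p _; exact: cont_fst.
by apply: closed_comp; [move=> p _; exact: cont_snd|exact: closed_eq].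
Qed.

Lemma homeo_level (E : set P2) (F : set P2) f g (s : R) : homeo_on E F f g ->
  homeo_on (at_height E s) F (fun p => f p.1) (fun q => (g q, s)).
Proof.
move=> [fc gc fg gf]; split.
- by apply: (within_comp _ fc); [apply: within_cont; exact: cont_fst|move=> p []].
- by apply: within_pair => //; apply: within_cont => x; exact: cvg_cst.
- by move=> [p t] [/= Ep ->]; have [h ->] := fg _ Ep.
- by move=> q /gf[].
Qed.

Lemma attach1_level X c : attach1 X c -> attach set0 (at_height X 1) c.
Proof.
elim=> [|X' E c0 d f g hX IH dle hE dis cl].
  rewrite (_ : at_height _ _ = set0); first exact: attach_nil.
  by rewrite -subset0 => p [].
have e : at_height (X' `|` E) 1 = at_height X' 1 `|` at_height E 1.
  by apply/seteqP; split=> p; rewrite /at_height /=; tauto.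
rewrite e; apply: attach_cell (homeo_level 1 hE) _ _ => //.
- by apply: leq_trans dle _.
- by rewrite -subset0 => p [[h _] [h' _]]; have : set0 p.1 by rewrite -dis.
- by rewrite -e; exact: closed_level.
Qed.

Definition to_line (t : R) : R := (2 * t - 1) / (1 - `|2 * t - 1|).
Definition of_line (y : R) : R := (1 + y / (1 + `|y|)) / 2.

Lemma of_line_open y : Defs.openI (of_line y).
Proof.
rewrite /Defs.openI /of_line /=; have h : 0 < 1 + `|y| by have := normr_ge0 y; lra.
have h1 : y / (1 + `|y|) < 1.
  by rewrite ltr_pdivrMr // mul1r; have := ler_norm y; lra.
have h2 : -1 < y / (1 + `|y|).
  by rewrite ltr_pdivlMr //; have := ler_norm (- y); rewrite normrN; lra.
lra.
Qed.

Lemma to_lineK t : Defs.openI t -> of_line (to_line t) = t.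
Proof.
move=> /andP[t0 t1]; rewrite /of_line /to_line.
have h : 0 < 1 - `|2 * t - 1| by rewrite subr_gt0 ltr_norml; lra.
rewrite normrM normfV (gtr0_norm h); field.
by apply/andP; split; lra.
Qed.

Lemma of_lineK y : to_line (of_line y) = y.
Proof.
rewrite /of_line /to_line; have h : 0 < 1 + `|y| by have := normr_ge0 y; lra.
have -> : 2 * ((1 + y / (1 + `|y|)) / 2) - 1 = y / (1 + `|y|) by field; lra.
rewrite normrM normfV (gtr0_norm h); field.
by apply/andP; split; lra.
Qed.

Lemma of_line_cont : continuous of_line.
Proof.
move=> y; apply: cvgM; last exact: cvg_cst.
apply: cvgD; first exact: cvg_cst.
apply: cvgM; first exact: cvg_id.
apply: cvgV; first by have := normr_ge0 y; rewrite lt0r_neq0 //; lra.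
by apply: cvgD; [exact: cvg_cst|exact: cvg_norm].
Qed.

Lemma to_line_cont : {within Defs.openI, continuous to_line}.
Proof.
apply/subspace_continuousP => t /andP[t0 t1]; apply: cvg_within_filter.
have c : continuous (fun t : R => 2 * t - 1) by exact: cont_affine.
apply: cvgM; first exact: c.
apply: cvgV; first by rewrite lt0r_neq0 // subr_gt0 ltr_norml; lra.
by apply: cvgB; [exact: cvg_cst|apply: cvg_norm; exact: c].
Qed.

Lemma within_comp_cont (P P' P'' : topologicalType) (A : set P) (f : P -> P') (g : P' -> P'') :
  {within A, continuous f} -> continuous g -> {within A, continuous (fun x => g (f x))}.
Proof.
by move=> fc gc; apply: (@within_comp _ _ _ _ setT) fc (within_cont gc) _.
Qed.

Lemma homeo_slab (E : set P2) d (f g : P2 -> P2) : (d <= 1)%N -> homeo_on E (open_cell d) f g ->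
  exists (f' : P3 -> P2) (g' : P2 -> P3), homeo_on [set p : P3 | E p.1 /\ Defs.openI p.2] (open_cell d.+1) f' g'.
Proof.
set A := [set p : P3 | _].
have A1 : {within A, continuous (fun p : P3 => p.1)} by apply: within_cont; exact: cont_fst.
have A2 : {within A, continuous (fun p : P3 => p.2)} by apply: within_cont; exact: cont_snd.
have AL : {within A, continuous (fun p : P3 => to_line p.2)}.
  by apply: (within_comp A2 to_line_cont) => p [].
case: d => [_ [fc gc fg gf]|[_ [fc gc fg gf]|//]].
- have [Eg _] := gf (0, 0) erefl.
  have E1 p : E p -> p = g (0, 0) by move=> /fg[-> ->].
  exists (fun p => (to_line p.2, 0)), (fun q => (g (0, 0), of_line q.1)); split.
  + by apply: within_pair => //; apply: within_cont => x; exact: cvg_cst.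
  + apply: within_cont; apply: cont_pair; first by move=> x; exact: cvg_cst.
    by apply: cont_comp of_line_cont; exact: cont_fst.
  + by move=> [p t] [/= /E1 -> t01]; rewrite to_lineK.
  + move=> [x y] /= ->; split; first by split=> //; exact: of_line_open.
    by rewrite of_lineK.
- exists (fun p => ((f p.1).1, to_line p.2)), (fun q => (g (q.1, 0), of_line q.2)); split.
  + apply: within_pair => //; apply: within_comp_cont (@cont_fst _ _).
    by apply: (within_comp A1 fc) => p [].
  + apply: within_pair; last first.
      by apply: within_cont; apply: cont_comp of_line_cont; exact: cont_snd.
    apply: (within_comp (f := fun q : P2 => (q.1, 0)) _ gc) => //.
    by apply: within_cont; apply: cont_pair; [exact: cont_fst|move=> x; exact: cvg_cst].
  + move=> [p t] [/= Ep t01]; have [h1 h2] := fg _ Ep; split=> //.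
    by rewrite to_lineK // -[X in _ = (X, _)]h2 -h1 -surjective_pairing.
  + move=> [x y] _ /=; have [h1 h2] := gf (x, 0) erefl; rewrite h2 of_lineK; split=> //.
    by split=> //; exact: of_line_open.
Qed.

(** A cell E of the tangle gives two cells of the cylinder of consecutive
    dimensions, whose contributions cancel. *)
Lemma attach1_cylinder (T X : set P2) c : attach1 X c -> closed T -> X `<=` T ->
  attach (at_height T 1) (at_height T 1 `|` cylinder X) 0.
Proof.
move=> hX Tc; elim: hX => [_|X' E c0 d f g hX IH dle hE dis cl XT].
  rewrite (_ : cylinder set0 = set0) ?setU0; first exact: attach_nil.
  by rewrite -subset0 => p [].
have X'T : X' `<=` T by move=> p hp; apply: XT; left.
have ET : E `<=` T by move=> p hp; apply: XT; right.
have [f' [g' hs]] := homeo_slab dle hE.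
have Xc := attach1_closed hX.
have dE p : X' p -> E p -> False by move=> h h'; have : set0 p by rewrite -dis.
(* E contributes its copy at the bottom and its product with the open interval;
   the copy at the top belongs to the starting set. *)
have e1 : (at_height T 1 `|` cylinder X') `|` at_height E 0 =
   (at_height T 1 `|` cylinder X') `|` at_height (X' `|` E) 0.
  apply/seteqP; split=> p; first by case=> [|[h1 h2]]; [left|right; split=> //; right].
  case=> [|[[h1|h1] h2]]; [by left|left; right; split=> //|by right].
  by rewrite h2 /unitI /=; lra.
have s1 : attach (at_height T 1) ((at_height T 1 `|` cylinder X') `|` at_height E 0)
     (0 + (-1) ^+ d).
  apply: attach_cell (IH X'T) _ (homeo_level 0 hE) _ _; first exact: leq_trans dle _.
    rewrite -subset0 => p [[[_ h1]|[h1 _]] [h2 h3]]; last exact: dE h2.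
    by move: h1; rewrite h3 => h; exfalso; move: h => /eqP; rewrite eq_sym oner_eq0.
  rewrite e1; apply: closedU; last exact: closed_level.
  by apply: closedU; [exact: closed_level|exact: closed_cylinder].
have e2 : ((at_height T 1 `|` cylinder X') `|` at_height E 0) `|`
     [set p : P3 | E p.1 /\ Defs.openI p.2] = at_height T 1 `|` cylinder (X' `|` E).
  apply/seteqP; split=> p.
    case=> [[[h|[h1 h2]]|[h1 h2]]|[h1 h2]]; [by left|right; split=> //; by left| |].
      by right; split; [right|rewrite h2 /unitI /=; lra].
    by right; split; [right|move: h2; rewrite /unitI /Defs.openI /=; lra].
  case=> [h|[[h1|h1] h2]]; [by left; left; left|by left; left; right|].
  have [h3|h3] := eqVneq p.2 0; first by left; right.
  have [h4|h4] := eqVneq p.2 1; first by left; left; left; split=> //; exact: ET.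
  right; split=> //; move: h2; rewrite /unitI /Defs.openI /= => /andP[h5 h6].
  by rewrite !lt_neqAle h5 h6 h4 eq_sym h3.
suff : attach (at_height T 1) (at_height T 1 `|` cylinder (X' `|` E))
    ((0 + (-1) ^+ d) + (-1) ^+ d.+1) by rewrite exprS mulN1r add0r subrr.
rewrite -e2; apply: attach_cell s1 _ hs _ _ => //.
  rewrite -subset0 => p [[[[_ h1]|[h1 _]]|[_ h1]] [h2 /andP[h3 h4]]]; last 2 first.
  - exact: dE h2.
  - by move: h3; rewrite h1 ltxx.
  - by move: h4; rewrite h1 ltxx.
rewrite e2; apply: closedU; [exact: closed_level|exact: closed_cylinder].
Qed.
End CellAttachment.

(** * Cell decompositions of tangles *)

Section EulerIdentity.
Local Open Scope classical_set_scope.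
Context {R : realType}.
Local Notation P2 := (R * R)%type.
Local Notation P3 := ((R * R) * R)%type.
Set Implicit Arguments.
Unset Strict Implicit.

Lemma openI_unitI (s : R) : Defs.openI s -> unitI s.
Proof. by move=> /andP[h1 h2]; rewrite /unitI /= !ltW. Qed.

(** Stated for parametrisations that may identify the two ends, so that it serves both
    arcs and circles. *)
Lemma arc_inverse (ga : R -> P2) : {within unitI, continuous ga} ->
  (forall s s', Defs.openI s -> unitI s' -> ga s' = ga s -> s' = s) ->
  exists2 g : P2 -> R, {within ga @` Defs.openI, continuous g} &
    forall s, Defs.openI s -> g (ga s) = s.
Proof.
move=> gac inj.
pose g p := xget 0 [set s | Defs.openI s /\ ga s = p].
have gK s : Defs.openI s -> g (ga s) = s.
  move=> so; rewrite /g; case: xgetP => [s' _ [so' h]|/(_ s) h].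
    by apply: inj => //; exact: openI_unitI.
  by exfalso; apply: h.
exists g => //; apply/within_continuousP => _ [s so <-] N; rewrite gK //.
rewrite nbhsE => -[G [Go Gs] GN].
(* Continuity of g at ga s: the image of the complement of a neighbourhood of s
   is compact, hence closed, and misses ga s. *)
pose K := ga @` (unitI `&` ~` G).
have Kc : closed K.
  apply: compact_closed; first exact: norm_hausdorff.
  apply: continuous_compact; first by apply: within_sub gac => x [].
  apply: compact_closedI; last exact: open_closedC.
  by rewrite unitI_itv; exact: segment_compact.
exists (~` K).
  split; first exact: closed_openC.
  by move=> [x [xu xG] /inj]; move/(_ so xu) => xs; apply: xG; rewrite xs.
move=> y nK [x xo xy]; rewrite -xy gK //; rewrite -xy in nK; apply: GN.
by apply: contrapT => xG; apply: nK; exists x => //; split=> //; exact: openI_unitI.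
Qed.

Lemma attach1_point (X : set P2) c p : attach1 X c -> ~ X p ->
  attach1 (X `|` [set p]) (c + 1).
Proof.
move=> hX Xp; apply: (@attach1_cell _ _ _ c 0 (fun=> (0, 0)) (fun=> p)) => //.
- split=> /=; [| |by move=> q ->|by move=> q ->].
    by apply: within_cont => x; exact: cvg_cst.
  by apply: within_cont => x; exact: cvg_cst.
- by rewrite -subset0 => q [Xq /= qp]; apply: Xp; rewrite -qp.
- apply: closedU; first exact: attach1_closed hX.
  by apply: compact_closed; [exact: norm_hausdorff|exact: compact_set1].
Qed.

(** A cell decomposition of an arc or of a circle first adds the images of the end
    parameters and then the rest as a 1-cell. *)
Lemma attach1_open_arc (X : set P2) c (ga : R -> P2) : attach1 X c ->
  {within unitI, continuous ga} ->
  (forall s s', Defs.openI s -> unitI s' -> ga s' = ga s -> s' = s) ->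
  (forall s, Defs.openI s -> ~ X (ga s)) -> X (ga 0) -> X (ga 1) ->
  attach1 (X `|` ga @` unitI) (c - 1).
Proof.
move=> hX gac inj dis X0 X1; have [g gc gK] := arc_inverse gac inj.
have e : X `|` ga @` unitI = X `|` ga @` Defs.openI.
  apply/seteqP; split=> p [|[s su <-]]; [by left| |by left|].
    have [s0|s0] := eqVneq s 0; first by left; rewrite s0.
    have [s1|s1] := eqVneq s 1; first by left; rewrite s1.
    right; exists s => //; move: su => /andP[h1 h2].
    by rewrite /Defs.openI /= !lt_neqAle h1 h2 s1 eq_sym s0.
  by right; exists s => //; exact: openI_unitI.
have cl : closed (X `|` ga @` unitI).
  by apply: closedU; [exact: attach1_closed hX|exact: compact_image_closed].
rewrite e in cl *; rewrite -[- 1]expr1.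
apply: (@attach1_cell _ _ _ c 1 (fun p => (to_line (g p), 0)) (fun q => ga (of_line q.1))) => //.
- split.
  + apply: within_pair; last by apply: within_cont => x; exact: cvg_cst.
    by apply: (within_comp gc to_line_cont) => _ [s so <-]; rewrite gK.
  + apply: (within_comp (f := fun q : P2 => of_line q.1) _ gac).
      by apply: within_cont; apply: cont_comp of_line_cont; exact: cont_fst.
    by move=> q _; apply: openI_unitI; exact: of_line_open.
  + by move=> _ [s so <-]; rewrite gK // to_lineK.
  + move=> [x y] /= y0; have ho := of_line_open x.
    split; first by exists (of_line x).
    by rewrite gK // of_lineK y0.
- by rewrite -subset0 => p [h [s so e']]; apply: (dis s so); rewrite e'.
Qed.

Lemma unitI0 : unitI (0 : R).
Proof. by rewrite /unitI /= lexx ler01. Qed.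
Lemma unitI1 : unitI (1 : R).
Proof. by rewrite /unitI /= lexx ler01. Qed.

Lemma attach1_arc (X : set P2) c (ga : R -> P2) : attach1 X c ->
  {within unitI, continuous ga} -> set_inj unitI ga ->
  X `&` ga @` unitI = set0 -> attach1 (X `|` ga @` unitI) (c + 1).
Proof.
move=> hX gac inj dis.
have dX s : unitI s -> ~ X (ga s).
  by move=> su h; have : set0 (ga s) by rewrite -dis; split=> //; exists s.
have inj' s s' : unitI s -> unitI s' -> ga s = ga s' -> s = s'.
  by move=> h1 h2; apply: inj; rewrite inE.
have h1 := attach1_point hX (dX 0 unitI0).
have h2 : attach1 ((X `|` [set ga 0]) `|` [set ga 1]) (c + 1 + 1).
  apply: attach1_point h1 _ => -[|/= h]; first by apply: dX; exact: unitI1.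
  by have /eqP := inj' _ _ unitI1 unitI0 h; rewrite oner_eq0.
have h3 := @attach1_open_arc _ _ ga h2 gac _ _ _ _.
have <- : c + 1 + 1 - 1 = c + 1 by ring.
have <- : ((X `|` [set ga 0]) `|` [set ga 1]) `|` ga @` unitI = X `|` ga @` unitI.
  apply/seteqP; split=> p.
    case=> [[[h|->]|->]|h]; [by left| | |by right].
      by right; exists 0 => //; exact: unitI0.
    by right; exists 1 => //; exact: unitI1.
  by case=> h; [left; left; left|right].
apply: h3; [|move=> s so|by left; right|by right].
  by move=> s s' so su; apply: inj' => //; exact: openI_unitI.
have su := openI_unitI so; have /andP[s0 s1] := so.
case=> [[h|/= h]|/= h]; first exact: dX h.
  by move: s0; rewrite (inj' _ _ su unitI0 h) ltxx.
by move: s1; rewrite (inj' _ _ su unitI1 h) ltxx.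
Qed.

Lemma attach1_circle (X : set P2) c (de : R -> P2) : attach1 X c ->
  {within unitI, continuous de} -> set_inj [set s | 0 <= s < 1] de -> de 0 = de 1 ->
  X `&` de @` unitI = set0 -> attach1 (X `|` de @` unitI) c.
Proof.
move=> hX dec inj e01 dis.
have dX s : unitI s -> ~ X (de s).
  by move=> su h; have : set0 (de s) by rewrite -dis; split=> //; exists s.
have inj' s s' : Defs.openI s -> unitI s' -> de s' = de s -> s' = s.
  move=> /andP[s0 s1] /andP[s0' s1'].
  have [->|ne] := eqVneq s' 1.
    rewrite -e01 => h; have h0 : 0 = s.
      by apply: (inj _ _ _ _ h); rewrite inE /=; lra.
    by move: s0; rewrite -h0 ltxx.
  have {}s1' : s' < 1 by rewrite lt_neqAle ne.
  by apply: inj; rewrite inE /=; lra.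
have h1 := attach1_point hX (dX 0 unitI0).
have h3 := @attach1_open_arc _ _ de h1 dec inj' _ _ _.
have <- : c + 1 - 1 = c by ring.
have <- : (X `|` [set de 0]) `|` de @` unitI = X `|` de @` unitI.
  apply/seteqP; split=> p.
    case=> [[h|->]|h]; [by left| |by right].
    by right; exists 0 => //; exact: unitI0.
  by case=> h; [left; left|right].
apply: h3; [move=> s so|by right|by right; rewrite -e01].
case=> [h|/= h]; first exact: dX (openI_unitI so) h.
by have /andP[s0 _] := so; move: s0; rewrite -(inj' _ _ so unitI0 (esym h)) ltxx.
Qed.

Lemma bigcup_cons (I : eqType) (i : I) s (F : I -> set P2) :
  \bigcup_(j in [set` i :: s]) F j = \bigcup_(j in [set` s]) F j `|` F i.
Proof.
apply/seteqP; split=> p.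
  by case=> j /=; rewrite inE => /orP[/eqP ->|js] h; [right|left; exists j].
case=> [[j /= js h]|h]; first by exists j => //=; rewrite inE js orbT.
by exists i => //=; rewrite inE eqxx.
Qed.

Lemma tangle_attach1 b t (T : set P2) a c ga de :
  tangle b t T -> @arcs_and_circles R T a c ga de -> attach1 T a%:Z.
Proof.
move=> tT [[ha hc] -> [pa pc] dac _].
have arcs (s : seq 'I_a) : uniq s ->
    attach1 (\bigcup_(i in [set` s]) (ga i @` unitI)) (size s)%:Z.
  elim: s => [_|i s IH /= /andP[nis us]].
    by rewrite (_ : \bigcup_(_ in _) _ = set0); [exact: attach1_nil|rewrite -subset0 => p []].
  rewrite bigcup_cons -addn1 PoszD; have [gac inj] := ha i.
  apply: attach1_arc (IH us) gac inj _; rewrite -subset0 => p [[j /= js hj] hi].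
  have ne : j != i by apply: contraNneq nis => <-.
  by have : set0 p by rewrite -(pa _ _ ne).
have circles (s : seq 'I_c) : uniq s ->
    attach1 (\bigcup_i (ga i @` unitI) `|` \bigcup_(i in [set` s]) (de i @` unitI)) a%:Z.
  elim: s => [_|i s IH /= /andP[nis us]].
    rewrite (_ : \bigcup_(_ in [set` [::]]) _ = set0) ?setU0; last by rewrite -subset0 => p [].
    rewrite -[X in X%:Z](size_enum_ord a).
    rewrite (_ : \bigcup_i _ = \bigcup_(i in [set` enum 'I_a]) (ga i @` unitI));
      first exact: arcs (enum_uniq _).
    by apply/seteqP; split=> p [i _ h]; exists i => //=; rewrite mem_enum.
  rewrite bigcup_cons setUA; have [dec inj e01] := hc i.
  apply: attach1_circle (IH us) dec inj e01 _; rewrite -subset0 => p [[|] [j /= js hj] hi].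
    by have : set0 p by rewrite -(dac j i).
  have ne : j != i by apply: contraNneq nis => <-.
  by have : set0 p by rewrite -(pc _ _ ne).
rewrite (_ : \bigcup_j (de j @` unitI) = \bigcup_(j in [set` enum 'I_c]) (de j @` unitI)).
  exact: circles (enum_uniq _).
by apply/seteqP; split=> p [i _ h]; exists i => //=; rewrite mem_enum.
Qed.

Definition mark n (x : 'I_n * bool) : P2 := (strand n x.1, (x.2 : nat)%:R).

Lemma markP n p : marks n n p <-> exists x : 'I_n * bool, p = mark x.
Proof.
split.
  case=> -[j jn ->]; [exists (Ordinal jn, false)|exists (Ordinal jn, true)] => //.
by move=> [[j []] ->]; [right|left]; exists j.
Qed.

Lemma mark_inj n : injective (@mark n).
Proof.
move=> [j b] [j' b'] [h1 h2]; congr pair; last first.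
  by case: b b' h2 {h1} => -[] //= /eqP; rewrite ?oner_eq0 // eq_sym oner_eq0.
apply: val_inj => /=;
      move: h1; rewrite /strand.
have n0 : (2 * n)%:R != 0 :> R.
  by rewrite pnatr_eq0 -lt0n muln_gt0 /=; apply: leq_ltn_trans (ltn_ord j).
move/(congr1 ( *%R^~ (2 * n)%:R)); rewrite !mulfVK //.
by move/eqP; rewrite eqr_nat => /eqP; lia.
Qed.

(** The 2a ends of the arcs are the 2n marked points. *)
Lemma tangle_arcs n (T : set P2) a c ga de :
  tangle n n T -> @arcs_and_circles R T a c ga de -> a = n.
Proof.
move=> [_ Tbd _ _] [[ha hc] TE [pa pc] dac [bga bde]].
have bu (b : bool) : unitI ((b : nat)%:R : R) by case: b; [exact: unitI1|exact: unitI0].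
(* The ends of the arcs and the marked points inject into each other. *)
have end_mark (x : 'I_a * bool) : exists y : 'I_n * bool, mark y = ga x.1 (x.2 : nat)%:R.
  have h : marks n n (ga x.1 (x.2 : nat)%:R).
    rewrite -Tbd; split; last by apply/bga => //; case: x.2; [right|left].
    by rewrite TE; left; exists x.1 => //; exists (x.2 : nat)%:R.
  by have [y ->] := (markP _ _).1 h; exists y.
have mark_end (y : 'I_n * bool) : exists x : 'I_a * bool, ga x.1 (x.2 : nat)%:R = mark y.
  have : marks n n (mark y) by apply/markP; exists y.
  rewrite -Tbd => -[]; rewrite TE => -[[i _ [s su <-]]|[i _ [s su <-]]] bd.
    by have [->|->] := (bga i s su).1 bd; [exists (i, false)|exists (i, true)].
  by exfalso; apply: (bde i s su).
have end_inj (x x' : 'I_a * bool) : ga x.1 (x.2 : nat)%:R = ga x'.1 (x'.2 : nat)%:R -> x = x'.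
  case: x x' => [i b] [i' b'] /= h; have [ii|ne] := eqVneq i i'; last first.
    have : set0 (ga i (b : nat)%:R); last by [].
    rewrite -(pa _ _ ne); split; first by exists (b : nat)%:R.
    by rewrite h; exists (b' : nat)%:R.
  subst i'; congr pair; have [_ inj] := ha i.
  have : (b : nat)%:R = (b' : nat)%:R :> R by apply: (inj _ _ _ _ h); rewrite inE.
  by case: b b' {h} => -[] //= /eqP; rewrite ?oner_eq0 // eq_sym oner_eq0.
have [f hf] := choice end_mark; have [g hg] := choice mark_end.
have fi : injective f by move=> x x' e; apply: end_inj; rewrite -!hf e.
have gi : injective g by move=> y y' e; apply: (@mark_inj n); rewrite -!hg e.
have := leq_card f fi; have := leq_card g gi.
by rewrite !card_prod !card_ord !card_bool; lia.
Qed.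

Lemma euler_lid n (T : set P2) : tangle n n T ->
  euler n T (DSurf (cylinder T) [::]) n%:Z.
Proof.
move=> tT; have [_ _ _ [a [c [ga [de ac]]]]] := tT.
have h := tangle_attach1 tT ac; rewrite (tangle_arcs tT ac) in h.
exists 0; split; [exact: attach1_level| |by rewrite addr0].
have := attach1_cylinder h (tangle_closed tT) (@subset_refl _ T).
rewrite (_ : _ `|` cylinder T = cylinder T) //.
apply/setUidr => p [Tp p1]; split=> //; rewrite p1; exact: unitI1.
Qed.
End EulerIdentity.

(** * The preadditive category of cobordisms *)

Section Lincomb.
Context {R : realType}.
Local Notation P2 := (R * R)%type.
Local Notation P3 := ((R * R) * R)%type.
Set Implicit Arguments.
Unset Strict Implicit.
Implicit Types (T : set P2) (S : @dsurf R) (f g h : @lincomb R).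

Lemma coef_cat S f g : coef S (f ++ g) = coef S f + coef S g.
Proof. by rewrite /coef big_cat. Qed.

Lemma coef_lscale S a f : coef S (lscale a f) = a * coef S f.
Proof. by rewrite /coef big_map mulr_sumr. Qed.

Lemma coef_lbilin S o f g : coef S (lbilin o f g) =
  \sum_(c <- f) \sum_(c' <- g | o c.2 c'.2 == S) c.1 * c'.1.
Proof.
rewrite /coef /lbilin big_mkcond big_allpairs_dep /=.
by apply: eq_bigr => c _; rewrite [RHS]big_mkcond.
Qed.

Lemma cobs_cat n T T' f g : cobs n T T' f -> cobs n T T' g -> cobs n T T' (f ++ g).
Proof. by move=> hf hg c; rewrite mem_cat => /orP[/hf|/hg]. Qed.

Lemma cobs1 n T T' a S : cob n T T' S -> cobs n T T' [:: (a, S)].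
Proof. by move=> hS c; rewrite inE => /eqP ->. Qed.

Lemma cobs_lscale n T T' a f : cobs n T T' f -> cobs n T T' (lscale a f).
Proof. by move=> hf _ /mapP[c /hf hc ->]. Qed.

Lemma cobs_lcomp n T T' T'' f g : cobs n T T' f -> cobs n T' T'' g ->
  cobs n T T'' (lcomp g f).
Proof. by move=> hf hg _ /allpairsP[[c c'] /= [/hg h /hf h'] ->]; exact: cob_scomp h' h. Qed.

Lemma cobs_lid n T : tangle n n T -> cobs n T T (lid T).
Proof. by move=> tT; apply: cobs1; exact: cob_lid. Qed.

(** Equality of linear combinations is only generated between cobordisms.  This
    makes the classes below consist of cobordisms from T to T'. *)
Lemma meq_cobs n T T' f g : meq n T T' f g -> cobs n T T' f /\ cobs n T T' g.
Proof.
elim=> {T T' f g} //.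
- by move=> T T' f g _ [].
- by move=> T T' f g h _ [h1 _] _ [_ h2].
- by move=> T T' f f' g g' _ [? ?] _ [? ?]; split; exact: cobs_cat.
- by move=> T T' T'' f f' g g' _ [? ?] _ [? ?]; split; apply: cobs_lcomp; eassumption.
- by move=> T T' S S' cS cS' _; split; exact: cobs1.
- move=> T T' B ds ds' cB p; split; apply: cobs1 => //.
  by have [_ _ _ _ h] := cB; apply: cob_dots cB _ => d; rewrite -(perm_mem p) => /h.
- move=> T T' B d d' ds cB h; split; apply: cobs1 => //.
  have [_ _ _ _ hB] := cB; apply: cob_dots cB _ => x; rewrite inE => /orP[/eqP ->|xd].
    exact: connected_component_sub h.
  by apply: hB; rewrite inE xd orbT.
- by move=> T T' B d d' ds cB h; split; [exact: cobs1|].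
- by move=> T T' B ds e cB *; split; [exact: cobs1|].
- by move=> T T' B d ds e cB *; split; exact: cobs1.
- move=> T T' B ds e cB _ _ _ cN; split; first exact: cobs1.
  have hc s : `|s| = 1 -> cob n T T' (DSurf (neck_cut e B) (e ((0, 0), s) :: ds)).
    move=> s1; have [_ _ _ _ hB] := cN; apply: cob_dots cN _ => x.
    rewrite inE => /orP[/eqP ->|/hB //]; right; exists ((0, 0), s) => //.
    by rewrite /caps /nsq2 /= s1 expr0n /= addr0.
  move=> c; rewrite !inE => /orP[] /eqP -> /=; apply: hc; rewrite ?normrN normr1 //.
Qed.

Lemma meq_refl n T T' f : cobs n T T' f -> meq n T T' f f.
Proof. by move=> hf; apply: meq_lin. Qed.
End Lincomb.

Section CobHom.
Context {R : realType}.
Variable n : nat.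
Local Notation P2 := (R * R)%type.
Local Notation P3 := ((R * R) * R)%type.
Set Implicit Arguments.
Unset Strict Implicit.
Implicit Types (T : set P2) (S : @dsurf R) (f g h : @lincomb R).

(** A morphism is an equivalence class, stored as a set of representatives; the
    relation is a partial equivalence relation with the linear combinations of
    cobordisms as its domain. *)
Record cobHom (T T' : set P2) := MkHom {
  hset : set (@lincomb R);
  hsetP : exists2 f, cobs n T T' f & hset = meq n T T' f }.
HB.instance Definition _ T T' := gen_eqMixin (cobHom T T').
HB.instance Definition _ T T' := gen_choiceMixin (cobHom T T').

Lemma cobHom_eq T T' (x y : cobHom T T') : hset x = hset y -> x = y.
Proof. by case: x y => [A hA] [B hB] /= AB; subst B; congr MkHom; exact: Prop_irrelevance. Qed.

Definition restr T T' f : lincomb := if pselect (cobs n T T' f) then f else [::].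

Lemma restr_cobs T T' f : cobs n T T' (restr T T' f).
Proof. by rewrite /restr; case: pselect. Qed.

Lemma restrE T T' f : cobs n T T' f -> restr T T' f = f.
Proof. by rewrite /restr; case: pselect. Qed.

(** The class of a list that is not made of cobordisms is 0, which makes the function
    total; this is harmless since every list below that matters is made of cobordisms. *)
Definition cls T T' f : cobHom T T' :=
  MkHom (ex_intro2 _ _ (restr T T' f) (@restr_cobs T T' f) erefl).

Lemma cls_meq T T' f g : meq n T T' f g -> cls T T' f = cls T T' g.
Proof.
move=> fg; have [hf hg] := meq_cobs fg; apply: cobHom_eq => /=; rewrite !restrE //.
apply/seteqP; split=> h; [apply: meq_trans; exact: meq_sym|exact: meq_trans].
Qed.

Lemma meq_cls T T' f g : cobs n T T' f -> cobs n T T' g ->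
  cls T T' f = cls T T' g -> meq n T T' f g.
Proof.
move=> hf hg /(congr1 (@hset _ _)) /=; rewrite !restrE // => e.
by rewrite e; exact: meq_refl.
Qed.

Definition rep T T' (x : cobHom T T') : lincomb := s2val (cid2 (hsetP x)).

Lemma rep_cobs T T' (x : cobHom T T') : cobs n T T' (rep x).
Proof. exact: (s2valP (cid2 (hsetP x))). Qed.

Lemma repK T T' (x : cobHom T T') : cls T T' (rep x) = x.
Proof.
apply: cobHom_eq; rewrite /= restrE; last exact: rep_cobs.
by rewrite -(s2valP' (cid2 (hsetP x))).
Qed.

Lemma cobHom_ind T T' (P : cobHom T T' -> Prop) :
  (forall f, cobs n T T' f -> P (cls T T' f)) -> forall x, P x.
Proof. by move=> h x; rewrite -(repK x); apply: h; exact: rep_cobs. Qed.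

Definition hadd T T' (x y : cobHom T T') := cls T T' (rep x ++ rep y).
Definition hopp T T' (x : cobHom T T') := cls T T' (lscale (-1) (rep x)).
Definition hcomp T T' T'' (y : cobHom T' T'') (x : cobHom T T') := cls T T'' (lcomp (rep y) (rep x)).

Lemma rep_cls T T' f : cobs n T T' f -> meq n T T' (rep (cls T T' f)) f.
Proof. by move=> hf; apply: meq_cls => //; [exact: rep_cobs|exact: repK]. Qed.

Lemma hadd_cls T T' f g : cobs n T T' f -> cobs n T T' g ->
  hadd (cls T T' f) (cls T T' g) = cls T T' (f ++ g).
Proof. by move=> hf hg; apply: cls_meq; apply: meq_add; exact: rep_cls. Qed.

Lemma cls_coef T T' f g : cobs n T T' f -> cobs n T T' g ->
  (forall S, coef S f = coef S g) -> cls T T' f = cls T T' g.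
Proof. by move=> hf hg e; apply: cls_meq; exact: meq_lin. Qed.

Lemma haddA T T' : associative (@hadd T T').
Proof.
elim/cobHom_ind => f hf; elim/cobHom_ind => g hg; elim/cobHom_ind => h hh.
by rewrite !hadd_cls ?catA //; exact: cobs_cat.
Qed.

Lemma haddC T T' : commutative (@hadd T T').
Proof.
elim/cobHom_ind => f hf; elim/cobHom_ind => g hg; rewrite !hadd_cls //.
by apply: cls_coef => [| |S]; [exact: cobs_cat|exact: cobs_cat|rewrite !coef_cat addrC].
Qed.

Lemma hadd0 T T' : left_id (cls T T' [::]) (@hadd T T').
Proof. by elim/cobHom_ind => f hf; rewrite hadd_cls. Qed.

Lemma haddN T T' : left_inverse (cls T T' [::]) (@hopp T T') (@hadd T T').
Proof.
move=> x; rewrite -{2}(repK x) hadd_cls; [|exact/cobs_lscale/rep_cobs|exact: rep_cobs].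
apply: cls_coef => [|//|S]; first by apply: cobs_cat; [exact/cobs_lscale/rep_cobs|exact: rep_cobs].
by rewrite coef_cat coef_lscale mulN1r addNr /coef big_nil.
Qed.

HB.instance Definition _ T T' := GRing.isZmodule.Build (cobHom T T')
  (@haddA T T') (@haddC T T') (@hadd0 T T') (@haddN T T').

Lemma cls_nil T T' : cls T T' [::] = 0.
Proof. by []. Qed.

Lemma cls_cat T T' f g : cobs n T T' f -> cobs n T T' g ->
  cls T T' (f ++ g) = cls T T' f + cls T T' g.
Proof. by move=> hf hg; rewrite -hadd_cls. Qed.

Lemma cls_opp T T' f : cobs n T T' f -> cls T T' (lscale (-1) f) = - cls T T' f.
Proof.
move=> hf; apply/eqP; rewrite -addr_eq0 -cls_cat //; last exact: cobs_lscale.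
apply/eqP/cls_coef => [|//|S]; first by apply: cobs_cat => //; exact: cobs_lscale.
by rewrite coef_cat coef_lscale mulN1r addNr /coef big_nil.
Qed.

Lemma cls_scale1 T T' f : cobs n T T' f -> cls T T' (lscale 1 f) = cls T T' f.
Proof. by move=> hf; apply: cls_coef => [||S] //; [exact: cobs_lscale|rewrite coef_lscale mul1r]. Qed.

Lemma hcomp_cls T T' T'' f g : cobs n T T' f -> cobs n T' T'' g ->
  hcomp (cls T' T'' g) (cls T T' f) = cls T T'' (lcomp g f).
Proof. by move=> hf hg; apply: cls_meq; apply: meq_comp; exact: rep_cls. Qed.

Ltac cobs_tac := repeat (first [eassumption | simple eapply cobs_lcomp
  | simple apply cobs_cat | simple apply cobs_lscale]).

Lemma hcompDl T T' T'' (y y' : cobHom T' T'') (x : cobHom T T') :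
  hcomp (y + y') x = hcomp y x + hcomp y' x.
Proof.
elim/cobHom_ind: x => f hf; elim/cobHom_ind: y => g hg; elim/cobHom_ind: y' => h hh.
rewrite -cls_cat // !hcomp_cls -?cls_cat; try by cobs_tac.
by rewrite /lcomp /lbilin allpairs_cat.
Qed.

Lemma hcompDr T T' T'' (y : cobHom T' T'') (x x' : cobHom T T') :
  hcomp y (x + x') = hcomp y x + hcomp y x'.
Proof.
elim/cobHom_ind: y => f hf; elim/cobHom_ind: x => g hg; elim/cobHom_ind: x' => h hh.
have hgh := cobs_cat hg hh.
rewrite -cls_cat // !hcomp_cls // -cls_cat; try by cobs_tac.
apply: cls_coef => [||S]; [by cobs_tac|by cobs_tac|].
rewrite coef_cat /lcomp !coef_lbilin -big_split /=; apply: eq_bigr => c _.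
by rewrite big_cat.
Qed.

Lemma hcomp0l T T' T'' (x : cobHom T T') : hcomp (0 : cobHom T' T'') x = 0.
Proof. by apply: (addrI (hcomp (0 : cobHom T' T'') x)); rewrite -hcompDl !addr0. Qed.

Lemma hcomp0r T T' T'' (y : cobHom T' T'') : hcomp y (0 : cobHom T T') = 0.
Proof. by apply: (addrI (hcomp y (0 : cobHom T T'))); rewrite -hcompDr !addr0. Qed.

Lemma hcomp_suml T T' T'' I (s : seq I) (P : pred I) (F : I -> cobHom T' T'') (x : cobHom T T') :
  hcomp (\sum_(i <- s | P i) F i) x = \sum_(i <- s | P i) hcomp (F i) x.
Proof. by apply: (big_morph (fun y => hcomp y x)); [move=> a b; exact: hcompDl|exact: hcomp0l]. Qed.

Lemma hcomp_sumr T T' T'' I (s : seq I) (P : pred I) (F : I -> cobHom T T') (y : cobHom T' T'') :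
  hcomp y (\sum_(i <- s | P i) F i) = \sum_(i <- s | P i) hcomp y (F i).
Proof. by apply: (big_morph (fun x => hcomp y x)); [move=> a b; exact: hcompDr|exact: hcomp0r]. Qed.

Lemma hcompNl T T' T'' (y : cobHom T' T'') (x : cobHom T T') : hcomp (- y) x = - hcomp y x.
Proof. by apply/eqP; rewrite -addr_eq0 -hcompDl addNr hcomp0l. Qed.

Lemma hcompNr T T' T'' (y : cobHom T' T'') (x : cobHom T T') : hcomp y (- x) = - hcomp y x.
Proof. by apply/eqP; rewrite -addr_eq0 -hcompDr addNr hcomp0r. Qed.

(** Linearity reduces identities between classes to single surfaces. *)
Lemma cobHom_gen T T' (P : cobHom T T' -> Prop) : P 0 -> (forall x y, P x -> P y -> P (x + y)) ->
  (forall x, P x -> P (- x)) -> (forall S, cob n T T' S -> P (cls T T' [:: (1, S)])) ->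
  forall x, P x.
Proof.
move=> P0 PD PN P1; elim/cobHom_ind => f; elim: f => [|[a S] f IH] hf //.
have hS : cob n T T' S by apply: (hf (a, S)); rewrite mem_head.
have {}hf : cobs n T T' f by move=> c cf; apply: hf; rewrite inE cf orbT.
rewrite -cat1s cls_cat //; last exact: cobs1.
apply: (PD); last exact: IH.
have Pn m : P (cls T T' [:: (m%:Z, S)]).
  elim: m => [|m IHm].
    rewrite (_ : cls _ _ _ = 0) // -cls_nil; apply: cls_coef => [|//|S']; first exact: cobs1.
    by rewrite /coef big_cons big_nil /=; case: ifP.
  rewrite (_ : cls _ _ _ = cls T T' [:: (1, S)] + cls T T' [:: (m%:Z, S)]);
      first by apply: (PD) => //; exact: (P1).
  rewrite -cls_cat; try exact: cobs1.
  apply: cls_coef => [||S']; [exact: cobs1|by apply: cobs_cat; exact: cobs1|].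
  by rewrite /coef /= !big_cons big_nil /=; case: ifP => _; rewrite ?addr0 // -intS.
case: a => m; first exact: Pn.
rewrite NegzE (_ : cls _ _ _ = - cls T T' [:: (m.+1%:Z, S)]); first exact: (PN).
by rewrite -cls_opp; [rewrite /lscale /= mulN1r|exact: cobs1].
Qed.

Lemma hcompA T0 T1 T2 T3 (z : cobHom T2 T3) (y : cobHom T1 T2) (x : cobHom T0 T1) :
  hcomp z (hcomp y x) = hcomp (hcomp z y) x.
Proof.
elim/cobHom_gen: z => [|z z' IH IH'|z IH|S3 h3]; rewrite ?hcomp0l ?hcompDl ?hcompNl ?IH ?IH' //.
elim/cobHom_gen: y => [|y y' IH IH'|y IH|S2 h2];
  rewrite ?(hcomp0l, hcomp0r, hcompDr, hcompDl, hcompNl, hcompNr) ?IH ?IH' //.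
elim/cobHom_gen: x => [|x x' IH IH'|x IH|S1 h1];
  rewrite ?(hcomp0r, hcompDr, hcompNr) ?IH ?IH' //.
have k1 : cobs n T0 T1 [:: (1, S1)] := cobs1 h1.
have k2 : cobs n T1 T2 [:: (1, S2)] := cobs1 h2.
have k3 : cobs n T2 T3 [:: (1, S3)] := cobs1 h3.
rewrite !hcomp_cls; try by cobs_tac.
by apply: cls_meq; rewrite /lcomp /lbilin /= !mulr1; exact: (meq_assoc h1 h2 h3).
Qed.

Definition hid T : cobHom T T := cls T T (lid T).

Lemma hcomp1l T T' (x : cobHom T T') : hcomp (hid T') x = x.
Proof.
elim/cobHom_gen: x => [|x x' IH IH'|x IH|S h]; rewrite ?hcomp0r ?hcompDr ?hcompNr ?IH ?IH' //.
have [[_ tT _ _] _ _ _ _] := h.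
rewrite hcomp_cls; [|exact: cobs1|exact: cobs_lid].
by apply: cls_meq; apply: meq_sym; rewrite /lcomp /lbilin /= mulr1; exact: meq_unitl.
Qed.

Lemma hcomp1r T T' (x : cobHom T T') : hcomp x (hid T) = x.
Proof.
elim/cobHom_gen: x => [|x x' IH IH'|x IH|S h]; rewrite ?hcomp0l ?hcompDl ?hcompNl ?IH ?IH' //.
have [[tT _ _ _] _ _ _ _] := h.
rewrite hcomp_cls; [|exact: cobs_lid|exact: cobs1].
by apply: cls_meq; apply: meq_sym; rewrite /lcomp /lbilin /= mulr1; exact: meq_unitr.
Qed.

(** Membership of the subgroup of morphisms q^i T -> q^j T'. *)
Definition hdeg (i j : int) T T' (x : cobHom T T') : Prop :=
  exists2 f, cob_hom n i T j T' f & x = cls T T' f.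

Lemma cob_hom_cobs i j T T' f : cob_hom n i T j T' f -> cobs n T T' f.
Proof. by move=> h c /h[]. Qed.

Lemma cob_hom_cat i j T T' f g : cob_hom n i T j T' f -> cob_hom n i T j T' g ->
  cob_hom n i T j T' (f ++ g).
Proof. by move=> hf hg c; rewrite mem_cat => /orP[/hf|/hg]. Qed.

Lemma cob_hom_scale i j T T' a f : cob_hom n i T j T' f -> cob_hom n i T j T' (lscale a f).
Proof. by move=> hf _ /mapP[c /hf hc ->]. Qed.

Lemma cob_hom_comp i j k T T' T'' f g : cob_hom n i T j T' f -> cob_hom n j T' k T'' g ->
  cob_hom n i T k T'' (lcomp g f).
Proof.
move=> hf hg _ /allpairsP[[c c'] /= [/hg[h [e he h1]] /hf[h' [e' he' h1']]] ->] /=.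
split; first exact: cob_scomp h' h.
exists (e' + e - n%:Z); first exact: euler_scomp h' h he' he.
rewrite size_cat !size_map PoszD mulrDr -[RHS]addr0 -{1}h1 -h1'; ring.
Qed.

Lemma cob_hom_lid i T : tangle n n T -> cob_hom n i T i T (lid T).
Proof.
move=> tT c; rewrite inE => /eqP -> /=; split; first exact: cob_lid.
by exists n%:Z; [exact: euler_lid|rewrite /=; lia].
Qed.

Lemma hdeg0 i j T T' : hdeg i j (0 : cobHom T T').
Proof. by exists [::]; rewrite ?cls_nil. Qed.

Lemma hdegD i j T T' (x y : cobHom T T') : hdeg i j x -> hdeg i j y -> hdeg i j (x + y).
Proof.
move=> [f hf ->] [g hg ->]; exists (f ++ g); first exact: cob_hom_cat.
by rewrite cls_cat //; apply: cob_hom_cobs; eassumption.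
Qed.

Lemma hdegN i j T T' (x : cobHom T T') : hdeg i j x -> hdeg i j (- x).
Proof.
move=> [f hf ->]; exists (lscale (-1) f); first exact: cob_hom_scale.
by rewrite cls_opp //; exact: (cob_hom_cobs hf).
Qed.

Lemma hdeg_comp i j k T T' T'' (y : cobHom T' T'') (x : cobHom T T') :
  hdeg i j x -> hdeg j k y -> hdeg i k (hcomp y x).
Proof.
move=> [f hf ->] [g hg ->]; exists (lcomp g f); first exact: cob_hom_comp hf hg.
by rewrite hcomp_cls //; [exact: cob_hom_cobs hf|exact: cob_hom_cobs hg].
Qed.

Lemma hdeg_id i T : tangle n n T -> hdeg i i (hid T).
Proof. by move=> tT; exists (lid T) => //; exact: cob_hom_lid. Qed.

Lemma hdeg_sum i j T T' I (s : seq I) (P : pred I) (F : I -> cobHom T T') :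
  (forall k, P k -> hdeg i j (F k)) -> hdeg i j (\sum_(k <- s | P k) F k).
Proof. by move=> h; elim/big_ind: _ => //; [exact: hdeg0|move=> *; exact: hdegD]. Qed.

Lemma cob_homE i j i' j' T T' f : j - i = j' - i' -> cob_hom n i T j T' f -> cob_hom n i' T j' T' f.
Proof.
move=> e hf c /hf[h [x hx hd]]; split=> //; exists x => //; lia.
Qed.

Lemma hdegE i j i' j' T T' (x : cobHom T T') : j - i = j' - i' -> hdeg i j x -> hdeg i' j' x.
Proof. by move=> e [f hf ->]; exists f => //; exact: cob_homE e hf. Qed.
End CobHom.

(** * Matrices of cobordism classes *)

Section Mor.
Context {R : realType}.
Variable n : nat.
Set Implicit Arguments.
Unset Strict Implicit.
Implicit Types (A B C : cpx R).
Local Notation Hom := (@cobHom R n).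
Local Notation cls := (@cls R n _ _).
Local Notation hom := (@Defs.hom R).
Local Notation geq := (@Defs.geq R).

(** Column-finiteness is what makes products defined without reference to degrees,
    so that they are associative and bilinear without side conditions. *)
Record mor A B := Mor {
  ent :> forall (x : gens A) (y : gens B), Hom (dg x) (dg y);
  entP : forall x, exists s : seq (gens B), forall y, ent x y != 0 -> y \in s }.
HB.instance Definition _ A B := gen_eqMixin (mor A B).
HB.instance Definition _ A B := gen_choiceMixin (mor A B).

Lemma mor_eq A B (f g : mor A B) : (forall x y, f x y = g x y) -> f = g.
Proof.
case: f g => [f hf] [g hg] /= fg.
have e : f = g by apply: functional_extensionality_dep => x; apply: functional_extensionality_dep => y.
by subst g; congr Mor; exact: Prop_irrelevance.
Qed.

Lemma mzeroP A B (x : gens A) : exists s : seq (gens B), forall y, (0 : Hom (dg x) (dg y)) != 0 -> y \in s.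
Proof. by exists [::] => y; rewrite eqxx. Qed.

Lemma maddP A B (f g : mor A B) x : exists s : seq (gens B), forall y, f x y + g x y != 0 -> y \in s.
Proof.
have [s hs] := entP f x; have [t ht] := entP g x; exists (s ++ t) => y h.
rewrite mem_cat; have [f0|f0] := eqVneq (f x y) 0; last by rewrite hs.
by rewrite ht ?orbT //; move: h; rewrite f0 add0r.
Qed.

Lemma moppP A B (f : mor A B) x : exists s : seq (gens B), forall y, - f x y != 0 -> y \in s.
Proof. by have [s hs] := entP f x; exists s => y; rewrite oppr_eq0 => /hs. Qed.

Definition mzero A B : mor A B := Mor (@mzeroP A B).
Definition madd A B (f g : mor A B) : mor A B := Mor (maddP f g).
Definition mopp A B (f : mor A B) : mor A B := Mor (moppP f).

Lemma maddA A B : associative (@madd A B).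
Proof. by move=> f g h; apply: mor_eq => x y /=; rewrite addrA. Qed.
Lemma maddC A B : commutative (@madd A B).
Proof. by move=> f g; apply: mor_eq => x y /=; rewrite addrC. Qed.
Lemma madd0 A B : left_id (@mzero A B) (@madd A B).
Proof. by move=> f; apply: mor_eq => x y /=; rewrite add0r. Qed.
Lemma maddN A B : left_inverse (@mzero A B) (@mopp A B) (@madd A B).
Proof. by move=> f; apply: mor_eq => x y /=; rewrite addNr. Qed.

HB.instance Definition _ A B := GRing.isZmodule.Build (mor A B)
  (@maddA A B) (@maddC A B) (@madd0 A B) (@maddN A B).

Lemma entD A B (f g : mor A B) x y : (f + g) x y = f x y + g x y.
Proof. by []. Qed.
Lemma entN A B (f : mor A B) x y : (- f) x y = - f x y.
Proof. by []. Qed.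
Definition msupp A B (f : mor A B) x : seq (gens B) := undup (sval (cid (entP f x))).

Lemma msuppP A B (f : mor A B) x y : f x y != 0 -> y \in msupp f x.
Proof. by rewrite mem_undup; case: cid => s /= hs; exact: hs. Qed.

Lemma msupp_uniq A B (f : mor A B) x : uniq (msupp f x).
Proof. exact: undup_uniq. Qed.

Lemma sum_support (I : eqType) (V : zmodType) (s t : seq I) (F : I -> V) :
  uniq s -> uniq t -> (forall i, F i != 0 -> i \in s) -> (forall i, F i != 0 -> i \in t) ->
  \sum_(i <- s) F i = \sum_(i <- t) F i.
Proof.
move=> us ut hs ht; rewrite (bigID (fun i => F i != 0)) /= [X in _ + X]big1 ?addr0; last first.
  by move=> i; rewrite negbK => /eqP.
rewrite [RHS](bigID (fun i => F i != 0)) /= [X in _ = _ + X]big1 ?addr0; last first.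
  by move=> i; rewrite negbK => /eqP.
rewrite -!(big_filter _ (fun i => F i != 0)); apply: perm_big.
apply: uniq_perm; rewrite ?filter_uniq // => i; rewrite !mem_filter.
by case h: (F i != 0) => //=; rewrite hs ?ht.
Qed.

Definition mcomp_ent A B C (g : mor B C) (f : mor A B) x z : Hom (dg x) (dg z) :=
  \sum_(y <- msupp f x) hcomp (g y z) (f x y).

Lemma mcompP A B C (g : mor B C) (f : mor A B) x :
  exists s : seq (gens C), forall z, mcomp_ent g f x z != 0 -> z \in s.
Proof.
exists (flatten [seq msupp g y | y <- msupp f x]) => z h.
apply/flattenP; apply: contrapT => nz; case/eqP: h.
rewrite /mcomp_ent big_seq big1 // => y ys.
have [->|g0] := eqVneq (g y z) 0; first by rewrite hcomp0l.
by exfalso; apply: nz; exists (msupp g y); [apply: map_f|exact: msuppP].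
Qed.

Definition mcomp A B C (g : mor B C) (f : mor A B) : mor A C := Mor (mcompP g f).
Local Notation "g ** f" := (mcomp g f) (at level 40, left associativity).

(** Lets several products be computed over a common index set. *)
Lemma mcompE A B C (g : mor B C) (f : mor A B) x z (s : seq (gens B)) :
  uniq s -> (forall y, f x y != 0 -> y \in s) ->
  (g ** f) x z = \sum_(y <- s) hcomp (g y z) (f x y).
Proof.
move=> us hs /=; have h y : hcomp (g y z) (f x y) != 0 -> f x y != 0.
  by apply: contraNneq => ->; rewrite hcomp0r.
apply: sum_support => // [|y /h|y /h]; [exact: msupp_uniq|exact: msuppP|exact: hs].
Qed.

Lemma mcompDl A B C (g g' : mor B C) (f : mor A B) : (g + g') ** f = g ** f + g' ** f.
Proof.
apply: mor_eq => x z /=; rewrite /mcomp_ent -big_split /=.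
by apply: eq_bigr => y _; rewrite hcompDl.
Qed.

Lemma mcompDr A B C (g : mor B C) (f f' : mor A B) : g ** (f + f') = g ** f + g ** f'.
Proof.
apply: mor_eq => x z; rewrite entD.
pose s := undup (msupp f x ++ msupp f' x).
have us : uniq s by exact: undup_uniq.
have hf y : f x y != 0 -> y \in s by move=> /msuppP h; rewrite mem_undup mem_cat h.
have hf' y : f' x y != 0 -> y \in s by move=> /msuppP h; rewrite mem_undup mem_cat h orbT.
rewrite (mcompE g z us hf) (mcompE g z us hf') (mcompE g z us) /=.
  by rewrite -big_split; apply: eq_bigr => y _; rewrite hcompDr.
move=> y; have [f0|/hf //] := eqVneq (f x y) 0.
by rewrite f0 add0r => /hf'.
Qed.

Lemma mcomp0l A B C (f : mor A B) : (0 : mor B C) ** f = 0.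
Proof. by apply: (addrI ((0 : mor B C) ** f)); rewrite -mcompDl !addr0. Qed.
Lemma mcomp0r A B C (g : mor B C) : g ** (0 : mor A B) = 0.
Proof. by apply: (addrI (g ** (0 : mor A B))); rewrite -mcompDr !addr0. Qed.
Lemma mcompNl A B C (g : mor B C) (f : mor A B) : (- g) ** f = - (g ** f).
Proof. by apply/eqP; rewrite -addr_eq0 -mcompDl addNr mcomp0l. Qed.
Lemma mcompNr A B C (g : mor B C) (f : mor A B) : g ** (- f) = - (g ** f).
Proof. by apply/eqP; rewrite -addr_eq0 -mcompDr addNr mcomp0r. Qed.

Lemma mcompA A B C D (h : mor C D) (g : mor B C) (f : mor A B) :
  h ** (g ** f) = (h ** g) ** f.
Proof.
apply: mor_eq => x w.
pose s := msupp f x; pose t := undup (flatten [seq msupp g y | y <- s]).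
have ut : uniq t by exact: undup_uniq.
have hg y z : y \in s -> g y z != 0 -> z \in t.
  move=> ys /msuppP h1; rewrite mem_undup; apply/flattenP.
  by exists (msupp g y) => //; exact: map_f.
rewrite (mcompE h w ut); last first.
  move=> z; apply: contraNT => zt; rewrite /= /mcomp_ent big_seq big1 // => y ys.
  have [->|/(hg _ _ ys)] := eqVneq (g y z) 0; first by rewrite hcomp0l.
  by rewrite (negPf zt).
rewrite (mcompE (h ** g) w (msupp_uniq f x) (@msuppP _ _ f x)) -/s.
transitivity (\sum_(z <- t) \sum_(y <- s) hcomp (h z w) (hcomp (g y z) (f x y))).
  by apply: eq_bigr => z _; rewrite /= /mcomp_ent hcomp_sumr.
rewrite exchange_big; apply: eq_big_seq => y ys.
rewrite (mcompE h w ut (fun z => hg y z ys)) hcomp_suml.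
by apply: eq_bigr => z _; rewrite hcompA.
Qed.

Definition mpart_ent A B (sg : gens A -> option (gens B)) (x : gens A) (y : gens B) :
  Hom (dg x) (dg y) := if sg x == Some y then cls (lid (dg x)) else 0.

Lemma mpartP A B (sg : gens A -> option (gens B)) x :
  exists s : seq (gens B), forall y, mpart_ent sg x y != 0 -> y \in s.
Proof.
exists (if sg x is Some y then [:: y] else [::]) => y; rewrite /mpart_ent.
by case: (sg x =P Some y) => [->|]; rewrite ?eqxx // mem_seq1 eqxx.
Qed.

(** The inclusions, projections and shifts of indices from which cones and the
    periodic complex are built are all partial functions on generators that
    preserve the diagram. *)
Definition mpart A B sg : mor A B := Mor (@mpartP A B sg).

Lemma mcomp_partr A B C (g : mor B C) sg x y z : sg x = Some y ->
  (g ** (mpart sg : mor A B)) x z = hcomp (g y z) (cls (lid (dg x)) : Hom (dg x) (dg y)).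
Proof.
move=> e; rewrite (@mcompE _ _ _ g _ x z [:: y]) //; last first.
  by move=> y' /=; rewrite /mpart_ent e; case: (Some y =P Some y') => [[->]|]; rewrite ?eqxx // mem_seq1 eqxx.
by rewrite big_seq1 /= /mpart_ent e eqxx.
Qed.

Lemma mcomp_partr0 A B C (g : mor B C) sg x z : sg x = None ->
  (g ** (mpart sg : mor A B)) x z = 0.
Proof.
move=> e; rewrite (@mcompE _ _ _ g _ x z [::]) ?big_nil //.
by move=> y' /=; rewrite /mpart_ent e eqxx.
Qed.

Lemma mcomp_partl A B C (f : mor A B) (sg : gens B -> option (gens C)) x y z :
  sg y = Some z -> (forall y', sg y' = Some z -> y' = y) ->
  ((mpart sg : mor B C) ** f) x z = hcomp (cls (lid (dg y)) : Hom (dg y) (dg z)) (f x y).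
Proof.
move=> e inj; rewrite /= /mcomp_ent.
have h y' : y' != y -> hcomp (mpart_ent sg y' z) (f x y') = 0.
  rewrite /mpart_ent => ne; case: eqP => [/inj e'|]; last by rewrite hcomp0l.
  by rewrite e' eqxx in ne.
have [ys|ys] := boolP (y \in msupp f x).
  rewrite (bigD1_seq y) //=; last exact: msupp_uniq.
  by rewrite [X in _ + X]big1 ?addr0 // /mpart_ent e eqxx.
rewrite big_seq big1 => [|y' y's]; last by apply: h; apply: contraNneq ys => <-.
have -> : f x y = 0 by apply/eqP; apply: contraNT ys; exact: msuppP.
by rewrite hcomp0r.
Qed.

Lemma mcomp_partl0 A B C (f : mor A B) (sg : gens B -> option (gens C)) x z :
  (forall y, sg y <> Some z) -> ((mpart sg : mor B C) ** f) x z = 0.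
Proof.
move=> h; rewrite /= /mcomp_ent big1 // => y _.
by rewrite /= /mpart_ent ifN ?hcomp0l //; apply/eqP; exact: h.
Qed.

Definition mid A : mor A A := mpart (@Some (gens A)).

Lemma mcomp1l A B (f : mor A B) : mid B ** f = f.
Proof.
apply: mor_eq => x y; rewrite (@mcomp_partl _ _ _ _ _ _ y) // => [|y' [//]].
exact: hcomp1l.
Qed.

Lemma mcomp1r A B (f : mor A B) : f ** mid A = f.
Proof. by apply: mor_eq => x y; rewrite (@mcomp_partr _ _ _ _ _ _ x) // hcomp1r. Qed.

(** The outer terms of a convolution have the same diagrams as K juxtaposed with a
    strand, but only up to a proof; this unit law allows for such equalities. *)
Lemma hcomp_lid_eqr T T' T'' (f : @lincomb R) : T' = T ->
  hcomp (cls f : Hom T' T'') (cls (lid T) : Hom T T') = (cls f : Hom T T'').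
Proof. by move=> e; subst T'; exact: hcomp1r. Qed.

Lemma hcomp_lid_eql T T' T'' (f : @lincomb R) : T'' = T' ->
  hcomp (cls (lid T') : Hom T' T'') (cls f : Hom T T') = (cls f : Hom T T'').
Proof. by move=> e; subst T''; exact: hcomp1l. Qed.

Definition ocomp (X Y Z : Type) (t : Y -> option Z) (s : X -> option Y) x :=
  if s x is Some y then t y else None.

Lemma mpart_comp A B C (t : gens B -> option (gens C)) (s : gens A -> option (gens B)) :
  (forall x y, s x = Some y -> dg y = dg x) ->
  mpart t ** mpart s = mpart (ocomp t s).
Proof.
move=> hs; apply: mor_eq => x z; case e: (s x) => [y|].
  rewrite (mcomp_partr _ _ e) /= /mpart_ent /ocomp e.
  case: ifP => _; last by rewrite hcomp0l.
  by rewrite (hs _ _ e); exact: hcomp1r.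
by rewrite (mcomp_partr0 _ _ e) /= /mpart_ent /ocomp e.
Qed.

Lemma mpart_eq A B (s t : gens A -> option (gens B)) : s =1 t -> mpart s = mpart t.
Proof. by move=> st; apply: mor_eq => x y /=; rewrite /mpart_ent st. Qed.

Lemma mpart_none A B : mpart (fun _ : gens A => @None (gens B)) = 0.
Proof. by apply: mor_eq. Qed.

(** Bihomogeneity of bidegree (i, j): entries vanish outside homological degree i.
    Raw graded maps have irrelevant entries there, matrices do not. *)
Definition mhom i j A B (f : mor A B) : Prop := forall x y,
  (hd y = hd x + i -> hdeg (qd x + j) (qd y) (f x y)) /\ (hd y <> hd x + i -> f x y = 0).

Lemma mhom0 i j A B : mhom i j (0 : mor A B).
Proof. by move=> x y; split=> // _; exact: hdeg0. Qed.

Lemma mhomD i j A B (f g : mor A B) : mhom i j f -> mhom i j g -> mhom i j (f + g).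
Proof.
move=> hf hg x y; have [f1 f2] := hf x y; have [g1 g2] := hg x y; split=> h.
  by apply: hdegD; [exact: f1|exact: g1].
by rewrite entD f2 // g2 // addr0.
Qed.

Lemma mhomN i j A B (f : mor A B) : mhom i j f -> mhom i j (- f).
Proof.
move=> hf x y; have [f1 f2] := hf x y; split=> h; first by apply: hdegN; exact: f1.
by rewrite entN f2 // oppr0.
Qed.

Lemma mhom_comp i j i' j' A B C (g : mor B C) (f : mor A B) :
  mhom i j f -> mhom i' j' g -> mhom (i + i') (j + j') (g ** f).
Proof.
move=> hf hg x z; split=> h.
  apply: hdeg_sum => y _; have [f1 f2] := hf x y; have [g1 g2] := hg y z.
  have [e|ne] := eqVneq (hd y) (hd x + i); last first.
    by rewrite f2 ?hcomp0r; [exact: hdeg0|exact/eqP].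
  apply: (@hdeg_comp _ _ _ (qd y + j')); last by apply: g1; rewrite h e addrA.
  by apply: hdegE (f1 e); ring.
rewrite /= /mcomp_ent big1 // => y _; have [f1 f2] := hf x y; have [g1 g2] := hg y z.
have [e|/eqP ne] := eqVneq (hd y) (hd x + i); last by rewrite f2 // hcomp0r.
by rewrite g2 ?hcomp0l // => e'; apply: h; rewrite e' e addrA.
Qed.

Lemma mhomE i j i' j' A B (f : mor A B) : i = i' -> j = j' -> mhom i j f -> mhom i' j' f.
Proof. by move=> -> ->. Qed.

Lemma mhom_part i j A B (s : gens A -> option (gens B)) :
  (forall x : gens A, tangle n n (dg x)) ->
  (forall x y, s x = Some y -> [/\ hd y = hd x + i, qd y = qd x + j & dg y = dg x]) ->
  mhom i j (mpart s).
Proof.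
move=> tA hs x y; rewrite /= /mpart_ent; case: eqP => [e|_]; last by split=> // _; exact: hdeg0.
have [h1 h2 h3] := hs _ _ e; split=> [_|//].
by rewrite h3 h2; exact: hdeg_id.
Qed.

Definition fin_fibers A : Prop := forall k : int, finite_set [set x : gens A | hd x = k]%classic.

Lemma in_fiber A (hA : fin_fibers A) k (x : gens A) : (x \in fiber A k) = (hd x == k).
Proof. by rewrite /fiber in_fset_set //; apply/idP/eqP => [/set_mem|h]; last exact/mem_set. Qed.

Lemma fiber_uniq A k : uniq (fiber A k : seq (gens A)).
Proof. exact: fset_uniq. Qed.

Definition mor_of_ent (i : int) A B (f : gmap A B) x y : Hom (dg x) (dg y) :=
  if y \in fiber B (hd x + i) then cls (f x y) else 0.

Lemma mor_ofP i A B (f : gmap A B) x :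
  exists s : seq (gens B), forall y, mor_of_ent i f x y != 0 -> y \in s.
Proof. by exists (fiber B (hd x + i)) => y; rewrite /mor_of_ent; case: ifP; rewrite ?eqxx. Qed.

(** Discards the entries outside homological degree i. *)
Definition mor_of i A B (f : gmap A B) : mor A B := Mor (mor_ofP i f).

Lemma mor_ofE i A B (hB : fin_fibers B) (f : gmap A B) x y :
  mor_of i f x y = if hd y == hd x + i then cls (f x y) else 0.
Proof. by rewrite /= /mor_of_ent in_fiber. Qed.

Definition gcobs i A B (f : gmap A B) : Prop := forall x y, hd y = hd x + i ->
  cobs n (dg x) (dg y) (f x y).

Lemma hom_gcobs i j A B (f : gmap A B) : hom n i j f -> gcobs i f.
Proof. by move=> hf x y /hf/cob_hom_cobs. Qed.

Lemma cobs_flatten T T' (ss : seq (@lincomb R)) : {in ss, forall f, cobs n T T' f} ->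
  cobs n T T' (flatten ss).
Proof. by move=> h c /flattenP[f /h hf /hf]. Qed.

Lemma cls_flatten T T' (I : eqType) (s : seq I) (F : I -> @lincomb R) :
  {in s, forall i, cobs n T T' (F i)} ->
  (cls (flatten [seq F i | i <- s]) : Hom T T') = \sum_(i <- s) (cls (F i) : Hom T T').
Proof.
elim: s => [|i s IH] h; first by rewrite big_nil.
have h' : {in s, forall i, cobs n T T' (F i)} by move=> k ks; apply: h; rewrite inE ks orbT.
rewrite big_cons /= cls_cat ?IH //; first by apply: h; rewrite mem_head.
by apply: cobs_flatten => _ /mapP[k ks ->]; exact: h'.
Qed.

Lemma gcobs_comp i j A B C (g : gmap B C) (f : gmap A B) : fin_fibers B ->
  gcobs i f -> gcobs j g -> gcobs (i + j) (gcomp i g f).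
Proof.
move=> hB hf hg x z h; apply: cobs_flatten => _ /mapP[y ys ->].
move: ys; rewrite in_fiber // => /eqP e.
by apply: cobs_lcomp (hf _ _ e) (hg _ _ _); rewrite h e addrA.
Qed.

Lemma hom_gcomp i j i' j' A B C (g : gmap B C) (f : gmap A B) : fin_fibers B ->
  hom n i j f -> hom n i' j' g -> hom n (i + i') (j + j') (gcomp i g f).
Proof.
move=> hB hf hg x z h c /flattenP[l /mapP[y ys ->]] cl.
move: ys; rewrite in_fiber // => /eqP e.
have hz : hd z = hd y + i' by rewrite h e addrA.
apply: (cob_hom_comp _ (hg y z hz) cl).
by apply: cob_homE (hf x y e); ring.
Qed.

Lemma mor_of_comp i j A B C (g : gmap B C) (f : gmap A B) : fin_fibers B -> fin_fibers C ->
  gcobs i f -> gcobs j g -> mor_of (i + j) (gcomp i g f) = mor_of j g ** mor_of i f.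
Proof.
move=> hB hC hf hg; apply: mor_eq => x z.
rewrite (@mcompE _ _ _ _ _ x z (fiber B (hd x + i))); [|exact: fiber_uniq|]; last first.
  by move=> y; rewrite mor_ofE // in_fiber //; case: ifP; rewrite ?eqxx.
rewrite mor_ofE //; case: eqP => h; last first.
  rewrite big_seq big1 // => y; rewrite in_fiber // => /eqP e.
  rewrite [mor_of j g y z]mor_ofE // ifN ?hcomp0l //; apply/eqP => h'; apply: h.
  by rewrite h' e addrA.
rewrite /gcomp cls_flatten => [|y]; last first.
  rewrite in_fiber // => /eqP e; apply: cobs_lcomp (hf _ _ e) (hg _ _ _).
  by rewrite h e addrA.
apply: eq_big_seq => y; rewrite in_fiber // => /eqP e.
rewrite !mor_ofE // e eqxx h addrA eqxx hcomp_cls //; first exact: hf.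
by apply: hg; rewrite h e addrA.
Qed.

Lemma mor_of_add i A B (f g : gmap A B) : fin_fibers B -> gcobs i f -> gcobs i g ->
  mor_of i (gadd f g) = mor_of i f + mor_of i g.
Proof.
move=> hB hf hg; apply: mor_eq => x y; rewrite entD !mor_ofE //.
by case: eqP => [e|]; [rewrite -cls_cat //; [exact: hf|exact: hg]|rewrite addr0].
Qed.

Lemma gcobs_add i A B (f g : gmap A B) : gcobs i f -> gcobs i g -> gcobs i (gadd f g).
Proof. by move=> hf hg x y e; apply: cobs_cat; [exact: hf|exact: hg]. Qed.

Lemma gcobs_scale i A B a (f : gmap A B) : gcobs i f -> gcobs i (gscale a f).
Proof. by move=> hf x y e; apply: cobs_lscale; exact: hf. Qed.

Lemma mor_of_opp i A B (f : gmap A B) : fin_fibers B -> gcobs i f ->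
  mor_of i (gscale (-1) f) = - mor_of i f.
Proof.
move=> hB hf; apply: mor_eq => x y; rewrite entN !mor_ofE //.
by case: eqP => [e|]; [rewrite cls_opp //; exact: hf|rewrite oppr0].
Qed.

Lemma mor_of_scale1 i A B (f : gmap A B) : fin_fibers B -> gcobs i f ->
  mor_of i (gscale 1 f) = mor_of i f.
Proof.
move=> hB hf; apply: mor_eq => x y; rewrite !mor_ofE //.
by case: eqP => [e|//]; rewrite cls_scale1 //; exact: hf.
Qed.

Lemma mor_of_zero i A B : fin_fibers B -> mor_of i (@gzero R A B) = 0.
Proof. by move=> hB; apply: mor_eq => x y; rewrite mor_ofE //; case: ifP. Qed.

Lemma mor_of_id A : fin_fibers A -> mor_of 0 (@gid R A) = mid A.
Proof.
move=> hA; apply: mor_eq => x y; rewrite mor_ofE // addr0 /= /mpart_ent /gid.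
rewrite (_ : (Some x == Some y) = (x == y)) //.
by case: (eqVneq x y) => [->|_]; rewrite ?eqxx //; case: ifP.
Qed.

Lemma gcobs_id A : (forall x : gens A, tangle n n (dg x)) -> gcobs 0 (@gid R A).
Proof. by move=> hA x y _; rewrite /gid; case: eqP => [<-|//]; exact: cobs_lid. Qed.

Lemma geq_mor i A B (f g : gmap A B) : fin_fibers B -> geq n i f g -> mor_of i f = mor_of i g.
Proof.
move=> hB h; apply: mor_eq => x y; rewrite !mor_ofE //; case: eqP => [e|//].
by apply: cls_meq; exact: h.
Qed.

Lemma mor_geq i A B (f g : gmap A B) : fin_fibers B -> gcobs i f -> gcobs i g ->
  mor_of i f = mor_of i g -> geq n i f g.
Proof.
move=> hB hf hg h x y e; have := congr1 (fun m : mor A B => m x y) h.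
by rewrite !mor_ofE // e eqxx; apply: meq_cls; [exact: hf|exact: hg].
Qed.

Lemma mhom_of i j A B (f : gmap A B) : fin_fibers B -> hom n i j f -> mhom i j (mor_of i f).
Proof.
move=> hB hf x y; rewrite mor_ofE //; case: eqP => [e|//]; split=> [_|//].
by exists (f x y) => //; exact: hf.
Qed.

(** Choosing representatives of the entries turns a homogeneous matrix back into a
    graded map. *)
Lemma mhom_raw i j A B (f : mor A B) : fin_fibers B -> mhom i j f ->
  exists2 r : gmap A B, hom n i j r & mor_of i r = f.
Proof.
move=> hB hf.
have h x y : exists r, (hd y = hd x + i -> cob_hom n (qd x + j) (dg x) (qd y) (dg y) r)
   /\ (hd y = hd x + i -> f x y = cls r).
  have [e|/eqP ne] := eqVneq (hd y) (hd x + i); last by exists [::]; split.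
  by have [r hr er] := (hf x y).1 e; exists r.
exists (fun x y => sval (cid (h x y))).
  by move=> x y e; case: cid => r /= [h1 _]; exact: h1.
apply: mor_eq => x y; rewrite mor_ofE //; case: eqP => [e|ne]; last by rewrite (hf x y).2.
by case: cid => r /= [_ h2]; rewrite h2.
Qed.

Lemma mor_of_hdiff i A B (f : gmap A B) : fin_fibers A -> fin_fibers B -> gcobs 1 (@dif R A) ->
  gcobs 1 (@dif R B) -> gcobs i f ->
  (i = 0 -> mor_of (i + 1) (hdiff i f) =
     mor_of 1 (@dif R B) ** mor_of i f - mor_of i f ** mor_of 1 (@dif R A)) /\
  (i = -1 -> mor_of (i + 1) (hdiff i f) =
     mor_of 1 (@dif R B) ** mor_of i f + mor_of i f ** mor_of 1 (@dif R A)).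
Proof.
move=> hA hB dA dB hf.
have c1 : gcobs (i + 1) (gcomp i (@dif R B) f) by exact: gcobs_comp.
have c2 : gcobs (i + 1) (gcomp 1 f (@dif R A)) by rewrite addrC; exact: gcobs_comp.
rewrite -[in X in X /\ _](@mor_of_comp i 1) //.
have e : mor_of i f ** mor_of 1 (@dif R A) = mor_of (i + 1) (gcomp 1 f (@dif R A)).
  by rewrite addrC mor_of_comp.
rewrite e -(@mor_of_comp i 1) //.
split=> i0; rewrite /hdiff.
  have -> : psign i = 1 by rewrite i0.
  rewrite mor_of_add ?mor_of_opp //; exact: gcobs_scale.
have -> : psign i = -1 by rewrite i0.
rewrite opprK mor_of_add ?mor_of_scale1 //; exact: gcobs_scale.
Qed.
End Mor.

(** * Identities in abelian groups *)

Section ZmodReflection.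
Set Implicit Arguments.
Unset Strict Implicit.

Inductive zexp := ZVar of nat | ZAdd of zexp & zexp | ZOpp of zexp | ZZero.

Fixpoint zeval (V : zmodType) (env : seq V) e : V :=
  match e with
  | ZVar i => nth 0 env i
  | ZAdd a b => zeval env a + zeval env b
  | ZOpp a => - zeval env a
  | ZZero => 0
  end.

(** An expression in an abelian group is determined by the integer coefficients of
    its variables, so identities are checked by comparing coefficients. *)
Fixpoint zcoef e i : int :=
  match e with
  | ZVar j => (j == i)%:Z
  | ZAdd a b => zcoef a i + zcoef b i
  | ZOpp a => - zcoef a i
  | ZZero => 0
  end.

Lemma zevalE (V : zmodType) (env : seq V) e :
  zeval env e = \sum_(i < size env) nth 0 env i *~ zcoef e i.
Proof.
elim: e => [j|a IHa b IHb|a IHa|] /=.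
- have [h|h] := ltnP j (size env).
    rewrite (bigD1 (Ordinal h)) //= eqxx mulr1z big1 ?addr0 // => i ne.
    rewrite (_ : (j == i) = false) ?mulr0z //; apply/negbTE.
    by apply: contraNneq ne => e; apply/eqP/val_inj.
  rewrite nth_default // big1 // => i _.
  by rewrite (_ : (j == i) = false) ?mulr0z // gtn_eqF // (leq_trans _ h).
- by rewrite IHa IHb -big_split; apply: eq_bigr => i _; rewrite mulrzDr.
- by rewrite IHa -sumrN; apply: eq_bigr => i _; rewrite mulrNz.
- by rewrite big1 // => i _; rewrite mulr0z.
Qed.

Lemma zmod_reflect (V : zmodType) (env : seq V) e e' :
  all (fun i => zcoef e i == zcoef e' i) (iota 0 (size env)) -> zeval env e = zeval env e'.
Proof.
move=> /allP h; rewrite !zevalE; apply: eq_bigr => i _; congr (_ *~ _).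
by apply/eqP; apply: h; rewrite mem_iota add0n ltn_ord.
Qed.
End ZmodReflection.

Ltac zm_index x env :=
  lazymatch env with
  | ?a :: ?r => match constr:((a, x)) with
               | (?y, ?y) => constr:(0%N)
               | _ => let k := zm_index x r in constr:(S k)
               end
  end.
Ltac zm_mem x env :=
  lazymatch env with
  | nil => constr:(false)
  | ?a :: ?r => match constr:((a, x)) with
               | (?y, ?y) => constr:(true)
               | _ => zm_mem x r
               end
  end.
Ltac zm_vars t env :=
  lazymatch t with
  | GRing.add ?a ?b => let env := zm_vars a env in zm_vars b env
  | GRing.opp ?a => zm_vars a env
  | GRing.zero => env
  | _ => let m := zm_mem t env in
         lazymatch m with true => env | false => constr:(t :: env) end
  end.
Ltac zm_reify t env :=
  lazymatch t with
  | GRing.add ?a ?b => let a := zm_reify a env in let b := zm_reify b env in constr:(ZAdd a b)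
  | GRing.opp ?a => let a := zm_reify a env in constr:(ZOpp a)
  | GRing.zero => constr:(ZZero)
  | _ => let k := zm_index t env in constr:(ZVar k)
  end.
Ltac zmod :=
  lazymatch goal with
  | |- @eq ?T ?l ?r =>
    let env := zm_vars l (@nil T) in let env := zm_vars r env in
    let l' := zm_reify l env in let r' := zm_reify r env in
    apply (@zmod_reflect _ env l' r'); vm_compute; reflexivity
  end.

(** * Homotopy equivalences of cones *)

Section Algebra.
Context {R : realType}.
Variable n : nat.
Set Implicit Arguments.
Unset Strict Implicit.
Local Notation mor := (@mor R n).
Local Notation "g ** f" := (mcomp g f) (at level 40, left associativity).
Local Notation mid := (@mid R n _).
Implicit Types (A B C Q W P : cpx R).

(** Products are kept associated to the left, where a relation a b = c is visible
    only at the beginning of a word; this form finds it further to the right. *)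
Lemma ext_rel A B C (b : mor A B) (a : mor B C) (c : mor A C) : a ** b = c ->
  forall D (x : mor C D), x ** a ** b = x ** c.
Proof. by move=> e D x; rewrite -mcompA e. Qed.

Ltac mnorm := rewrite ?(mcompDl, mcompDr, mcompNl, mcompNr, mcomp0l, mcomp0r,
  mcomp1l, mcomp1r, opprD, opprK, oppr0, addr0, add0r, mcompA).

Definition mheq A B (dA : mor A A) (dB : mor B B) : Prop :=
  exists (F : mor A B) (G : mor B A) (K : mor A A) (L : mor B B),
  [/\ mhom 0 0 F, mhom 0 0 G, mhom (-1) 0 K & mhom (-1) 0 L] /\
  [/\ dB ** F = F ** dA, dA ** G = G ** dB,
      G ** F = mid + (dA ** K + K ** dA) & F ** G = mid + (dB ** L + L ** dB)].

Lemma mheq_trans A B C (dA : mor A A) (dB : mor B B) (dC : mor C C) :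
  mheq dA dB -> mheq dB dC -> mheq dA dC.
Proof.
move=> [F [G [K [L [[hF hG hK hL] [cF cG GF FG]]]]]].
move=> [F' [G' [K' [L' [[hF' hG' hK' hL'] [cF' cG' GF' FG']]]]]].
exists (F' ** F), (G ** G'), (K + G ** K' ** F), (L' + F' ** L ** G'); split.
  split.
  - exact: mhomE (mhom_comp hF hF').
  - exact: mhomE (mhom_comp hG' hG).
  - by apply: mhomD => //; apply: mhomE (mhom_comp hF (mhom_comp hK' hG)).
  - by apply: mhomD => //; apply: mhomE (mhom_comp hG' (mhom_comp hL hF')).
split.
- by mnorm; rewrite ?(cF', ext_rel cF') -?mcompA cF.
- by mnorm; rewrite ?(cG, ext_rel cG) -?mcompA cG'.
- mnorm; rewrite (ext_rel GF') cG; mnorm; rewrite GF -[_ ** dB ** F]mcompA cF; mnorm; zmod.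
- mnorm; rewrite (ext_rel FG) cF'; mnorm; rewrite FG' -[_ ** dB ** G']mcompA cG'; mnorm; zmod.
Qed.

(** Put e = F G, homotopic to 1 + N.  Since G F is homotopic to 1, e e is
    homotopic to e, so (1 + N)(1 + N) = 1 + 2 N is homotopic to 1 + N, and N is
    null-homotopic. *)
Lemma mheq_unipotent A B (dA : mor A A) (dB : mor B B) (F : mor A B) (G : mor B A)
    (K : mor A A) (L N : mor B B) :
  [/\ mhom 0 0 F, mhom 0 0 G, mhom (-1) 0 K, mhom (-1) 0 L & mhom 0 0 N] ->
  dB ** F = F ** dA -> dA ** G = G ** dB -> dB ** dB = 0 ->
  G ** F = mid + (dA ** K + K ** dA) ->
  F ** G = mid + N + (dB ** L + L ** dB) -> N ** N = 0 -> mheq dA dB.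
Proof.
move=> [hF hG hK hL hN] cF cG dd GF FG NN.
have he : mhom 0 0 (F ** G) by apply: mhomE (mhom_comp hG hF).
have eD : F ** G ** dB = dB ** (F ** G).
  by mnorm; rewrite cF -!mcompA cG.
have ee : F ** G ** (F ** G) = F ** G + (dB ** (F ** K ** G) + F ** K ** G ** dB).
  mnorm; rewrite (ext_rel GF) cF; mnorm.
  by rewrite -[F ** K ** G ** dB]mcompA -cG; mnorm.
(* With e = F G, the commutators of dB with F K G, e L, L N and L are e e - e,
   e X, X N and X for X = e - 1 - N; they combine to e - 1 because N N = 0. *)
exists F, G, K, (F ** K ** G - F ** G ** L - L ** N + L); split.
  split=> //; apply: mhomD => //; apply: mhomD; first apply: mhomD.
  - by apply: mhomE (mhom_comp hG (mhom_comp hK hF)).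
  - by apply: mhomN; apply: mhomE (mhom_comp hL he).
  - by apply: mhomN; apply: mhomE (mhom_comp hN hL).
split=> //.
have [e eE] : exists e, e = F ** G by exists (F ** G).
have [Y YE] : exists Y, Y = F ** K ** G by exists (F ** K ** G).
rewrite -eE -YE in eD ee FG *.
have ND : N ** dB = dB ** N.
  have -> : N = e - mid - (dB ** L + L ** dB) by rewrite FG; zmod.
  by mnorm; rewrite eD dd -[L ** dB ** dB]mcompA dd; mnorm.
have YD : dB ** Y + Y ** dB = e ** e - e by rewrite ee; zmod.
transitivity (mid + (dB ** Y + Y ** dB - (e ** (dB ** L + L ** dB)) -
   ((dB ** L + L ** dB) ** N) + (dB ** L + L ** dB))); last first.
  by mnorm; rewrite eD -[L ** dB ** N]mcompA -ND; mnorm; zmod.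
have XE : dB ** L + L ** dB = e - mid - N by rewrite FG; zmod.
by rewrite YD XE; mnorm; rewrite NN; mnorm; zmod.
Qed.

Definition biproduct A B C (j1 : mor A C) (j2 : mor B C) (p1 : mor C A) (p2 : mor C B) :=
  [/\ p1 ** j1 = mid, p2 ** j2 = mid, p1 ** j2 = 0, p2 ** j1 = 0 &
      j1 ** p1 + j2 ** p2 = mid].

(** Written with the structure maps of a direct sum, so that the argument does not
    depend on how the generators of a cone are encoded. *)
Definition cone_dif A B C (j1 : mor A C) (j2 : mor B C) (p1 : mor C A) (p2 : mor C B)
   (dA : mor A A) (dB : mor B B) (u : mor A B) : mor C C :=
  j2 ** dB ** p2 + j2 ** u ** p1 - j1 ** dA ** p1.

(** With T' (a, b) = (phi a, phi b - phi u h a) and T (a, b) = (psi a, psi b + h u psi a),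
    T T' is homotopic to 1 and T' T is homotopic to 1 + N, where N maps the source
    summand to the target summand. *)
Lemma mheq_cone_conj A B C C' (i j : int)
  (j1 j2 : mor A C) (p1 p2 : mor C A) (k1 k2 : mor B C') (q1 q2 : mor C' B)
  (dA u h : mor A A) (dB h' : mor B B) (phi : mor A B) (psi : mor B A) :
  biproduct j1 j2 p1 p2 -> biproduct k1 k2 q1 q2 ->
  [/\ mhom (i - 1) j j1, mhom 0 0 j2, mhom (1 - i) (- j) p1 & mhom 0 0 p2] ->
  [/\ mhom (i - 1) j k1, mhom 0 0 k2, mhom (1 - i) (- j) q1 & mhom 0 0 q2] ->
  [/\ mhom i j u, mhom (-1) 0 h, mhom (-1) 0 h', mhom 0 0 phi & mhom 0 0 psi] ->
  dA ** u = u ** dA -> dB ** phi = phi ** dA -> dA ** psi = psi ** dB -> dB ** dB = 0 ->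
  psi ** phi = mid + (dA ** h + h ** dA) -> phi ** psi = mid + (dB ** h' + h' ** dB) ->
  mheq (cone_dif j1 j2 p1 p2 dA dA u)
       (cone_dif k1 k2 q1 q2 dB dB (phi ** u ** psi)).
Proof.
move=> [pj11 pj22 pj12 pj21 pj] [qk11 qk22 qk12 qk21 qk] [hj1 hj2 hp1 hp2] [hk1 hk2 hq1 hq2].
move=> [hu hh hh' hphi hpsi] du dphi dpsi dd Hh Hh'.
(* phi and psi do not intertwine u and phi u psi strictly; the homotopy h
   provides the off-diagonal corrections. *)
pose T' := k1 ** phi ** p1 + k2 ** phi ** p2 - k2 ** phi ** u ** h ** p1.
pose T := j1 ** psi ** q1 + j2 ** psi ** q2 + j2 ** h ** u ** psi ** q1.
(* nu measures the incoherence of h and h'. *)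
pose nu := phi ** (h ** u - u ** h) ** psi + phi ** u ** psi ** h' - h' ** phi ** u ** psi.
have hE1 := (pj11, ext_rel pj11, pj22, ext_rel pj22, pj12, ext_rel pj12, pj21, ext_rel pj21).
have hE2 := (qk11, ext_rel qk11, qk22, ext_rel qk22, qk12, ext_rel qk12, qk21, ext_rel qk21).
have hE3 := (du, ext_rel du, dphi, ext_rel dphi, dpsi, ext_rel dpsi, dd, ext_rel dd).
have hE4 := (Hh, ext_rel Hh, Hh', ext_rel Hh').
apply: (@mheq_unipotent _ _ _ _ T' T (j2 ** h ** p2 - j1 ** h ** p1 - j2 ** h ** u ** h ** p1)
  (k2 ** h' ** q2 - k1 ** h' ** q1) (k2 ** nu ** q1)).
- split.
  + apply: mhomD; last apply: mhomN; first apply: mhomD.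
    * by apply: mhomE (mhom_comp hp1 (mhom_comp hphi hk1)); ring.
    * by apply: mhomE (mhom_comp hp2 (mhom_comp hphi hk2)).
    * by apply: mhomE (mhom_comp hp1 (mhom_comp hh (mhom_comp hu (mhom_comp hphi hk2)))); ring.
  + apply: mhomD; first apply: mhomD.
    * by apply: mhomE (mhom_comp hq1 (mhom_comp hpsi hj1)); ring.
    * by apply: mhomE (mhom_comp hq2 (mhom_comp hpsi hj2)).
    * by apply: mhomE (mhom_comp hq1 (mhom_comp hpsi (mhom_comp hu (mhom_comp hh hj2)))); ring.
  + apply: mhomD; [apply: mhomD; [|apply: mhomN]|apply: mhomN].
    * by apply: mhomE (mhom_comp hp2 (mhom_comp hh hj2)).
    * by apply: mhomE (mhom_comp hp1 (mhom_comp hh hj1)); ring.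
    * by apply: mhomE (mhom_comp hp1 (mhom_comp hh (mhom_comp hu (mhom_comp hh hj2)))); ring.
  + apply: mhomD; last apply: mhomN.
    * by apply: mhomE (mhom_comp hq2 (mhom_comp hh' hk2)).
    * by apply: mhomE (mhom_comp hq1 (mhom_comp hh' hk1)); ring.
  + have hnu : mhom (i - 1) j nu.
      apply: mhomD; last apply: mhomN; first apply: mhomD.
      * apply: mhomE (mhom_comp hpsi (mhom_comp (_ : mhom (i - 1) j (h ** u - u ** h)) hphi)); try ring.
        apply: mhomD; last apply: mhomN.
          by apply: mhomE (mhom_comp hu hh); ring.
        by apply: mhomE (mhom_comp hh hu); ring.
      * by apply: mhomE (mhom_comp hh' (mhom_comp hpsi (mhom_comp hu hphi))); ring.
      * by apply: mhomE (mhom_comp hpsi (mhom_comp hu (mhom_comp hphi hh'))); ring.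
    by apply: mhomE (mhom_comp hq1 (mhom_comp hnu hk2)); ring.
- rewrite /cone_dif /T'; mnorm; do ![progress rewrite ?(hE1, hE2); mnorm].
  by do ![progress rewrite ?(hE3, hE4); mnorm]; zmod.
- rewrite /cone_dif /T; mnorm; do ![progress rewrite ?(hE1, hE2); mnorm].
  by do ![progress rewrite ?(hE3, hE4); mnorm]; zmod.
- rewrite /cone_dif; mnorm; do ![progress rewrite ?(hE1, hE2); mnorm].
  by do ![progress rewrite ?(hE3); mnorm]; zmod.
- rewrite /cone_dif /T /T' -pj; mnorm; do ![progress rewrite ?(hE1, hE2); mnorm].
  by do ![progress rewrite ?(hE3, hE4); mnorm]; zmod.
- rewrite /cone_dif /T /T' /nu -qk; mnorm; do ![progress rewrite ?(hE1, hE2); mnorm].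
  by do ![progress rewrite ?(hE3, hE4); mnorm]; zmod.
- by rewrite /nu; mnorm; do ![progress rewrite ?(hE1, hE2); mnorm].
Qed.

(** The maps io and pr include and project the coefficient of u^0, and rho divides
    by u.  The only failure of io to be a chain map is u io del, which is the
    boundary of - io del in the cone. *)
Lemma mheq_cone_quotient Q W C (i j : int) (j1 j2 : mor W C) (p1 p2 : mor C W)
  (dQ : mor Q Q) (dW u rho : mor W W) (io : mor Q W) (pr : mor W Q) (del : mor Q Q) :
  biproduct j1 j2 p1 p2 ->
  [/\ mhom (i - 1) j j1, mhom 0 0 j2, mhom (1 - i) (- j) p1 & mhom 0 0 p2] ->
  [/\ mhom 0 0 io, mhom 0 0 pr, mhom (- i) (- j) rho & mhom (1 - i) (- j) del] ->
  [/\ pr ** io = mid, rho ** u = mid, pr ** u = 0, rho ** io = 0 &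
     io ** pr + u ** rho = mid] ->
  dW ** io = io ** dQ + u ** io ** del -> dW ** u = u ** dW ->
  dQ ** del = - (del ** dQ) -> del ** del = 0 ->
  mheq dQ (cone_dif j1 j2 p1 p2 dW dW u).
Proof.
move=> [pj11 pj22 pj12 pj21 pj] [hj1 hj2 hp1 hp2] [hio hpr hrho hdel].
move=> [pi ru pu ri ipur] dio du ddel deldel.
have hE1 := (pj11, ext_rel pj11, pj22, ext_rel pj22, pj12, ext_rel pj12, pj21, ext_rel pj21).
have hE2 := (pi, ext_rel pi, ru, ext_rel ru, pu, ext_rel pu, ri, ext_rel ri).
have hE3 := (dio, ext_rel dio, du, ext_rel du, ddel, ext_rel ddel, deldel, ext_rel deldel).
have dpr : pr ** dW = dQ ** pr.
  rewrite -[LHS]mcomp1r -ipur; mnorm; do ![progress rewrite ?(hE2, hE3); mnorm].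
  by [].
have drho : rho ** dW = dW ** rho + io ** del ** pr.
  rewrite -[LHS]mcomp1r -ipur; mnorm; do ![progress rewrite ?(hE2, hE3); mnorm].
  by zmod.
have hE4 := (dpr, ext_rel dpr, drho, ext_rel drho).
have iopr : io ** pr = mid - u ** rho by rewrite -ipur; zmod.
exists (j2 ** io - j1 ** io ** del), (pr ** p2), 0, (- (j1 ** rho ** p2)); split.
  split; [| |exact: mhom0|].
  - apply: mhomD; last apply: mhomN; first exact: mhomE (mhom_comp hio hj2).
    by apply: mhomE (mhom_comp hdel (mhom_comp hio hj1)); ring.
  - by apply: mhomE (mhom_comp hp2 hpr).
  - by apply: mhomN; apply: mhomE (mhom_comp hp2 (mhom_comp hrho hj1)); ring.
rewrite /cone_dif; split.
- mnorm; do ![progress rewrite ?(hE1, hE2, hE3); mnorm].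
  by zmod.
- mnorm; do ![progress rewrite ?(hE1, hE2, hE3, hE4); mnorm].
  by [].
- mnorm; do ![progress rewrite ?(hE1, hE2, hE3); mnorm].
  by [].
- rewrite -pj; mnorm; do ![progress rewrite ?(hE1, hE2, hE3, hE4); mnorm].
  rewrite ?(iopr, ext_rel iopr); mnorm.
  by zmod.
Qed.
End Algebra.

(** * From matrices back to graded maps, and cones *)

Section Dictionary.
Context {R : realType}.
Variable n : nat.
Set Implicit Arguments.
Unset Strict Implicit.
Local Notation Hom := (@cobHom R n).
Local Notation cls := (@cls R n _ _).
Local Notation hom := (@Defs.hom R).
Local Notation geq := (@Defs.geq R).
Local Notation mor := (@mor R n).
Local Notation "g ** f" := (mcomp g f) (at level 40, left associativity).
Local Notation mid := (@mid R n _).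
Local Notation mor_of := (@mor_of R n).
Local Notation mpart := (@mpart R n _ _).
Implicit Types (A B C : cpx R).

(** The conditions under which graded maps between complexes and homogeneous matrices
    determine each other, and the identity has degree 0. *)
Definition is_precpx A : Prop :=
  [/\ (forall x : gens A, tangle n n (dg x)), fin_fibers A & hom n 1 0 (@dif R A)].

Definition mdif A : mor A A := mor_of 1 (@dif R A).

Lemma is_cpx_precpx A : is_cpx n A -> is_precpx A.
Proof. by move=> [h1 h2 h3 _]; split. Qed.

Lemma mdif_sq A : is_cpx n A -> mdif A ** mdif A = 0.
Proof.
move=> [h1 h2 h3 h4]; have c := hom_gcobs h3.
by rewrite -(mor_of_comp (i := 1) (j := 1)) // (geq_mor h2 h4) mor_of_zero.
Qed.

Lemma gcobs_hdiff i A B (f : gmap A B) : fin_fibers A -> fin_fibers B -> gcobs n 1 (@dif R A) ->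
  gcobs n 1 (@dif R B) -> gcobs n i f -> gcobs n (i + 1) (hdiff i f).
Proof.
move=> hA hB dA dB hf; apply: gcobs_add; first exact: gcobs_comp.
by apply: gcobs_scale; rewrite addrC; exact: gcobs_comp.
Qed.

Lemma chain_mapP A B (f : gmap A B) : is_precpx A -> is_precpx B -> hom n 0 0 f ->
  (chain_map n 0 0 f <-> mdif B ** mor_of 0 f = mor_of 0 f ** mdif A).
Proof.
move=> [tA lA dA] [tB lB dB] hf; have cA := hom_gcobs dA; have cB := hom_gcobs dB.
have cf := hom_gcobs hf.
have [e _] := mor_of_hdiff lA lB cA cB cf; have {}e := e erefl.
split=> [[_ /(geq_mor lB)]|h].
  by rewrite e mor_of_zero // => /eqP; rewrite subr_eq0 => /eqP.
split=> //; apply: mor_geq => //; first exact: gcobs_hdiff.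
by rewrite e mor_of_zero // h subrr.
Qed.

Lemma homotopic_idP A (f : gmap A A) : is_precpx A -> gcobs n 0 f ->
  (homotopic n f (@gid R A) <-> exists2 h : mor A A, mhom (-1) 0 h &
     mor_of 0 f = mid + (mdif A ** h + h ** mdif A)).
Proof.
move=> [tA lA dA] cf; have cA := hom_gcobs dA.
have ci := @gcobs_id R n A tA.
have lhs : mor_of 0 (gadd f (gscale (-1) (@gid R A))) = mor_of 0 f - mid.
  by rewrite mor_of_add ?mor_of_opp ?mor_of_id //; exact: gcobs_scale.
split=> [[h hh /(geq_mor lA)]|[h hh e]].
  have [_ /(_ erefl) e] := mor_of_hdiff lA lA cA cA (hom_gcobs hh).
  rewrite lhs -[0]/(-1 + 1 : int) e => /(canRL (subrK _)) ->.
  by exists (mor_of (-1) h); [exact: mhom_of|rewrite addrC].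
have [r hr er] := mhom_raw lA hh; exists r => //.
apply: mor_geq => //; first by apply: gcobs_add => //; exact: gcobs_scale.
  by rewrite -[0]/(-1 + 1 : int); apply: gcobs_hdiff => //; exact: hom_gcobs hr.
have [_ /(_ erefl) e'] := mor_of_hdiff lA lA cA cA (hom_gcobs hr).
by rewrite lhs; apply: etrans (esym e'); rewrite er e addrC addKr.
Qed.

Lemma mheq_homotopy_equiv A B : is_precpx A -> is_precpx B -> mheq (mdif A) (mdif B) ->
  homotopy_equiv n A B.
Proof.
move=> gA gB [F [G [K [L [[hF hG hK hL] [cF cG GF FG]]]]]].
have [tA lA dA] := gA; have [tB lB dB] := gB.
have [f hf ef] := mhom_raw lB hF; have [g hg eg] := mhom_raw lA hG.
exists f, g; split.
- by apply/(chain_mapP gA gB hf); rewrite ef.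
- by apply/(chain_mapP gB gA hg); rewrite eg.
- apply/homotopic_idP => //.
    by apply: (gcobs_comp (i := 0) (j := 0)) => //; apply: hom_gcobs; eassumption.
  exists K => //; rewrite (mor_of_comp (i := 0) (j := 0)) ?ef ?eg ?GF //; apply: hom_gcobs; eassumption.
- apply/homotopic_idP => //.
    by apply: (gcobs_comp (i := 0) (j := 0)) => //; apply: hom_gcobs; eassumption.
  exists L => //; rewrite (mor_of_comp (i := 0) (j := 0)) ?ef ?eg ?FG //; apply: hom_gcobs; eassumption.
Qed.

Lemma homotopy_inverseP A B (f : gmap A B) (g : gmap B A) : is_precpx A -> is_precpx B ->
  homotopy_inverse n f g ->
  exists (h : mor A A) (h' : mor B B), [/\ mhom (-1) 0 h, mhom (-1) 0 h',
    mor_of 0 g ** mor_of 0 f = mid + (mdif A ** h + h ** mdif A) &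
    mor_of 0 f ** mor_of 0 g = mid + (mdif B ** h' + h' ** mdif B)].
Proof.
move=> gA gB [[hf _] [hg _] gf fg].
have [tA lA dA] := gA; have [tB lB dB] := gB.
have cf := hom_gcobs hf; have cg := hom_gcobs hg.
have [h hh e] := (homotopic_idP gA (gcobs_comp (i := 0) (j := 0) lB cf cg)).1 gf.
have [h' hh' e'] := (homotopic_idP gB (gcobs_comp (i := 0) (j := 0) lA cg cf)).1 fg.
rewrite (mor_of_comp (i := 0) (j := 0)) // in e.
rewrite (mor_of_comp (i := 0) (j := 0)) // in e'.
by exists h, h'.
Qed.

Section Cone.
Variables (i j : int) (A B : cpx R) (u : gmap A B).
Local Notation Cu := (cone i j u).

Definition cone_inl : mor A Cu := mpart (fun x : gens A => Some (inl x : gens Cu)).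
Definition cone_inr : mor B Cu := mpart (fun y : gens B => Some (inr y : gens Cu)).
Definition cone_prl : mor Cu A := mpart (fun z : gens Cu =>
  match z return option (gens A) with inl x => Some x | inr _ => None end).
Definition cone_prr : mor Cu B := mpart (fun z : gens Cu =>
  match z return option (gens B) with inr y => Some y | inl _ => None end).

Lemma cone_biproduct : biproduct cone_inl cone_inr cone_prl cone_prr.
Proof.
split; rewrite /cone_inl /cone_inr /cone_prl /cone_prr ?mpart_comp;
      try by [move=> ? ? [<-]|case=> ? ? // [<-]].
- exact: mpart_eq.
- exact: mpart_eq.
- exact: mpart_none.
- exact: mpart_none.
- apply: mor_eq => x y; rewrite entD /= /mpart_ent; case: x => x /=.
    by rewrite addr0.
  by rewrite add0r.
Qed.

Lemma cone_mhom : (forall x : gens A, tangle n n (dg x)) -> (forall x : gens B, tangle n n (dg x)) ->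
  [/\ mhom (i - 1) j cone_inl, mhom 0 0 cone_inr, mhom (1 - i) (- j) cone_prl & mhom 0 0 cone_prr].
Proof.
move=> tA tB; have tC (z : gens Cu) : tangle n n (dg z) by case: z => z /=; [exact: tA|exact: tB].
split; apply: mhom_part => //.
- by move=> x _ [<-]; split=> //=; rewrite addrA.
- by move=> x _ [<-]; split=> //=; rewrite addr0.
- by move=> [x|x] y //= [<-]; split=> //; ring.
- by move=> [x|x] y //= [<-]; split=> //; rewrite addr0.
Qed.

Hypotheses (gA : is_precpx A) (gB : is_precpx B) (hu : hom n i j u) (ieven : psign i = 1).

Lemma cone_fin : fin_fibers Cu.
Proof.
move=> k; have [_ lA _] := gA; have [_ lB _] := gB.
rewrite (_ : [set _ | _]%classic = (inl @` [set x : gens A | hd x = k + 1 - i] `|`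
   inr @` [set y : gens B | hd y = k])%classic).
  by rewrite finite_setU; split; apply: finite_image.
apply/seteqP; split=> [[x|y] /= h|z].
- by left; exists x => //=; rewrite -h; ring.
- by right; exists y.
- by case=> -[x /= h <-] /=; rewrite ?h //; ring.
Qed.

Lemma cone_hom : hom n 1 0 (@dif R Cu).
Proof.
have [tA lA dA] := gA; have [tB lB dB] := gB.
move=> [x|x] [y|y] /= h.
- do 2!apply: cob_hom_scale; apply: cob_homE (dA x y _); first by ring.
  by apply: (addIr (i - 1)); rewrite !addrA h; ring.
- apply: cob_homE (hu _); first by ring.
  by rewrite h; ring.
- by [].
- exact: dB.
Qed.

Lemma cone_precpx : is_precpx Cu.
Proof.
have [tA lA dA] := gA; have [tB lB dB] := gB.
by split; [case=> x /=; [exact: tA|exact: tB]|exact: cone_fin|exact: cone_hom].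
Qed.

(** For even i the shift does not change the sign of the differential. *)
Lemma cone_mdif : mdif Cu = cone_dif cone_inl cone_inr cone_prl cone_prr (mdif A) (mdif B) (mor_of i u).
Proof.
have [tA lA dA] := gA; have [tB lB dB] := gB; have lC := cone_fin.
apply: mor_eq => z z'; rewrite /mdif mor_ofE // /cone_dif !entD entN.
case: z => [x|x].
- rewrite (@mcomp_partr0 R n _ _ _ _ _ (inl x : gens Cu)) // add0r.
  rewrite !(@mcomp_partr R n _ _ _ _ _ (inl x : gens Cu) (x : gens A)) //.
  case: z' => [y|y].
  + rewrite [(cone_inr ** _) _ _]mcomp_partl0 // hcomp0l add0r.
    rewrite (@mcomp_partl R n _ _ _ _ _ _ (y : gens A) (inl y : gens Cu)) //; last by move=> y' [].
    rewrite mor_ofE //=.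
    rewrite (_ : (@hd R A y + i - 1 == @hd R A x + i - 1 + 1) = (@hd R A y == @hd R A x + 1)); last first.
      by apply/eqP/eqP => h; [apply: (addIr (i - 1)); rewrite !addrA h; ring|rewrite h; ring].
    case: eqP => [h|_]; last by rewrite hcomp0r hcomp0l oppr0.
    rewrite ieven; have c := hom_gcobs dA h.
    rewrite cls_opp; last exact: cobs_lscale.
    rewrite cls_scale1 //; congr (- _); symmetry.
    apply: etrans (hcomp1r _) _; exact: hcomp1l.
  + rewrite [(cone_inl ** _) _ _]mcomp_partl0 // hcomp0l oppr0 addr0.
    rewrite (@mcomp_partl R n _ _ _ _ _ _ (y : gens B) (inr y : gens Cu)) //; last by move=> y' [].
    rewrite mor_ofE //=.
    rewrite (_ : (@hd R B y == @hd R A x + i - 1 + 1) = (@hd R B y == @hd R A x + i)); last first.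
      by congr (_ == _); ring.
    case: eqP => [h|_]; last by rewrite hcomp0r hcomp0l.
    symmetry; apply: etrans (hcomp1r _) _; exact: hcomp1l.
- rewrite [(_ ** cone_prl) _ _](@mcomp_partr0 R n _ _ _ _ _ (inr x : gens Cu)) // addr0.
  rewrite [(_ ** cone_prl) _ _](@mcomp_partr0 R n _ _ _ _ _ (inr x : gens Cu)) // subr0.
  rewrite (@mcomp_partr R n _ _ _ _ _ (inr x : gens Cu) (x : gens B)) //.
  case: z' => [y|y].
  + rewrite mcomp_partl0 // hcomp0l /=; by case: eqP.
  + rewrite (@mcomp_partl R n _ _ _ _ _ _ (y : gens B) (inr y : gens Cu)) //; last by move=> y' [].
    rewrite mor_ofE //=; case: eqP => [h|_]; last by rewrite hcomp0r hcomp0l.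
    symmetry; apply: etrans (hcomp1r _) _; exact: hcomp1l.
Qed.
End Cone.
End Dictionary.

(** * The symmetric projector and its periodic complex *)

Section Symmetric.
Context {R : realType}.
Variable n : nat.
Set Implicit Arguments.
Unset Strict Implicit.
Local Notation Hom := (@cobHom R n).
Local Notation cls := (@cls R n _ _).
Local Notation hom := (@Defs.hom R).
Local Notation geq := (@Defs.geq R).
Local Notation mor := (@mor R n).
Local Notation "g ** f" := (mcomp g f) (at level 40, left associativity).
Local Notation mid := (@mid R n _).
Local Notation mor_of := (@mor_of R n).
Local Notation mpart := (@mpart R n _ _).
Local Notation mdif := (@mdif R n).

Variables (n_ge2 : (2 <= n)%N) (K : cpx R) (D : sym_gens n K -> sym_gens n K -> @lincomb R).
Local Notation Q := (symQ D).
Local Notation E0 := (symE0 n K).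
Hypotheses (lK : fin_fibers K) (cQ : is_convolution n (@sym_map R n K) D) (bQ : Kom_minus n Q).

Lemma first_lt : (0 < 2 * n)%N. Proof. by lia. Qed.
Lemma last_lt : ((2 * n).-1 < 2 * n)%N. Proof. by lia. Qed.
Definition i_first : 'I_(2 * n) := Ordinal first_lt.
Definition i_last : 'I_(2 * n) := Ordinal last_lt.
(** Generators of the two outer terms.  Both terms are K juxtaposed with a strand up
    to a q-shift, as their diagrams D_k have k = 0. *)
Definition qfirst (x : gens K) : gens Q := existT (fun m => gens (sym_term K m)) i_first x.
Definition qlast (x : gens K) : gens Q := existT (fun m => gens (sym_term K m)) i_last x.

Lemma sym_k_first : sym_k n 0 = 0%N.
Proof. by rewrite /sym_k ifT //; lia. Qed.
Lemma sym_k_last : sym_k n (2 * n).-1 = 0%N.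
Proof. by rewrite /sym_k ifF; lia. Qed.

Lemma dg_first x : dg (qfirst x) = @dg R E0 x.
Proof. by rewrite /= sym_k_first. Qed.
Lemma dg_last x : dg (qlast x) = @dg R E0 x.
Proof. by rewrite /= sym_k_last. Qed.

Lemma hd_first x : hd (qfirst x) = @hd R K x - (2 * n)%:Z + 1.
Proof.
rewrite /= /position /= (_ : (2 * n)%:Z = ((2 * n).-1)%:Z + 1); first by ring.
by rewrite -PoszD addn1 prednK //; exact: first_lt.
Qed.
Lemma hd_last x : hd (qlast x) = @hd R K x.
Proof. by rewrite /= /position /= subrr addr0. Qed.
Lemma qd_first x : qd (qfirst x) = @qd R K x + (2 * n)%:Z.
Proof. by rewrite /= ifT ?subr0 //; lia. Qed.
Lemma qd_last x : qd (qlast x) = @qd R K x.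
Proof.
rewrite /= ifF; last by apply/negbTE; lia.
rewrite (_ : (2 * n)%:Z - 1 = ((2 * n).-1)%:Z) ?subrr ?addr0 //.
by apply/eqP; rewrite subr_eq -PoszD addn1 prednK //; exact: first_lt.
Qed.

Lemma qfirstP (z : gens Q) : val (tag z) = 0%N -> z = qfirst (tagged z).
Proof. by case: z => m x /= h; have -> : m = i_first by exact: val_inj. Qed.

Lemma qlastP (z : gens Q) : val (tag z) = (2 * n).-1 -> z = qlast (tagged z).
Proof. by case: z => m x /= h; have -> : m = i_last by exact: val_inj. Qed.

Lemma symQ_precpx : is_precpx n Q.
Proof. by have [] := bQ => /is_cpx_precpx. Qed.

Lemma symE0_fin : fin_fibers E0.
Proof. exact: lK. Qed.

Lemma symE0_tangle (x : gens K) : tangle n n (@dg R E0 x).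
Proof. by have [tQ _ _] := symQ_precpx; rewrite -dg_first; exact: tQ. Qed.

Definition eta_part (x : gens E0) : option (gens Q) := Some (qlast x).
Definition eps_part (z : gens Q) : option (gens E0) :=
  if val (tag z) == 0%N then Some (tagged z : gens K) else None.

Lemma eta_hom : hom n 0 0 (@eta R n K D).
Proof.
move=> x z h; rewrite /eta; case: ifP => [/andP[/eqP h1 /eqP h2]|//].
move: h; rewrite (qlastP h1) h2 => _.
rewrite dg_last; apply: cob_homE (cob_hom_lid 0 (symE0_tangle x)).
by rewrite qd_last /=; ring.
Qed.

Lemma epsilon_hom : hom n ((2 * n)%:Z - 1) (- (2 * n)%:Z) (@epsilon R n K D).
Proof.
move=> z x h; rewrite /epsilon; case: ifP => [/andP[/eqP h1 /eqP h2]|//].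
move: h; rewrite (qfirstP h1) h2 => _.
rewrite dg_first; apply: cob_homE (cob_hom_lid 0 (symE0_tangle x)).
by rewrite qd_first /=; ring.
Qed.

Lemma partial_hom : hom n ((2 * n)%:Z - 1) (- (2 * n)%:Z) (@partial_n R n K D).
Proof.
move=> z z' h; apply: cob_hom_scale.
have := hom_gcomp symE0_fin epsilon_hom eta_hom; rewrite !addr0; exact.
Qed.

Lemma eta_mor : mor_of 0 (@eta R n K D) = mpart eta_part.
Proof.
have [_ lQ _] := symQ_precpx; apply: mor_eq => x z; rewrite mor_ofE // addr0 [RHS]/= /mpart_ent /eta.
have [<-|ne] := eqVneq (qlast x) z.
  by rewrite hd_last !eqxx /eta_part /= ?eqxx.
rewrite [in RHS]ifN; last by apply: contra ne => /eqP[->].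
rewrite [X in if _ then X else _](_ : _ = 0); first by case: ifP.
rewrite ifF //; apply/negbTE; apply: contra ne => /andP[/eqP h1 /eqP h2].
by rewrite (qlastP h1) h2.
Qed.

Lemma epsilon_mor : mor_of ((2 * n)%:Z - 1) (@epsilon R n K D) = mpart eps_part.
Proof.
apply: mor_eq => z x; rewrite (mor_ofE _ _ symE0_fin) [RHS]/= /mpart_ent /epsilon /eps_part.
have [h1|h1] := eqVneq (val (tag z)) 0%N; last first.
  by rewrite /= if_same.
have [h2|h2] := eqVneq (tagged z : gens K) x; last first.
  rewrite /= if_same ifN //; apply: contra h2 => /eqP[->] //.
have e : z = qfirst x by rewrite (qfirstP h1) h2.
rewrite ifT; last by rewrite e hd_first; apply/eqP; rewrite /=; ring.
have e2 : lid (@dg R Q z) = lid (@dg R E0 x) by rewrite e dg_first.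
by rewrite h2 !eqxx e2.
Qed.

Definition mdel : mor Q Q := mor_of ((2 * n)%:Z - 1) (@partial_n R n K D).
Definition meta : mor E0 Q := mpart eta_part.
Definition meps : mor Q E0 := mpart eps_part.

Lemma mdelE : mdel = - (meta ** meps).
Proof.
have [_ lQ _] := symQ_precpx; have he := hom_gcobs eta_hom; have hp := hom_gcobs epsilon_hom.
rewrite /mdel /partial_n mor_of_opp //; last first.
  by rewrite -[X in gcobs _ X]addr0; exact: (gcobs_comp symE0_fin hp he).
rewrite -{1}[(2 * n)%:Z - 1]addr0 (mor_of_comp symE0_fin lQ hp he).
by rewrite eta_mor epsilon_mor.
Qed.

Lemma mdel_hom : mhom ((2 * n)%:Z - 1) (- (2 * n)%:Z) mdel.
Proof. by have [_ lQ _] := symQ_precpx; apply: mhom_of => //; exact: partial_hom. Qed.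

(** The first and the last term of the convolution are different. *)
Lemma meps_meta : meps ** meta = 0.
Proof.
rewrite mpart_comp; last by move=> x y [<-]; exact: dg_last.
rewrite -(@mpart_none R n E0 E0); apply: mpart_eq => x.
by rewrite /ocomp /= /eps_part /= ifF //; apply/negbTE; lia.
Qed.

Lemma mdel_sq : mdel ** mdel = 0.
Proof.
by rewrite mdelE mcompNl mcompNr opprK -mcompA [meps ** _]mcompA meps_meta mcomp0l mcomp0r.
Qed.

Local Notation dE := (mor_of 1 (@dif R E0)).

Lemma PoszS (k : nat) : k.+1%:Z = k%:Z + 1.
Proof. by rewrite -addn1 PoszD. Qed.

Lemma lscale1 (f : @lincomb R) : lscale 1 f = f.
Proof. by rewrite /lscale -[RHS]map_id; apply: eq_map => -[a S] /=; rewrite mul1r. Qed.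

Lemma lscaleNN (f : @lincomb R) : lscale (-1) (lscale (-1) f) = f.
Proof. by rewrite /lscale -map_comp -[RHS]map_id; apply: eq_map => -[a S] /=; rewrite !mulN1r opprK. Qed.

Lemma dif_last (x y : gens K) : @dif R (sym_term K i_last) x y = @dif R E0 x y.
Proof. by rewrite /= sym_k_last. Qed.
Lemma dif_first (x y : gens K) : @dif R (sym_term K i_first) x y = @dif R E0 x y.
Proof. by rewrite /= sym_k_first. Qed.

Lemma psign_first : psign (position i_first) = -1.
Proof.
rewrite /psign /position /= sub0r abszN absz_nat -signr_odd.
by rewrite (_ : odd _ = true) //; lia.
Qed.
Lemma psign_last : psign (position i_last) = 1.
Proof. by rewrite /psign /position /= subrr. Qed.

(** The last term is a subcomplex, since the differential of a convolution never
    moves to an earlier term. *)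
Lemma dif_meta : mdif Q ** meta = meta ** dE.
Proof.
have [_ lQ _] := symQ_precpx; have [_ cdiag _ clow] := cQ.
apply: mor_eq => x z; rewrite (@mcomp_partr R n _ _ _ _ _ x (qlast x)) //.
rewrite /mdif mor_ofE //.
have [h|h] := eqVneq (val (tag z)) (2 * n).-1; last first.
  rewrite mcomp_partl0; last by move=> y [e]; case/eqP: h; rewrite -e.
  case: eqP => [e|_]; last by rewrite hcomp0l.
  rewrite (_ : cls _ = 0) ?hcomp0l //.
  case: z h e => m y /= h e; rewrite (cls_meq (g := [::])) //.
  apply: (clow i_last m x y) => /=; last exact: e.
  by rewrite ltn_neqAle h /=; have := ltn_ord m; lia.
rewrite (qlastP h); set y : gens K := tagged z.
rewrite (@mcomp_partl R n _ _ _ _ _ _ (y : gens E0) (qlast y)) //; last first.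
  move=> y' e.
  (* All terms of the convolution have the generators of K, so the second
     component is a function to a fixed type. *)
  exact: (congr1 (fun o : option (gens Q) =>
    if o is Some z then (tagged z : gens K) else y) e).
rewrite mor_ofE; last exact: symE0_fin.
rewrite !hd_last; case: eqP => [e|_]; last by rewrite hcomp0l hcomp0r.
rewrite (cls_meq (g := @dif R E0 x y)).
  by rewrite hcomp_lid_eqr ?dg_last // hcomp_lid_eql // dg_last.
have := cdiag i_last x y e.
by rewrite psign_last lscale1 dif_last.
Qed.

(** The first term is a quotient complex for the same reason.  The sign comes from its
    odd position 1 - 2n. *)
Lemma dif_meps : meps ** mdif Q = - (dE ** meps).
Proof.
have [_ lQ _] := symQ_precpx; have [_ cdiag _ clow] := cQ.
apply: mor_eq => z y; rewrite entN (@mcomp_partl R n _ _ _ _ _ _ (qfirst y) (y : gens E0)) //; last first.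
  move=> z'; rewrite /eps_part; case: eqP => // h [<-]; exact: qfirstP.
rewrite /mdif mor_ofE //.
have [h|h] := eqVneq (val (tag z)) 0%N; last first.
  rewrite mcomp_partr0 ?oppr0; last by rewrite /eps_part ifN.
  case: eqP => [e|_]; last by rewrite hcomp0r.
  rewrite [X in hcomp _ X](_ : _ = 0) ?hcomp0r //.
  case: z h e => m x h e; rewrite (cls_meq (g := [::])) //.
  apply: (clow m i_first x (y : gens K)); [by rewrite lt0n|exact: e].
rewrite (qfirstP h); set x : gens K := tagged z.
rewrite (@mcomp_partr R n _ _ _ _ _ (qfirst x) (x : gens E0)) //.
rewrite mor_ofE; last exact: symE0_fin.
rewrite !hd_first (_ : (hd y - _ + 1 == _) = (@hd R K y == @hd R K x + 1)); last first.
  by apply/eqP/eqP => e; [apply: (addIr (1 - (2 * n)%:Z)); rewrite addrCA addrC addrA e; ring|rewrite e; ring].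
case: eqP => [e|_]; last by rewrite hcomp0l hcomp0r oppr0.
have := cdiag i_first x y e; rewrite psign_first dif_first => hm.
have [_ /(cobs_lscale (a := -1))] := meq_cobs hm; rewrite lscaleNN => hc.
rewrite (cls_meq hm) cls_opp // hcompNr; congr (- _).
by rewrite hcomp_lid_eqr ?hcomp_lid_eql ?dg_first.
Qed.

(** The signs in [dif_meta] and [dif_meps] are opposite, so del anticommutes with the
    differential. *)
Lemma dif_mdel : mdif Q ** mdel = - (mdel ** mdif Q).
Proof.
rewrite mdelE !mcompNl !mcompNr opprK mcompA dif_meta -!mcompA dif_meps.
by rewrite mcompNr.
Qed.

Local Notation W := (@Defs.periodic R n K D).

Definition miota : mor Q W := mpart (fun z : gens Q => Some ((0%N, z) : gens W)).
Definition mproj : mor W Q :=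
  mpart (fun w : gens W => if w.1 == 0%N then Some (w.2 : gens Q) else None).
Definition mu : mor W W := mpart (fun w : gens W => Some ((w.1.+1, w.2) : gens W)).
Definition mrho : mor W W :=
  mpart (fun w : gens W => if w.1 is k.+1 then Some ((k, w.2) : gens W) else None).

Lemma periodic_rel : [/\ mproj ** miota = mid, mrho ** mu = mid, mproj ** mu = 0,
   mrho ** miota = 0 & miota ** mproj + mu ** mrho = mid].
Proof.
split; rewrite !mpart_comp;
      try by [move=> ? ? [<-]|move=> [[|k] z] w //= [<-]].
- exact: mpart_eq.
- by apply: mpart_eq => -[k z].
- by rewrite -(@mpart_none R n W Q); apply: mpart_eq.
- by rewrite -(@mpart_none R n Q W); apply: mpart_eq.
- apply: mor_eq => -[[|k] z] w; rewrite entD /= /mpart_ent /= ?addr0 //.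
  by rewrite add0r.
Qed.

Lemma periodic_tangle (w : gens W) : tangle n n (dg w).
Proof. by have [tQ _ _] := symQ_precpx; exact: tQ. Qed.

Lemma periodic_mhom : [/\ mhom 0 0 miota, mhom 0 0 mproj,
   mhom (- (2 - (2 * n)%:Z)) (- (2 * n)%:Z) mrho & mhom (2 - (2 * n)%:Z) (2 * n)%:Z mu].
Proof.
have [tQ _ _] := symQ_precpx; have tW := periodic_tangle.
split; apply: mhom_part => //.
- by move=> z w [<-] /=; split=> //; rewrite ?mulr0 !addr0.
- by move=> [[|k] z] w //= [<-]; split=> //; rewrite ?mulr0 !addr0.
- move=> [[|k] z] w //= [<-] /=; rewrite (PoszS k); split=> //; ring.
- move=> [k z] w [<-] /=; rewrite (PoszS k); split=> //; ring.
Qed.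

(** u lowers the homological degree by 2n - 2 > 0, so a given degree of W meets only
    finitely many powers of u, as Q is bounded above. *)
Lemma periodic_fin : fin_fibers W.
Proof.
have [_ lQ _] := symQ_precpx; have [_ [b hb]] := bQ => m.
pose B := `|b - m|%N.
apply: (@sub_finite_set _ _ (\bigcup_(k in [set k | (k < B.+1)%N])
   (pair k @` [set z : gens Q | hd z = m - (2 - (2 * n)%:Z) * k%:Z]))%classic).
  move=> [k z] /= h; exists k => /=; last first.
    by exists z => //=; rewrite -h; ring.
  have hz : @hd R Q z <= b := hb z.
  have n2 : (2 : int) <= n%:Z by rewrite lez_nat.
  (* hd z = m + (2n - 2) k is at most b, and 2n - 2 is positive. *)
  have h2 : k%:Z <= b - m.
    have k0 : (0 : int) <= k%:Z by [].
    move: h hz n2 k0; rewrite /= PoszM; move: (hd _ + position _) => hz0.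
    nia.
  by rewrite ltnS /B -lez_nat; apply: le_trans h2 _; exact: lez_abs.
apply: bigcup_finite; first exact: finite_II.
by move=> k _; apply: finite_image; exact: lQ.
Qed.

Lemma periodic_hom : hom n 1 0 (@dif R W).
Proof.
have [_ _ dQ] := symQ_precpx; have hp := partial_hom.
move=> [k z] [k' z'] /= h; case: eqP => [e|_].
  subst k'; apply: cob_homE (dQ z z' _); first by rewrite /=; ring.
  by apply: (addIr ((2 - (2 * n)%:Z) * k%:Z)); rewrite h /=; ring.
case: eqP => [e|//]; subst k'; apply: cob_homE (hp z z' _).
  by rewrite (PoszS k) /=; ring.
by apply: (addIr ((2 - (2 * n)%:Z) * k.+1%:Z)); rewrite h /= (PoszS k); ring.
Qed.

Lemma periodic_precpx : is_precpx n W.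
Proof. by split; [exact: periodic_tangle|exact: periodic_fin|exact: periodic_hom]. Qed.

Lemma dif_miota : mdif W ** miota = miota ** mdif Q + mu ** miota ** mdel.
Proof.
have [_ lQ _] := symQ_precpx; have lW := periodic_fin.
rewrite mpart_comp //; last by move=> ? ? [<-].
apply: mor_eq => z [k z']; rewrite entD (@mcomp_partr R n _ _ _ _ _ z ((0%N, z) : gens W) ((k, z') : gens W)) //.
rewrite hcomp1r /mdif !mor_ofE //.
case: k => [|[|k]].
- rewrite [X in _ = _ + X]mcomp_partl0 // addr0.
  rewrite (@mcomp_partl R n _ _ _ _ _ _ z' ((0%N, z') : gens W)) //; last by move=> y' [].
  by rewrite mor_ofE //= !mulr0 !addr0; case: eqP => [_|_]; rewrite ?hcomp0r //; symmetry; exact: hcomp1l.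
- rewrite [X in _ = X + _]mcomp_partl0 // add0r.
  rewrite (@mcomp_partl R n _ _ _ _ _ _ z' ((1%N, z') : gens W)) //; last by move=> y' [].
  rewrite /mdel mor_ofE //= mulr0 mulr1 addr0.
  rewrite (_ : (_ + (2 - (2 * n)%:Z) == _) = (@hd R Q z' == @hd R Q z + ((2 * n)%:Z - 1))); last first.
    by apply/eqP/eqP => /= e; [apply: (addIr (2 - (2 * n)%:Z)); rewrite e; ring|rewrite e; ring].
  by case: eqP => [_|_]; rewrite ?hcomp0r //; symmetry; exact: hcomp1l.
- by rewrite !mcomp_partl0 // addr0 /=; case: ifP.
Qed.

Lemma dif_mu : mdif W ** mu = mu ** mdif W.
Proof.
have lW := periodic_fin; apply: mor_eq => -[k z] [k' z'].
rewrite (@mcomp_partr R n _ _ _ _ _ ((k, z) : gens W) ((k.+1, z) : gens W) ((k', z') : gens W)) //.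
rewrite hcomp1r /mdif mor_ofE //.
case: k' => [|k'].
  by rewrite mcomp_partl0 //=; case: ifP.
rewrite (@mcomp_partl R n _ _ _ _ _ _ ((k', z') : gens W) ((k'.+1, z') : gens W)) //; last first.
  by move=> [k1 z1] [-> ->].
rewrite mor_ofE //=.
rewrite (_ : (_ + _ * (k'.+1)%:Z == _) = (@hd R W ((k', z') : gens W) == @hd R W ((k, z) : gens W) + 1)); last first.
  rewrite /= -!(addn1 k) -!(addn1 k') !PoszD.
  by apply/eqP/eqP => /= e; [apply: (addIr (2 - (2 * n)%:Z)); rewrite mulrDr mulr1 addrA in e; rewrite e; ring
     |rewrite mulrDr mulr1 addrA e; ring].
rewrite !eqSS; case: eqP => [_|_]; rewrite ?hcomp0r //; symmetry; exact: hcomp1l.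
Qed.

Lemma mul_u_hom : hom n (2 - (2 * n)%:Z) (2 * n)%:Z (@mul_u R n K D).
Proof.
move=> [k z] [k' z'] h; rewrite /mul_u; case: ifP => // /andP[/eqP /= e1 /eqP /= e2].
subst k' z'; apply: cob_homE (cob_hom_lid 0 (periodic_tangle ((k, z) : gens W))).
by rewrite /= (PoszS k); ring.
Qed.

Lemma mul_u_mor : mor_of (2 - (2 * n)%:Z) (@mul_u R n K D) = mu.
Proof.
have lW := periodic_fin; apply: mor_eq => -[k z] [k' z']; rewrite mor_ofE // /mul_u /mu /= /mpart_ent.
rewrite (_ : (Some _ == Some _) = (k' == k.+1) && (z' == z)); last first.
  by apply/idP/idP => [/eqP[-> ->]|/andP[/eqP-> /eqP->]]; rewrite !eqxx.
case: andP => [[/eqP-> /eqP->]|_]; last by case: ifP.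
by rewrite ifT //; apply/eqP; rewrite (PoszS k); ring.
Qed.
End Symmetric.

Theorem theorem1p4 (R : realType) (n : nat) (n_ge2 : (2 <= n)%N)
    (Q : symmetric_projector R n)
    (P : cpx R) (iota : gmap (unit_cpx n) P) (P_CK : CK_projector iota)
    (phi : gmap (sp_periodic Q) P) (psi : gmap P (sp_periodic Q))
    (phi_equiv : homotopy_inverse n phi psi) :
  homotopy_equiv n (sp_cpx Q)
    (cone (2 - (2 * n)%:Z) (2 * n)%:Z (U_map phi psi)).
Proof.
case: Q phi psi phi_equiv => K io KCK D cQ bQ phi psi pe.
rewrite /sp_periodic /sp_cpx /U_map /= in phi psi pe *.
have lK : fin_fibers K by have [[[_ lK _ _] _] _ _ _] := KCK.
have [[cP _] _ _ _] := P_CK; have gP := is_cpx_precpx cP; have [tP lP dP] := gP.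
have gW := periodic_precpx n_ge2 lK bQ; have [tW lW dW] := gW.
have [hphi hpsi _ _] := pe.
have [h [h' [hh hh' Hh Hh']]] := homotopy_inverseP gW gP pe.
have dphi := (chain_mapP gW gP hphi.1).1 hphi.
have dpsi := (chain_mapP gP gW hpsi.1).1 hpsi.
have hu := mul_u_hom bQ.
have heven : psign (2 - (2 * n)%:Z) = 1.
  rewrite /psign (_ : 2 - (2 * n)%:Z = - (2 * n.-1)%:Z); last by lia.
  by rewrite abszN absz_nat -signr_odd (_ : odd _ = false) //; lia.
have huP := hom_gcomp lW hpsi.1 hu; have hU := hom_gcomp lW huP hphi.1.
rewrite !add0r !addr0 in huP hU.
have eU : mor_of n (2 - (2 * n)%:Z) (gcomp (2 - (2 * n)%:Z) phi (gcomp 0 (@mul_u R n K D) psi)) =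
    mcomp (mcomp (mor_of n 0 phi) (mu D)) (mor_of n 0 psi).
  rewrite -mcompA -(mul_u_mor n_ge2 bQ).
  rewrite -(mor_of_comp lW lW (hom_gcobs hpsi.1) (hom_gcobs hu)) add0r.
  by rewrite -(mor_of_comp lW lP (hom_gcobs huP) (hom_gcobs hphi.1)) addr0.
apply: mheq_homotopy_equiv; [exact: symQ_precpx|exact: cone_precpx|].
rewrite (@cone_mdif R n _ _ _ _ _ gP gP heven) eU.
have [hio hpr hrho hmu] := periodic_mhom bQ.
have step1 := mheq_cone_quotient
   (cone_biproduct n (2 - (2 * n)%:Z) (2 * n)%:Z (@mul_u R n K D))
   (cone_mhom (2 - (2 * n)%:Z) (2 * n)%:Z (@mul_u R n K D) tW tW) _
   (periodic_rel D) (dif_miota n_ge2 bQ) (dif_mu n_ge2 bQ)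
   (dif_mdel n_ge2 lK cQ bQ) (mdel_sq n_ge2 lK bQ).
apply: (mheq_trans (step1 _)).
  split=> //; apply: mhomE (mdel_hom n_ge2 lK bQ) => //; ring.
apply: mheq_cone_conj Hh Hh' => //.
- exact: cone_biproduct.
- exact: cone_biproduct.
- exact: cone_mhom.
- exact: cone_mhom.
- split=> //; apply: mhom_of => //; [exact: hphi.1|exact: hpsi.1].
- exact: dif_mu.
- exact: mdif_sq.
Qed.
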